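(* Let $(E_t,\beta_{s,t})_{s,t\in\mathbb{Q}_+}$ be a rational-time subproduct system (of two-dimensional complex Hilbert spaces) admitting a representation in some Arveson system. Then there exist vectors $x_t,y_t\in E_t$ for $t\in\mathbb{Q}_+$ such that one and only one of the following two conditions is satisfied. (1) There exists $a\in(0,1)$ such that for all $s,t\in\mathbb{Q}_+$: $\|x_t\|=\|y_t\|=1$, $\langle x_t,y_t\rangle=a^t$, $\beta_{s,t}(x_{s+t})=x_s\otimes x_t$, $\beta_{s,t}(y_{s+t})=y_s\otimes y_t$. (3) There exist $c\in(0,\infty)$ and $b\in\mathbb{R}$ such that for all $s,t\in\mathbb{Q}_+$: $\|x_t\|=1$, $\langle x_t,y_t\rangle=0$, $$\|y_t\|^2=\begin{cases}t&\text{if }c=1,\\ (c^{2t}-1)/(c^2-1)&\text{if }c\neq1,\end{cases}$$ $\beta_{s,t}(x_{s+t})=x_s\otimes x_t$, and $\beta_{s,t}(y_{s+t})=y_s\otimes x_t+c^s e^{\mathrm{i}bs}\,x_s\otimes y_t$.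
   Context: Notation: $\mathbb{Q}_+=\mathbb{Q}\cap(0,\infty)$; $\mathbf 1_t$ is the identity map of $E_t$. A rational-time subproduct system consists of two-dimensional complex Hilbert spaces $E_t$ for $t\in\mathbb{Q}_+$ and isometric linear maps $\beta_{s,t}:E_{s+t}\to E_s\otimes E_t$ for $s,t\in\mathbb{Q}_+$ satisfying $(\beta_{r,s}\otimes\mathbf 1_t)\beta_{r+s,t}=(\mathbf 1_r\otimes\beta_{s,t})\beta_{r,s+t}$ for all $r,s,t\in\mathbb{Q}_+$. An Arveson system (product system of Hilbert spaces, in Arveson's sense) consists of separable Hilbert spaces $\tilde E_t$, $t\in(0,\infty)$, and unitary operators $\tilde\beta_{s,t}:\tilde E_{s+t}\to\tilde E_s\otimes\tilde E_t$, $s,t\in(0,\infty)$, satisfying the associativity condition $(\tilde\beta_{r,s}\otimes\mathbf 1)\tilde\beta_{r+s,t}=(\mathbf 1\otimes\tilde\beta_{s,t})\tilde\beta_{r,s+t}$, together with the usual measurability requirements: the disjoint union $\{(t,f):t>0,\,f\in\tilde E_t\}$ carries a standard Borel structure for which it is isomorphic, as a measurable family of Hilbert spaces, to the trivial family $(0,\infty)\times H$ with $H$ a separable infinite-dimensional Hilbert space, and the multiplication $((s,f),(t,g))\mapsto(s+t,\tilde\beta_{s,t}^{-1}(f\otimes g))$ is Borel measurable. A representation of $(E_t,\beta_{s,t})$ in $(\tilde E_t,\tilde\beta_{s,t})$ is a family of linear isometric embeddings $\alpha_t:E_t\to\tilde E_t$, $t\in\mathbb{Q}_+$, such that $\tilde\beta_{s,t}\alpha_{s+t}=(\alpha_s\otimes\alpha_t)\beta_{s,t}$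 for all $s,t\in\mathbb{Q}_+$. *)

(* Defs.v *)
From HB Require Import structures.
From mathcomp Require Import all_boot all_order all_algebra.
From mathcomp Require Import complex ring.
From mathcomp Require Import all_classical all_reals all_analysis.
Set Implicit Arguments. Unset Strict Implicit. Unset Printing Implicit Defensive.
Import Order.TTheory GRing.Theory Num.Theory Num.Def.
Import numFieldNormedType.Exports.
Local Open Scope classical_set_scope.
Local Open Scope complex_scope.
Local Open Scope ring_scope.

(* inner is linear in its first argument and conjugate-linear in its second; as
   in every normedModType R[i], norms are R[i]-valued. *)
HB.mixin Record isHilbert (R : realType) H & CompleteNormedModule R[i] H := {
  inner : {dot H for conjC} ;
  inner_norm : forall x : H, inner x x = `|x| ^+ 2 }.
#[short(type="hilbertType")]
HB.structure Definition Hilbert (R : realType) :=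
  {H of CompleteNormedModule R[i] H & isHilbert R H}.

Section ComplexLimits.
Variable R : realType.
Local Notation C := R[i].

Lemma gt0_complexE (e : C) : 0 < e -> exists2 r : R, 0 < r & e = r%:C.
Proof.
move=> e0; exists (complex.Re e).
  by move: e0; rewrite ltcE /= => /andP[].
by rewrite RRe_real// gtr0_real.
Qed.

Lemma cvgC_distP (u : nat -> C^o) (l : C^o) :
  (u @ \oo --> l) <->
  forall e : C, 0 < e -> exists N, forall n, (N <= n)%N -> `|l - u n| < e.
Proof.
split=> [/cvgrPdist_lt h e e0|h].
  by have [N _ hN] := h e e0; exists N => n /hN.
apply/cvgrPdist_lt => e e0; have [N hN] := h e e0.
by exists N => // n /hN.
Qed.

Lemma cvgC_unique (u : nat -> C^o) (l l' : C^o) :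
  u @ \oo --> l -> u @ \oo --> l' -> l = l'.
Proof. by move=> h h'; rewrite -(cvg_lim (@norm_hausdorff _ C^o) h) (cvg_lim (@norm_hausdorff _ C^o) h'). Qed.

Lemma distC_conj (x y : C) : `|x^*%R - y^*%R| = `|x - y|.
Proof.
have -> : x^*%R - y^*%R = (x - y)^*%R by rewrite [RHS]raddfB.
exact: norm_conjC.
Qed.

Lemma cvgC_conj (u : nat -> C^o) (l : C^o) :
  u @ \oo --> l -> (fun n => conjC (u n : C) : C^o) @ \oo --> (conjC (l : C) : C^o).
Proof.
move=> /cvgC_distP h; apply/cvgC_distP => e /h[N hN].
by exists N => n /hN; congr (_ < _); rewrite -[LHS]distC_conj.
Qed.

Lemma cauchyC_cvg (u : nat -> C^o) :
  (forall e : C, 0 < e -> exists N, forall n m, (N <= n)%N -> (N <= m)%N ->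
     `|u n - u m| < e) -> exists l : C^o, u @ \oo --> l.
Proof.
move=> hu.
have cvgR (p : C -> R) : (forall x y : C, p (x - y) = p x - p y) ->
    (forall x : C, (`|p x|)%:C <= `|x|) ->
    exists l : R, (p \o u) @ \oo --> l.
  move=> pB ple; apply/cvg_ex; apply: cauchy_cvg.
  apply/cauchy_exP => e e0; have e0C : 0 < e%:C :> C by rewrite ltcR.
  have [N hN] := hu _ e0C; exists (p (u N)); exists N => // n /= Nn.
  rewrite /ball/= -ltcR; apply: le_lt_trans (hN N n _ _) => //.
  by rewrite -pB.
have [a ha] := cvgR (@complex.Re R) (raddfB _) (@normc_ge_Re R).
have [b hb] : exists l : R, (@complex.Im R \o u) @ \oo --> l.
  apply: cvgR => [x y|x]; first by case: x y => ? ? [].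
  have := normc_ge_Re (- 'i%C * x); rewrite normrM normrN.
  have -> : `|'i%C : C| = 1 by rewrite normc_def /= expr0n expr1n add0r sqrtr1.
  rewrite mul1r; case: x => x y /=.
  by rewrite oppr0 mul0r sub0r mulN1r opprK.
exists (a +i* b); apply/cvgC_distP => e /gt0_complexE[r r0 ->].
have r20 : 0 < r / 2 by rewrite divr_gt0.
have /cvgrPdist_lt/(_ _ r20)[N _ hN] := ha.
have /cvgrPdist_lt/(_ _ r20)[M _ hM] := hb.
exists (maxn N M) => n; rewrite geq_max => /andP[/hN/= n1 /hM/= n2].
have -> : (a +i* b) - u n =
    (a - complex.Re (u n))%:C + 'i%C * (b - complex.Im (u n))%:C.
  by rewrite [LHS]complexE; case: (u n).
apply: le_lt_trans (ler_normD _ _) _.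
rewrite normrM.
have -> : `|'i%C : C| = 1 by rewrite normc_def /= expr0n expr1n add0r sqrtr1.
rewrite mul1r !normc_def /= expr0n /= !addr0 !sqrtr_sqr -rmorphD ltcR.
by rewrite [ltRHS]splitr ltrD.
Qed.
End ComplexLimits.

Section PreHilbert.
Variables (R : realType) (V : lmodType R[i]) (d : {dot V for conjC}).
Local Notation C := R[i].

Definition pnorm (v : V) : C := sqrtC (d v v).

Lemma pnorm_ge0 v : 0 <= pnorm v.
Proof. exact: sqrt_dnorm_ge0. Qed.

Lemma dnormK v : pnorm v ^+ 2 = d v v.
Proof. exact: sqrtCK. Qed.

Lemma dotC u v : d u v = (d v u)^*%R.
Proof. by rewrite (hermC d) expr0 mul1r. Qed.

Lemma dotZr a u v : d u (a *: v) = a^*%R * d u v.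
Proof. exact: linearZr_LR. Qed.

Lemma dotZl a u v : d (a *: u) v = a * d u v.
Proof. exact: linearZl_LR. Qed.

Lemma dotDl u v w : d (u + v) w = d u w + d v w.
Proof. exact: linearDl. Qed.

Lemma dotDr u v w : d w (u + v) = d w u + d w v.
Proof. exact: linearDr. Qed.

Lemma dotBl u v w : d (u - v) w = d u w - d v w.
Proof. exact: linearBl. Qed.

Lemma dotBr u v w : d w (u - v) = d w u - d w v.
Proof. exact: linearBr. Qed.

Lemma dot_CS u v : `|d u v| <= pnorm u * pnorm v.
Proof.
have [->|v0] := eqVneq v 0.
  by rewrite linear0r normr0 mulr_ge0 ?pnorm_ge0.
have vv0 : 0 < d v v by rewrite dnorm_gt0.
rewrite -(@ler_pXn2r _ 2)// ?nnegrE ?mulr_ge0 ?pnorm_ge0//.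
rewrite exprMn !dnormK.
have := dnorm_ge0 d (u - (d u v / d v v) *: v).
rewrite dnormB dnormZ dotZr rmorphM fmorphV/= -(dotC v v).
have -> : (d u v)^*%R / d v v * d u v = `|d u v| ^+ 2 / d v v.
  by rewrite normCK mulrAC [_^* * _]mulrC.
have -> : (`|d u v| ^+ 2 / d v v)^*%R = `|d u v| ^+ 2 / d v v.
  by apply/CrealP; rewrite ger0_real// divr_ge0 ?exprn_ge0// ltW.
rewrite normrM normfV (gtr0_norm vv0) exprMn -mulrA.
have -> : (d v v)^-1 ^+ 2 * d v v = (d v v)^-1.
  by rewrite expr2 -mulrA mulVf ?mulr1// gt_eqF.
rewrite opprD addrA addrK subr_ge0 ler_pdivrMr//.
Qed.

Lemma ler_dnormD u v : pnorm (u + v) <= pnorm u + pnorm v.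
Proof.
rewrite -(@ler_pXn2r _ 2)// ?nnegrE ?addr_ge0 ?pnorm_ge0//.
rewrite dnormK dnormD sqrrD !dnormK addrAC lerD2r lerD2l.
have : d u v + (d u v)^*%R <= `|d u v| *+ 2.
  apply: le_trans (real_ler_norm _) _.
    apply/CrealP; rewrite rmorphD/= conjCK addrC//.
  by apply: le_trans (ler_normD _ _) _; rewrite norm_conjC mulr2n.
move=> /le_trans; apply; rewrite ler_pMn2r//; exact: dot_CS.
Qed.

Lemma pnormZ a v : pnorm (a *: v) = `|a| * pnorm v.
Proof.
apply/eqP; rewrite -(@eqrXn2 _ 2)// ?mulr_ge0 ?pnorm_ge0//.
by rewrite exprMn !dnormK dnormZ.
Qed.

Lemma dnorm0_eq0 v : pnorm v = 0 -> v = 0.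
Proof. by move=> /eqP; rewrite sqrt_dnorm_eq0 => /eqP. Qed.

Lemma pnormN v : pnorm (- v) = pnorm v.
Proof. by rewrite -scaleN1r pnormZ normrN1 mul1r. Qed.

Lemma dnorm_distC u v : pnorm (u - v) = pnorm (v - u).
Proof. by rewrite -pnormN opprB. Qed.

End PreHilbert.

Section CompletionDef.
Variables (R : realType) (V : lmodType R[i]) (d : {dot V for conjC}).
Local Notation C := R[i].

Definition dcauchy (v : nat -> V) := forall e : C, 0 < e -> exists N,
  forall n m, (N <= n)%N -> (N <= m)%N -> pnorm d (v n - v m) < e.

Definition dnull (v : nat -> V) := forall e : C, 0 < e -> exists N,
  forall n, (N <= n)%N -> pnorm d (v n) < e.

(* A Cauchy sequence v of the pre-Hilbert space V is identified with the
   functional w |-> lim_n <v_n, w>; the completion is the space of these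
   functionals, so no quotient by null sequences is needed. *)
Definition represents (v : nat -> V) (phi : V -> C) :=
  dcauchy v /\ forall w, (fun n => d (v n) w : C^o) @ \oo --> (phi w : C^o).

Definition in_completion : {pred V -> C} :=
  fun phi => `[< exists v, represents v phi >].

Lemma dcauchy_bounded v : dcauchy v ->
  exists2 M : C, 0 < M & forall n, pnorm d (v n) <= M.
Proof.
move=> /(_ 1 ltr01)[N hN].
pose M := \sum_(n < N) pnorm d (v n) + (pnorm d (v N) + 1).
have M0 : 0 <= \sum_(n < N) pnorm d (v n).
  by apply: sumr_ge0 => i _; exact: pnorm_ge0.
exists M; first by rewrite ltr_wpDl// ltr_wpDl// pnorm_ge0.
move=> n; have [nN|nN] := ltnP n N.
  rewrite /M (bigD1 (Ordinal nN))//= -addrA lerDl.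
  rewrite addr_ge0 ?addr_ge0 ?pnorm_ge0//.
  by apply: sumr_ge0 => i _; exact: pnorm_ge0.
rewrite /M -[leLHS]add0r lerD//.
have -> : v n = v N + (v n - v N) by rewrite addrC subrK.
apply: le_trans (ler_dnormD _ _ _) _; rewrite lerD2l.
exact/ltW/hN.
Qed.

Lemma dcauchyD u v : dcauchy u -> dcauchy v -> dcauchy (fun n => u n + v n).
Proof.
move=> hu hv e e0; have e20 : 0 < e / 2 by rewrite divr_gt0.
have [N hN] := hu _ e20; have [M hM] := hv _ e20.
exists (maxn N M) => n m; rewrite !geq_max => /andP[n1 n2] /andP[m1 m2].
rewrite opprD addrACA; apply: le_lt_trans (ler_dnormD _ _ _) _.
by rewrite [ltRHS]splitr ltrD// ?hN ?hM.
Qed.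

Lemma dcauchyZ a v : dcauchy v -> dcauchy (fun n => a *: v n).
Proof.
move=> hv e e0; have a0 : 0 < `|a| + 1 by rewrite ltr_wpDl.
have [N hN] := hv (e / (`|a| + 1)) (divr_gt0 e0 a0); exists N => n m n1 m1.
rewrite -scalerBr pnormZ.
apply: (@le_lt_trans _ _ ((`|a| + 1) * pnorm d (v n - v m))).
  by rewrite ler_wpM2r ?pnorm_ge0// lerDl.
by rewrite mulrC -ltr_pdivlMr// hN.
Qed.

Lemma representsD u v phi psi : represents u phi -> represents v psi ->
  represents (fun n => u n + v n) (phi + psi).
Proof.
move=> [hu hphi] [hv hpsi]; split; first exact: dcauchyD.
move=> w; under eq_fun do rewrite linearDl.
exact: (@cvgD _ C^o _ _ _ _ _ _ _ (hphi w) (hpsi w)).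
Qed.

Lemma representsZ a v phi : represents v phi ->
  represents (fun n => a *: v n) (a *: phi).
Proof.
move=> [hv hphi]; split; first exact: dcauchyZ.
move=> w; under eq_fun do rewrite dotZl.
exact: (@cvgZl_tmp C C^o _ _ _ a (fun n => d (v n) w) (phi w) (hphi w)).
Qed.

Lemma represents_const v : represents (fun=> v) (d v).
Proof.
split=> [e e0|w]; last exact: cvg_cst.
by exists 0%N => n m _ _; rewrite subrr /pnorm linear0l sqrtC0.
Qed.

Lemma represents0 : represents (fun=> 0) 0.
Proof.
have := represents_const 0; congr represents.
by apply/funext => w; rewrite linear0l.
Qed.

Lemma represents_null v : represents v 0 -> dnull v.
Proof.
move=> [hv h0] e e0; have [M M0 hM] := dcauchy_bounded hv.
have e1 : 0 < e ^+ 2 / 2 by rewrite divr_gt0 ?exprn_gt0.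
have [N hN] := hv _ (divr_gt0 e1 M0).
exists N => n Nn.
rewrite -(@ltr_pXn2r _ 2)// ?nnegrE ?pnorm_ge0 ?(ltW e0)// dnormK.
have /cvgC_distP/(_ _ e1)[K hK] := h0 (v n).
pose k := maxn N K; have := hK k (leq_maxr _ _).
rewrite sub0r normrN => lt1.
have -> : d (v n) (v n) = d (v n - v k) (v n) + d (v k) (v n).
  by rewrite -linearDl subrK.
have vv : d (v n - v k) (v n) + d (v k) (v n) = d (v n) (v n).
  by rewrite -linearDl subrK.
rewrite vv -(ger0_norm (dnorm_ge0 d (v n))) -vv.
apply: le_lt_trans (ler_normD _ _) _; rewrite [ltRHS]splitr ler_ltD//.
apply: le_trans (dot_CS _ _ _) _.
apply: le_trans (_ : e ^+ 2 / 2 / M * M <= _); last first.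
  by rewrite divfK ?gt_eqF.
by rewrite ler_pM ?pnorm_ge0// ltW// hN// leq_maxl.
Qed.

Lemma dcauchy_dot v u : dcauchy v -> dcauchy u ->
  exists l : C^o, (fun n => d (v n) (u n) : C^o) @ \oo --> l.
Proof.
move=> hv hu; apply: cauchyC_cvg => e e0.
have [M M0 hM] := dcauchy_bounded hv; have [K K0 hK] := dcauchy_bounded hu.
have e20 : 0 < e / 2 by rewrite divr_gt0.
have [N1 h1] := hv _ (divr_gt0 e20 K0); have [N2 h2] := hu _ (divr_gt0 e20 M0).
exists (maxn N1 N2) => n m; rewrite !geq_max => /andP[n1 n2] /andP[m1 m2].
have -> : d (v n) (u n) - d (v m) (u m) =
    d (v n - v m) (u n) + d (v m) (u n - u m).
  by rewrite linearBl linearBr addrA subrK.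
apply: le_lt_trans (ler_normD _ _) _; rewrite [ltRHS]splitr ltrD//.
  apply: le_lt_trans (dot_CS _ _ _) _.
  apply: (@le_lt_trans _ _ (pnorm d (v n - v m) * K)).
    by rewrite ler_wpM2l ?pnorm_ge0.
  by rewrite -ltr_pdivlMr// h1.
apply: le_lt_trans (dot_CS _ _ _) _.
apply: (@le_lt_trans _ _ (M * pnorm d (u n - u m))).
  by rewrite ler_wpM2r ?pnorm_ge0.
by rewrite mulrC -ltr_pdivlMr// h2.
Qed.

Lemma in_completionP phi :
  reflect (exists v, represents v phi) (phi \in in_completion).
Proof. exact: asboolP. Qed.

Lemma in_completion_submod : submod_closed in_completion.
Proof.
split=> [|a phi psi /in_completionP[u hu] /in_completionP[v hv]].
  by apply/in_completionP; exists (fun=> 0); exact: represents0.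
apply/in_completionP; exists (fun n => a *: u n + v n).
exact: (representsD (representsZ a hu) hv).
Qed.

HB.instance Definition _ := GRing.isSubmodClosed.Build C (V -> C) in_completion
  in_completion_submod.

Record completion := Completion {
  completion_fun :> V -> C ; completion_prop : completion_fun \in in_completion }.

HB.instance Definition _ := [isSub for completion_fun].
HB.instance Definition _ := [Choice of completion by <:].
HB.instance Definition _ := [SubChoice_isSubLmodule of completion by <:].

End CompletionDef.

Section CompletionInner.
Variables (R : realType) (V : lmodType R[i]) (d : {dot V for conjC}).
Local Notation C := R[i].
Local Notation W := (completion d).

Definition rseq (phi : W) : nat -> V :=
  projT1 (cid (elimT (in_completionP _ _) (completion_prop phi))).

Lemma rseqP phi : represents d (rseq phi) phi.
Proof. by rewrite /rseq; case: cid. Qed.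

Definition cinner (phi psi : W) : C :=
  lim ((fun n => d (rseq phi n) (rseq psi n) : C^o) @ \oo).

Lemma cinner_cvg (phi psi : W) u v : represents d u phi -> represents d v psi ->
  (fun n => d (u n) (v n) : C^o) @ \oo --> (cinner phi psi : C^o).
Proof.
move=> hu hv.
have [l hl] := dcauchy_dot (proj1 (rseqP phi)) (proj1 (rseqP psi)).
have -> : cinner phi psi = l by exact: (cvg_lim (@norm_hausdorff _ C^o) hl).
have repB x y (f : W) : represents d x f -> represents d y f ->
    dnull d (fun n => x n - y n).
  move=> hx hy; apply: represents_null.
  have := representsD hx (representsZ (-1) hy); congr represents.
    by apply/funext => n; rewrite scaleN1r.
  by apply/funext => w /=; rewrite [LHS]/GRing.add/= scaleN1r subrr.
have hn1 := repB _ _ _ (rseqP phi) hu; have hn2 := repB _ _ _ (rseqP psi) hv.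
have [M M0 hM] := dcauchy_bounded (proj1 hu).
have [K K0 hK] := dcauchy_bounded (proj1 (rseqP psi)).
apply/cvgC_distP => e e0.
have e20 : 0 < e / 2 by rewrite divr_gt0.
have e40 : 0 < e / 2 / 2 by rewrite divr_gt0.
have /cvgC_distP/(_ _ e20)[N0 h0] := hl.
have [N1 h1] := hn1 _ (divr_gt0 e40 K0).
have [N2 h2] := hn2 _ (divr_gt0 e40 M0).
exists (maxn N0 (maxn N1 N2)) => n; rewrite !geq_max => /and3P[n0 n1 n2].
have -> : l - d (u n) (v n) = l - d (rseq phi n) (rseq psi n) +
    (d (rseq phi n - u n) (rseq psi n) + d (u n) (rseq psi n - v n)).
  by rewrite linearBl linearBr !subrKA.
apply: le_lt_trans (ler_normD _ _) _; rewrite [ltRHS]splitr ltrD ?h0//.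
apply: le_lt_trans (ler_normD _ _) _; rewrite [ltRHS]splitr ltrD//.
  apply: le_lt_trans (dot_CS _ _ _) _.
  apply: (@le_lt_trans _ _ (pnorm d (rseq phi n - u n) * K)).
    by rewrite ler_wpM2l ?pnorm_ge0.
  by rewrite -ltr_pdivlMr// h1.
apply: le_lt_trans (dot_CS _ _ _) _.
apply: (@le_lt_trans _ _ (M * pnorm d (rseq psi n - v n))).
  by rewrite ler_wpM2r ?pnorm_ge0.
by rewrite mulrC -ltr_pdivlMr// h2.
Qed.

Lemma cinner_unique (phi psi : W) u v (l : C^o) :
  represents d u phi -> represents d v psi ->
  (fun n => d (u n) (v n) : C^o) @ \oo --> l -> cinner phi psi = l.
Proof.
by move=> hu hv; apply: cvgC_unique; exact: cinner_cvg.
Qed.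

Lemma rseq_lin a (phi psi : W) :
  represents d (fun n => a *: rseq phi n + rseq psi n) (a *: phi + psi : W).
Proof.
have -> : ((a *: phi + psi : W) : V -> C) =
  a *: (phi : V -> C) + (psi : V -> C) by [].
by apply: representsD (rseqP _); apply: representsZ (rseqP _).
Qed.

Lemma cinner_lin (a : C) (phi chi psi : W) :
  cinner (a *: phi + chi) psi = a * cinner phi psi + cinner chi psi.
Proof.
apply: (cinner_unique (rseq_lin a phi chi) (rseqP psi)).
under eq_fun do rewrite dotDl dotZl.
exact: (@cvgD _ C^o _ _ _ _ _ _ _
  (@cvgZl_tmp C C^o _ _ _ a _ _ (cinner_cvg (rseqP phi) (rseqP psi)))
  (cinner_cvg (rseqP chi) (rseqP psi))).
Qed.

Lemma cinner_linl psi : linear_for *%R (cinner ^~ psi).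
Proof. by move=> a phi chi; exact: cinner_lin. Qed.

Lemma cinnerC phi psi : cinner phi psi = (cinner psi phi)^*%R.
Proof.
apply: (cinner_unique (rseqP phi) (rseqP psi)).
have := cvgC_conj (cinner_cvg (rseqP psi) (rseqP phi)).
by under eq_fun do rewrite -(dotC d).
Qed.

Lemma cinner_linr psi : linear_for (conjC \; *%R) (cinner psi).
Proof.
move=> a phi chi; rewrite cinnerC cinner_lin rmorphD rmorphM/=.
by rewrite (cinnerC psi phi) (cinnerC psi chi).
Qed.

HB.instance Definition _ := bilinear_isBilinear.Build C W W C *%R
  (conjC \; *%R) cinner (conj cinner_linl cinner_linr).

Lemma cinner_herm phi psi : cinner phi psi = (-1) ^+ false * (cinner psi phi)^*%R.
Proof. by rewrite expr0 mul1r (cinnerC phi psi). Qed.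

HB.instance Definition _ := isHermitianSesquilinear.Build C W false conjC
  cinner cinner_herm.

Lemma cinner_ge0 phi : 0 <= cinner phi phi.
Proof.
have /cvgC_distP := cinner_cvg (rseqP phi) (rseqP phi).
set l := cinner _ _ => h.
have lr : l \is Num.real by apply/CrealP; rewrite /l -(cinnerC phi phi).
rewrite real_leNgt ?real0//; apply/negP => l0.
have [|N hN] := h (- l); first by rewrite oppr_gt0.
have := hN N (leqnn _).
have x1 := dnorm_ge0 d (rseq phi N).
rewrite ltr0_norm; last by rewrite subr_lt0 (lt_le_trans l0).
by rewrite ltrN2 ltrBrDr gtrDl le_gtF.
Qed.

Lemma cinner_eq0 phi : cinner phi phi = 0 -> phi = 0.
Proof.
move=> h0; apply/val_inj/funext => w /=.
have h := cinner_cvg (rseqP phi) (rseqP phi); rewrite h0 in h.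
apply: (cvgC_unique (proj2 (rseqP phi) w)); apply/cvgC_distP => e e0.
pose K := pnorm d w + 1; have K0 : 0 < K by rewrite ltr_wpDl ?pnorm_ge0.
have e1 : 0 < (e / K) ^+ 2 by rewrite exprn_gt0// divr_gt0.
have /cvgC_distP/(_ _ e1)[N hN] := h; exists N => n /hN.
rewrite !sub0r !normrN ger0_norm ?dnorm_ge0// -dnormK.
rewrite ltr_pXn2r ?nnegrE ?pnorm_ge0 ?divr_ge0 ?(ltW e0) ?(ltW K0)// => hn.
apply: le_lt_trans (dot_CS _ _ _) _.
apply: (@le_lt_trans _ _ (pnorm d (rseq phi n) * K)).
  by rewrite ler_wpM2l ?pnorm_ge0// lerDl.
by rewrite -ltr_pdivlMr.
Qed.

Lemma cinner_gt0 phi : phi != 0 -> 0 < cinner phi phi.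
Proof.
move=> phi0; rewrite lt_def cinner_ge0 andbT.
by apply: contra_neq phi0; exact: cinner_eq0.
Qed.

HB.instance Definition _ := isDotProduct.Build C W cinner cinner_gt0.

End CompletionInner.

Section CompletionHilbert.
Variables (R : realType) (V : lmodType R[i]) (d : {dot V for conjC}).
Local Notation C := R[i].
Local Notation W := (completion d).
Let cdot : {dot W for conjC} := @cinner R V d.

HB.instance Definition _ := Lmodule_isNormed.Build C W
  (ler_dnormD cdot) (pnormZ cdot) (@dnorm0_eq0 _ _ cdot).

Lemma cnormE (phi : W) : `|phi| = pnorm cdot phi.
Proof. by []. Qed.

Lemma cinjection_prop v : d v \in in_completion d.
Proof. by apply/in_completionP; exists (fun=> v); exact: represents_const. Qed.

Definition cinjection v : W := Completion (cinjection_prop v).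

Lemma cinjectionP v : represents d (fun=> v) (cinjection v).
Proof. exact: represents_const. Qed.

Lemma cinjection_linear : linear cinjection.
Proof.
by move=> a u v; apply/val_inj/funext => w /=; rewrite dotDl dotZl.
Qed.

HB.instance Definition _ :=
  GRing.isLinear.Build C V W _ cinjection cinjection_linear.

Lemma cinner_cinjection u v : cdot (cinjection u) (cinjection v) = d u v.
Proof.
exact: (cinner_unique (cinjectionP u) (cinjectionP v) (cvg_cst _)).
Qed.

Lemma norm_cinjection v : `|cinjection v| = pnorm d v.
Proof. by rewrite cnormE {1}/pnorm cinner_cinjection. Qed.

Lemma cnorm_le (phi : W) v (e : C) : 0 <= e -> represents d v phi ->
  (exists N, forall n, (N <= n)%N -> pnorm d (v n) <= e) -> `|phi| <= e.
Proof.
move=> e0 hv [N hN]; rewrite cnormE -(@ler_pXn2r _ 2)// ?nnegrE ?pnorm_ge0//.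
rewrite dnormK; apply/ler_addgt0Pl => r r0.
have /cvgC_distP/(_ _ r0)[M hM] := cinner_cvg hv hv.
rewrite -[X in X <= _]ger0_norm; last exact: cinner_ge0.
pose n := maxn N M.
have -> : cdot phi phi = cinner phi phi - d (v n) (v n) + d (v n) (v n).
  by rewrite subrK.
apply: le_trans (ler_normD _ _) _; rewrite lerD//.
  by apply/ltW/hM; rewrite leq_maxr.
rewrite ger0_norm ?dnorm_ge0// -dnormK.
by rewrite ler_pXn2r ?nnegrE ?pnorm_ge0// hN// leq_maxl.
Qed.

Lemma represents_tail (phi : W) v u : represents d v phi ->
  represents d (fun n => v n - u) (phi - cinjection u : W).
Proof.
move=> hv; have := representsD hv (representsZ (-1) (represents_const d u)).
by rewrite !scaleN1r.
Qed.

Lemma cinjection_dense (phi : W) (e : C) : 0 < e ->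
  exists v, `|phi - cinjection v| <= e.
Proof.
move=> e0; have hv := rseqP phi; have [N hN] := proj1 hv _ e0.
exists (rseq phi N); apply: (cnorm_le (ltW e0) (represents_tail _ hv)).
by exists N => n Nn; apply/ltW/hN.
Qed.

Lemma invn_small (e : C) : 0 < e -> exists N, forall n, (N <= n)%N ->
  n.+1%:R^-1 < e :> C.
Proof.
move=> /gt0_complexE[r r0 ->].
have [N _ hN] := near_infty_natSinv_lt (PosNum r0).
exists N => n /hN /=; rewrite -ltcR rmorphV ?unitfE ?pnatr_eq0//.
by rewrite rmorph_nat.
Qed.

Lemma completion_complete (F : set_system W) :
  ProperFilter F -> cauchy F -> cvg F.
Proof.
move=> FF /cauchyP hF.
have inv0 k : 0 < k.+1%:R^-1 :> C by rewrite invr_gt0 ltr0n.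
have /choice[x hx] : forall k : nat, exists x : W, F (ball x (k.+1%:R^-1 : C)).
  by move=> k; have [x] := hF _ (inv0 k); exists x.
have /choice[v hv] : forall k : nat, exists v : V,
    `|x k - cinjection v| <= k.+1%:R^-1.
  by move=> k; exact: cinjection_dense.
have hxx n m : `|x n - x m| <= n.+1%:R^-1 + m.+1%:R^-1.
  have [y [h1 h2]] : exists y : W, `|x n - y| < n.+1%:R^-1 /\
      `|x m - y| < m.+1%:R^-1.
    have [y []] := filter_ex (filterI (hx n) (hx m)).
    by rewrite -ball_normE /ball_/= => h1 h2; exists y.
  rewrite (_ : x n - x m = (x n - y) + (y - x m)); last by rewrite subrKA.
  apply: le_trans (ler_normD _ _) _.
  by apply: lerD; [exact: ltW|rewrite distrC; exact: ltW].
have vc : dcauchy d v.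
  move=> e e0; have e40 : 0 < e / 2 / 2 by rewrite !divr_gt0.
  have [N hN] := invn_small e40; exists N => n m /hN hn /hN hm.
  rewrite -norm_cinjection raddfB/=.
  have -> : cinjection (v n) - cinjection (v m) =
    (x m - cinjection (v m)) - (x n - cinjection (v n)) + (x n - x m).
    by rewrite opprB -addrA subrKA [RHS]addrC subrKA.
  apply: le_lt_trans (ler_normD _ _) _; rewrite [ltRHS]splitr ltr_leD//.
    apply: le_lt_trans (ler_normB _ _) _; rewrite [ltRHS]splitr ltrD//.
      exact: le_lt_trans (hv m) _.
    exact: le_lt_trans (hv n) _.
  apply: le_trans (hxx n m) _.
  by rewrite [leRHS]splitr lerD// ltW.
have /choice[phi hphi] : forall w : V, exists l : C,
    (fun n => d (v n) w : C^o) @ \oo --> (l : C^o).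
  move=> w; apply: (@dcauchy_dot _ _ _ _ (fun=> w)) => //.
  exact: (proj1 (represents_const d w)).
have rphi : represents d v phi by split.
have pphi : phi \in in_completion d by apply/in_completionP; exists v.
pose p : W := Completion pphi.
apply/cvg_ex; exists p; apply/cvg_ballP => e e0.
have e40 : 0 < e / 2 / 2 by rewrite !divr_gt0.
have [N hN] := invn_small e40; have [M hM] := vc _ e40.
pose n := maxn N M.
have np : `|p - cinjection (v n)| <= e / 2 / 2.
  have rt : represents d (fun k => v k - v n) (p - cinjection (v n) : W).
    exact: (@represents_tail p v (v n) rphi).
  have ht : exists N, forall k, (N <= k)%N -> pnorm d (v k - v n) <= e / 2 / 2.
    by exists M => k Mk; apply/ltW/hM; rewrite ?leq_maxr.
  exact: (cnorm_le (ltW e40) rt ht).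
near=> y.
have hy : `|x n - y| < e / 2 / 2.
  have : ball (x n) (n.+1%:R^-1 : C) y by near: y; exact: hx.
  rewrite -ball_normE /ball_/= => /lt_trans; apply; exact/hN/leq_maxl.
rewrite -ball_normE /ball_/=.
have -> : p - y = (p - cinjection (v n)) + (cinjection (v n) - x n) + (x n - y).
  by rewrite !subrKA.
apply: le_lt_trans (ler_normD _ _) _; rewrite [ltRHS]splitr; apply: ler_ltD.
  apply: le_trans (ler_normD _ _) _; rewrite [leRHS]splitr.
  apply: (lerD np); rewrite distrC; apply: (le_trans (hv n)).
  by apply/ltW/hN; exact: leq_maxl.
apply: (lt_trans hy); rewrite gtr_pMr ?divr_gt0// invf_lt1 ?ltr1n//.
Unshelve. all: by end_near. Qed.

HB.instance Definition _ := Uniform_isComplete.Build W completion_complete.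

Lemma cinner_norm (phi : W) : cdot phi phi = `|phi| ^+ 2.
Proof. by rewrite cnormE dnormK. Qed.

HB.instance Definition _ := isHilbert.Build R W cinner_norm.

End CompletionHilbert.

Section FiniteTensor.
Variables (R : realType) (H K : hilbertType R).
Local Notation C := R[i].

(* The elementary tensor of p.1 and p.2 as the function q |-> <p, q>; the
   algebraic tensor product is the space of finite sums of such functions. *)
Definition pure_form (p : H * K) : H * K -> C :=
  fun q => inner p.1 q.1 * inner p.2 q.2.

Definition form_of (s : seq (H * K)) : H * K -> C :=
  fun q => \sum_(p <- s) pure_form p q.

Definition finite_rank : {pred H * K -> C} :=
  fun f => `[< exists s, f = form_of s >].

Lemma finite_rankP f : reflect (exists s, f = form_of s) (f \in finite_rank).
Proof. exact: asboolP. Qed.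

Lemma form_of_cat s t q : form_of (s ++ t) q = form_of s q + form_of t q.
Proof. by rewrite /form_of big_cat. Qed.

Definition scale_seq (a : C) (s : seq (H * K)) : seq (H * K) :=
  [seq (a *: p.1, p.2) | p <- s].

Lemma form_of_scale a s q : form_of (scale_seq a s) q = a * form_of s q.
Proof.
rewrite /form_of big_map mulr_sumr; apply: eq_bigr => p _.
by rewrite /pure_form/= (dotZl inner) mulrA.
Qed.

Lemma finite_rank_submod : submod_closed finite_rank.
Proof.
split=> [|a f g /finite_rankP[s ->] /finite_rankP[t ->]].
  by apply/finite_rankP; exists [::]; apply/funext => q; rewrite /form_of big_nil.
apply/finite_rankP; exists (scale_seq a s ++ t); apply/funext => q.
by rewrite form_of_cat form_of_scale.
Qed.

HB.instance Definition _ := GRing.isSubmodClosed.Build C (H * K -> C) finite_rank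
  finite_rank_submod.

Record fin_tensor := FinTensor {
  fin_form :> H * K -> C ; fin_formP : fin_form \in finite_rank }.

HB.instance Definition _ := [isSub for fin_form].
HB.instance Definition _ := [Choice of fin_tensor by <:].
HB.instance Definition _ := [SubChoice_isSubLmodule of fin_tensor by <:].

Definition fin_seq (f : fin_tensor) : seq (H * K) :=
  projT1 (cid (elimT (finite_rankP _) (fin_formP f))).

Lemma fin_seqP (f : fin_tensor) : fin_form f = form_of (fin_seq f).
Proof. by rewrite /fin_seq; case: cid. Qed.

Definition seq_dot (s t : seq (H * K)) : C :=
  \sum_(q <- t) \sum_(p <- s) pure_form p q.

Lemma pure_formC p q : pure_form p q = (pure_form q p)^*%R.
Proof.
by rewrite /pure_form rmorphM/= (dotC inner p.1) (dotC inner p.2).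
Qed.

Lemma seq_dotC s t : seq_dot s t = (seq_dot t s)^*%R.
Proof.
rewrite /seq_dot rmorph_sum exchange_big/=; apply: eq_bigr => p _.
by rewrite rmorph_sum; apply: eq_bigr => q _; exact: pure_formC.
Qed.

Lemma seq_dot_cat s s' : seq_dot (s ++ s') (s ++ s') =
  seq_dot s s + seq_dot s' s + (seq_dot s s' + seq_dot s' s').
Proof.
rewrite /seq_dot big_cat/= -!big_split/=.
by congr (_ + _); apply: eq_bigr => q _; rewrite big_cat.
Qed.

Lemma seq_dot_perp s s' : (forall p q, p \in s -> q \in s' -> pure_form p q = 0) ->
  seq_dot s s' = 0.
Proof.
move=> h; rewrite /seq_dot big_seq big1// => q qs'.
by rewrite big_seq big1// => p ps; exact: h.
Qed.

Lemma seq_dot_line s g : seq_dot [seq (p, g) | p <- s] [seq (p, g) | p <- s] =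
  inner (\sum_(p <- s) p) (\sum_(p <- s) p) * inner g g.
Proof.
rewrite /seq_dot big_map linear_sumr mulr_suml; apply: eq_bigr => q _.
rewrite big_map (linear_sumlz inner) mulr_suml; apply: eq_bigr => p _.
by [].
Qed.

(* Positivity of the entrywise product of two Gram matrices: split off the
   component along the second factor g of the first term. *)
Lemma seq_dot_ge0 s : 0 <= seq_dot s s.
Proof.
have [n] := ubnP (size s); elim: n s => [//|n IHn] [|[f g] s] /=.
  by rewrite /seq_dot big_nil.
rewrite ltnS => sn.
have [g0|g0] := eqVneq g 0.
  rewrite -cat1s seq_dot_cat.
  have z p : pure_form (f, g) p = 0 by rewrite /pure_form/= g0 linear0l mulr0.
  rewrite (_ : seq_dot _ [:: _] = 0); last first.
    by rewrite seq_dot_perp// => p q; rewrite inE => /eqP ->.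
  rewrite (_ : seq_dot s [:: _] = 0); last first.
    by rewrite seq_dotC seq_dot_perp ?rmorph0// => p q; rewrite inE => /eqP ->.
  rewrite (_ : seq_dot [:: _] s = 0); last first.
    by rewrite seq_dot_perp// => p q; rewrite inE => /eqP ->.
  by rewrite !add0r IHn.
have gg : inner g g != 0 by rewrite dnorm_eq0.
pose c (p : H * K) : C := inner p.2 g / inner g g.
pose l := [seq (x, g) | x <- f :: [seq c p *: p.1 | p <- s]].
pose m := [seq (p.1, p.2 - c p *: g) | p <- s].
have lm0 p q : p \in l -> q \in m -> pure_form p q = 0.
  move=> /mapP[x _ ->] /mapP[y _ ->]; rewrite /pure_form/=.
  have -> : inner g (y.2 - c y *: g) = 0.
    rewrite (dotBr inner) (dotZr inner) /c rmorphM fmorphV/= -(dotC inner g g).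
    by rewrite divfK// -(dotC inner) subrr.
  by rewrite mulr0.
have E q : form_of ((f, g) :: s) q = form_of (l ++ m) q.
  rewrite form_of_cat /form_of !big_cons big_map big_map big_map -addrA.
  congr (_ + _); rewrite -big_split/=; apply: eq_bigr => p _.
  rewrite /pure_form/= (dotZl inner) (dotBl inner) (dotZl inner).
  by rewrite mulrBr [c p * _]mulrC -mulrA addrC subrK.
have Es t t' : (forall q, form_of t q = form_of t' q) ->
    seq_dot t t = seq_dot t' t'.
  move=> h; rewrite [LHS](_ : _ = seq_dot t' t).
    by rewrite seq_dotC [RHS]seq_dotC; congr conjC; apply: eq_bigr => q _; exact: h.
  by apply: eq_bigr => q _; exact: h.
rewrite (Es _ _ E) seq_dot_cat (seq_dot_perp lm0) add0r.
rewrite (_ : seq_dot m l = 0); last first.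
  by rewrite seq_dotC seq_dot_perp ?rmorph0// => p q pl qm; exact: lm0.
rewrite addr0 addr_ge0//; last by rewrite IHn// size_map.
rewrite seq_dot_line mulr_ge0//; exact: dnorm_ge0.
Qed.

Definition fdot (f g : fin_tensor) : C := \sum_(q <- fin_seq g) f q.

Lemma fdotE f g : fdot f g = seq_dot (fin_seq f) (fin_seq g).
Proof. by apply: eq_bigr => q _; rewrite {1}fin_seqP. Qed.

Lemma fdotC f g : fdot f g = (fdot g f)^*%R.
Proof. by rewrite !fdotE seq_dotC. Qed.

Lemma fdot_lin (a : C) (f f' g : fin_tensor) :
  fdot (a *: f + f') g = a * fdot f g + fdot f' g.
Proof. by rewrite /fdot mulr_sumr -big_split. Qed.

Lemma fdot_linl g : linear_for *%R (fdot ^~ g).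
Proof. by move=> a f f'; exact: fdot_lin. Qed.

Lemma fdot_linr g : linear_for (conjC \; *%R) (fdot g).
Proof.
move=> a f f'; rewrite fdotC fdot_lin rmorphD rmorphM/=.
by rewrite (fdotC g f) (fdotC g f').
Qed.

HB.instance Definition _ := bilinear_isBilinear.Build C fin_tensor fin_tensor C
  *%R (conjC \; *%R) fdot (conj fdot_linl fdot_linr).

Lemma fdot_herm f g : fdot f g = (-1) ^+ false * (fdot g f)^*%R.
Proof. by rewrite expr0 mul1r (fdotC f g). Qed.

HB.instance Definition _ := isHermitianSesquilinear.Build C fin_tensor false conjC
  fdot fdot_herm.

Lemma form_of1 p : form_of [:: p] = pure_form p.
Proof. by apply/funext => q; rewrite /form_of big_seq1. Qed.

Lemma pure_form_finite p : pure_form p \in finite_rank.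
Proof. by apply/finite_rankP; exists [:: p]; rewrite form_of1. Qed.

Definition fin_pure p : fin_tensor := FinTensor (pure_form_finite p).

Lemma fdot_pure f p : fdot f (fin_pure p) = f p.
Proof.
rewrite fdotC /fdot /=.
transitivity ((form_of (fin_seq f) p)^*^*)%R; last by rewrite conjCK -fin_seqP.
congr (_^*)%R; rewrite rmorph_sum; apply: eq_bigr => q _; exact: pure_formC.
Qed.

Lemma fdot_ge0 f : 0 <= fdot f f.
Proof. by rewrite fdotE seq_dot_ge0. Qed.

Lemma fdot_gt0 f : f != 0 -> 0 < fdot f f.
Proof.
move=> f0; rewrite lt_def fdot_ge0 andbT; apply: contra_neq f0 => ff0.
apply/val_inj/funext => p /=; apply/eqP.
rewrite -normr_eq0 -sqrf_eq0; set x := `|_| ^+ 2.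
have x0 : 0 <= x by rewrite exprn_ge0.
pose n := fdot (fin_pure p) (fin_pure p).
have n0 : 0 <= n := fdot_ge0 _.
pose t := (n + 1)^-1; have t0 : 0 < t by rewrite invr_gt0 ltr_wpDl.
pose a := - (f p * t).
have := fdot_ge0 (a *: fin_pure p + f).
have hx : x = f p * (f p)^*%R by rewrite /x normCK.
have tc : t^*%R = t by apply/CrealP; rewrite gtr0_real.
have ac : a^*%R = - ((f p)^*%R * t) by rewrite rmorphN rmorphM/= tc.
have fP : fdot (fin_pure p) f = (f p)^*%R by rewrite fdotC fdot_pure.
rewrite fdot_lin (fdotC (fin_pure p)) (fdotC f) !fdot_lin !rmorphD !rmorphM/=.
rewrite -(fdotC (fin_pure p) (fin_pure p)) -/n -(fdotC f f) ff0 addr0.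
rewrite -(fdotC (fin_pure p) f) -(fdotC f) fP fdot_pure ac.
have -> : a * (- ((f p)^*%R * t) * n + (f p)^*%R) + - ((f p)^*%R * t) * f p =
    - (x * t * (2 - t * n)).
  by rewrite hx /a; ring.
rewrite oppr_ge0 => xle.
have tn : t * n <= 1 by rewrite /t mulrC ler_pdivrMr ?mul1r ?lerDl// ltr_wpDl.
have c0 : 0 < t * (2 - t * n).
  by rewrite mulr_gt0// subr_gt0 (le_lt_trans tn)// ltr1n.
by rewrite eq_le x0 andbT; move: xle; rewrite -mulrA pmulr_lle0.
Qed.

HB.instance Definition _ := isDotProduct.Build C fin_tensor fdot fdot_gt0.

End FiniteTensor.

(* These properties determine the space and the map x, y |-> x (x) y up to a
   unique unitary; tensor_product below is opaque, so they are also all that is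
   known about the tensor product used here. *)
Record hilbert_tensor (R : realType) (H K : hilbertType R) := HilbertTensor {
  tensor_space : hilbertType R ;
  tensor_vec : H -> K -> tensor_space ;
  tensor_linl : forall y, linear (tensor_vec ^~ y) ;
  tensor_linr : forall x, linear (tensor_vec x) ;
  tensor_inner : forall x x' y y',
    inner (tensor_vec x y) (tensor_vec x' y') = inner x x' * inner y y' ;
  tensor_dense : dense [set z | exists s : seq (H * K),
    z = \sum_(p <- s) tensor_vec p.1 p.2] }.

Lemma denseP (R : realType) (H : hilbertType R) (A : set H) :
  dense A <-> forall x (e : R[i]), 0 < e -> exists2 y, A y & `|x - y| < e.
Proof.
split=> [dA x e e0|h O [x Ox] oO].
  have [y [yb yA]] := dA (ball x e) (ex_intro _ x (ballxx x e0)) (ball_open x e).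
  by exists y => //; move: yb; rewrite -ball_normE.
have /nbhs_ballP[e e0 he] : nbhs x O by exact: open_nbhs_nbhs.
have [y Ay xy] := h x e e0; exists y; split=> //.
by apply: he; rewrite -ball_normE.
Qed.

Lemma tensor_product (R : realType) (H K : hilbertType R) : hilbert_tensor H K.
Proof.
pose D : {dot fin_tensor H K for conjC} := @fdot R H K.
pose W : hilbertType R := completion D.
pose m (x : H) (y : K) : W := cinjection D (fin_pure (x, y)).
apply: (@HilbertTensor R H K W m).
- move=> y a x x'; rewrite /m -linearP; congr (cinjection D _).
  apply/val_inj/funext => q /=.
  transitivity (a * pure_form (x, y) q + pure_form (x', y) q); last by [].
  by rewrite /pure_form/= (dotDl inner) (dotZl inner) mulrDl mulrA.
- move=> x a y y'; rewrite /m -linearP; congr (cinjection D _).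
  apply/val_inj/funext => q /=.
  transitivity (a * pure_form (x, y) q + pure_form (x, y') q); last by [].
  rewrite /pure_form/= (dotDl inner) (dotZl inner) mulrDr; congr (_ + _).
  by rewrite mulrCA.
- move=> x x' y y'; have := cinner_cinjection D (fin_pure (x, y)) (fin_pure (x', y')).
  by move=> h; rewrite [LHS]h; exact: fdot_pure.
apply/denseP => x e e0; have e20 : 0 < e / 2 by rewrite divr_gt0.
have [v hv] := cinjection_dense x e20; exists (cinjection D v).
  exists (fin_seq v); rewrite /m -raddf_sum/=; congr (cinjection D _).
  apply/val_inj => /=; rewrite fin_seqP; apply/funext => q.
  have -> (s : seq (H * K)) : 
      val (\sum_(p <- s) fin_pure (p.1, p.2)) q = form_of s q.
    elim: s => [|p s IHs]; first by rewrite big_nil /form_of big_nil.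
    rewrite big_cons [RHS]/form_of big_cons -[X in _ = _ + X]/(form_of s q) -IHs.
    by case: p.
  by [].
by apply: (le_lt_trans hv); rewrite gtr_pMr ?invf_lt1 ?ltr1n.
Qed.

Definition tensor (R : realType) (H K : hilbertType R) : hilbertType R :=
  tensor_space (tensor_product H K).
Definition tens (R : realType) (H K : hilbertType R) (x : H) (y : K) :
  tensor H K := tensor_vec (tensor_product H K) x y.

Notation "H ⊠ K" := (tensor H K) (at level 40, left associativity).
Notation "x ⊗ y" := (tens x y) (at level 40, left associativity).

Record isometry (R : realType) (H K : hilbertType R) := Isometry {
  isometry_linear :> {linear H -> K} ;
  isometry_norm : forall x, `|isometry_linear x| = `|x| }.

Lemma isometry_inner (R : realType) (H K : hilbertType R) (f : isometry H K) x y :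
  inner (f x) (f y) = inner x y.
Proof.
pose D u v := inner (f u) (f v) - inner u v.
have D0 u v : D u v + (D u v)^*%R = 0.
  have := isometry_norm f (u + v); move=> /(congr1 (fun z => z ^+ 2)).
  rewrite -!inner_norm linearD !dnormD !inner_norm !isometry_norm.
  by move=> /addrI h; rewrite /D rmorphB addrACA h -opprD subrr.
have Di : D x ('i *: y) = - 'i * D x y.
  by rewrite /D linearZ/= !(dotZr inner) conjCi mulrBr.
have := D0 x ('i *: y); rewrite Di rmorphM rmorphN/= conjCi opprK mulNr addrC.
rewrite -mulrBr => /eqP; rewrite mulf_eq0 (negPf (neq0Ci _))/= subr_eq0 => /eqP Dr.
have /eqP := D0 x y; rewrite Dr -mulr2n mulrn_eq0/= subr_eq0 => /eqP.
exact.
Qed.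

Section IsometryExtension.
Variables (R : realType) (T T' : hilbertType R).
Local Notation C := R[i].

Variables (I : Type) (a : I -> T) (b : I -> T').
Let S (V : lmodType C) (c : I -> V) (s : seq (C * I)) : V :=
  \sum_(p <- s) p.1 *: c p.2.
Hypothesis ab : forall i j, inner (a i) (a j) = inner (b i) (b j).
Hypothesis a_total : dense [set x | exists s, x = S a s].

Let S_inner s t : inner (S a s) (S a t) = inner (S b s) (S b t).
Proof.
have E (V : hilbertType R) (c : I -> V) : inner (S c s) (S c t) =
    \sum_(q <- t) \sum_(p <- s) p.1 * (q.1^*%R * inner (c p.2) (c q.2)).
  rewrite [in LHS]/S linear_sumr; apply: eq_bigr => q _.
  rewrite (linear_sumlz inner); apply: eq_bigr => p _.
  have L1 := dotZl (@inner R V) p.1 (c p.2) (q.1 *: c q.2).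
  have L2 := dotZr (@inner R V) q.1 (c p.2) (c q.2).
  by rewrite [LHS]L1 L2.
by rewrite !E; apply: eq_bigr => q _; apply: eq_bigr => p _; rewrite ab.
Qed.

Let opps (s : seq (C * I)) := [seq (- p.1, p.2) | p <- s].

Let S_cat (V : lmodType C) (c : I -> V) s t : S c (s ++ t) = S c s + S c t.
Proof. by rewrite /S big_cat. Qed.

Let S_scale (V : lmodType C) (c : I -> V) k s :
  S c [seq (k * p.1, p.2) | p <- s] = k *: S c s.
Proof.
rewrite /S big_map scaler_sumr; apply: eq_bigr => p _.
by rewrite scalerA.
Qed.

Let S_opp (V : lmodType C) (c : I -> V) s : S c (opps s) = - S c s.
Proof.
rewrite /S big_map -sumrN; apply: eq_bigr => p _.
by rewrite scaleNr.
Qed.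

Let S_norm s : `|S a s| = `|S b s|.
Proof.
apply/eqP; rewrite -(@eqrXn2 _ 2)//; apply/eqP.
by rewrite -!inner_norm S_inner.
Qed.

Let S_dist s t : `|S a s - S a t| = `|S b s - S b t|.
Proof. by rewrite -!S_opp -!S_cat S_norm. Qed.

Let goodp (x : T) (y : T') := forall s, `|y - S b s| = `|x - S a s|.

Let dense_seq x : exists s : nat -> seq (C * I),
  forall n, `|x - S a (s n)| < n.+1%:R^-1.
Proof.
have h n : exists s, `|x - S a s| < n.+1%:R^-1.
  have n0 : 0 < n.+1%:R^-1 :> C by rewrite invr_gt0 ltr0n.
  by have [_ [s ->] hs] := (iffLR (denseP _) a_total) x _ n0; exists s.
by have [s hs] := choice h; exists s.
Qed.

Lemma cauchy_seq_cvg (u : nat -> T') :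
  (forall e : C, 0 < e -> exists N, forall n m, (N <= n)%N -> (N <= m)%N ->
    `|u n - u m| < e) ->
  exists y, forall e : C, 0 < e -> exists N, forall n, (N <= n)%N -> `|y - u n| < e.
Proof.
move=> h; have /cvg_ex[y hy] : cvg (u @ \oo).
  apply: cauchy_cvg; apply: cauchy_exP => e e0.
  have [N hN] := h e e0; exists (u N); exists N => // n /= Nn.
  by rewrite -ball_normE /ball_/=; apply: hN.
exists y => e e0; have /cvgrPdist_lt/(_ _ e0)[N _ hN] := hy.
by exists N => n /hN.
Qed.

Let good_ex x : exists y, goodp x y.
Proof.
have [s hs] := dense_seq x.
have [e e0|y hy] := @cauchy_seq_cvg (fun n => S b (s n)).
  have e20 : 0 < e / 2 by rewrite divr_gt0.
  have [N hN] := invn_small e20; exists N => n m /hN hn /hN hm.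
  rewrite -S_dist -(subrKA x) [ltRHS]splitr.
  apply: le_lt_trans (ler_normD _ _) _; apply: ltrD.
    by rewrite distrC; exact: lt_trans (hs n) _.
  exact: lt_trans (hs m) _.
have le3 (e p q r : C) : p < e / 2 -> q < e / 2 -> p + (q + r) <= r + e.
  move=> hp hq; rewrite addrA addrC lerD2l [leRHS]splitr.
  by apply: lerD; exact: ltW.
exists y => t; apply/eqP; rewrite eq_le; apply/andP; split.
  apply/ler_addgt0Pr => e e0; have e20 : 0 < e / 2 by rewrite divr_gt0.
  have [N hN] := invn_small e20; have [M hM] := hy _ e20.
  pose n := maxn N M; rewrite -(subrKA (S b (s n))).
  apply: le_trans (ler_normD _ _) _; rewrite -S_dist -(subrKA x).
  apply: le_trans (lerD (lexx _) (ler_normD _ _)) _; apply: le3.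
    by apply: hM; exact: leq_maxr.
  by rewrite distrC; apply: lt_trans (hs n) (hN _ _); exact: leq_maxl.
apply/ler_addgt0Pr => e e0; have e20 : 0 < e / 2 by rewrite divr_gt0.
have [N hN] := invn_small e20; have [M hM] := hy _ e20.
pose n := maxn N M; rewrite -(subrKA (S a (s n))).
apply: le_trans (ler_normD _ _) _; rewrite S_dist -(subrKA y).
apply: le_trans (lerD (lexx _) (ler_normD _ _)) _; apply: le3.
  by apply: lt_trans (hs n) (hN _ _); exact: leq_maxl.
by rewrite distrC; apply: hM; exact: leq_maxr.
Qed.

Let ext x := projT1 (cid (good_ex x)).
Let extP x : goodp x (ext x).
Proof. by rewrite /ext; case: cid. Qed.

Let dist0_eq (x y : T') : (forall e : C, 0 < e -> `|x - y| <= e) -> x = y.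
Proof.
move=> h; apply/eqP; rewrite -subr_eq0 -normr_le0.
by apply/ler_addgt0Pr => e e0; rewrite add0r h.
Qed.

Let ext_linear : linear ext.
Proof.
move=> k x y; apply: dist0_eq => e e0.
have e20 : 0 < e / 2 by rewrite divr_gt0.
have k0 : 0 < `|k| + 1 by rewrite ltr_wpDl.
have e40 : 0 < e / 2 / 2 by rewrite divr_gt0.
have [_ [s ->] hs] := (iffLR (denseP _) a_total) x _ (divr_gt0 e40 k0).
have [_ [t ->] ht] := (iffLR (denseP _) a_total) y _ e40.
pose r := [seq (k * p.1, p.2) | p <- s] ++ t.
have Sr (V : lmodType C) (c : I -> V) : S c r = k *: S c s + S c t.
  by rewrite S_cat S_scale.
have kle (V : hilbertType R) (u v u' v' : V) : `|u - u'| < e / 2 / 2 / (`|k| + 1) ->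
    `|v - v'| < e / 2 / 2 -> `|k *: u + v - (k *: u' + v')| <= e / 2.
  move=> hu hv; rewrite opprD addrACA -scalerBr [leRHS]splitr.
  apply: le_trans (ler_normD _ _) _; apply: lerD; last exact: ltW.
  rewrite normrZ; apply: (@le_trans _ _ ((`|k| + 1) * `|u - u'|)).
    by rewrite ler_wpM2r// lerDl.
  by rewrite mulrC -ler_pdivlMr// ltW.
rewrite -(subrKA (S b r)) [leRHS]splitr.
apply: le_trans (ler_normD _ _) _; apply: lerD.
  by rewrite extP Sr; exact: kle.
by rewrite distrC Sr; apply: kle; rewrite extP.
Qed.

Let ext_norm x : `|ext x| = `|x|.
Proof. by have := extP x [::]; rewrite /S !big_nil !subr0. Qed.

Lemma isometry_extension : exists f : isometry T T', forall i, f (a i) = b i.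
Proof.
pose lf := HB.pack_for {linear T -> T'} ext
  (GRing.isLinear.Build C T T' _ ext ext_linear).
exists (@Isometry R T T' lf ext_norm) => i /=.
have := extP (a i) [:: (1, i)]; rewrite /S !big_seq1 !scale1r subrr normr0.
by move=> /eqP; rewrite normr_eq0 subr_eq0 => /eqP.
Qed.

End IsometryExtension.

Lemma isometry_dist (R : realType) (H K : hilbertType R) (f : isometry H K) x y :
  `|f x - f y| = `|x - y|.
Proof. by rewrite -linearB isometry_norm. Qed.

Section TensorTheory.
Variables (R : realType) (H K : hilbertType R).
Local Notation C := R[i].

Lemma tens_linl (y : K) : linear (fun x : H => x ⊗ y).
Proof. exact: tensor_linl. Qed.

Lemma tens_linr (x : H) : linear (fun y : K => x ⊗ y).
Proof. exact: tensor_linr. Qed.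

HB.instance Definition _ := bilinear_isBilinear.Build C H K (H ⊠ K) *:%R *:%R
  (@tens R H K) (conj tens_linl tens_linr).

Lemma tensDl (x x' : H) (y : K) : (x + x') ⊗ y = x ⊗ y + x' ⊗ y.
Proof. exact: linearDl. Qed.

Lemma tensDr (x : H) (y y' : K) : x ⊗ (y + y') = x ⊗ y + x ⊗ y'.
Proof. exact: linearDr. Qed.

Lemma tensBr (x : H) (y y' : K) : x ⊗ (y - y') = x ⊗ y - x ⊗ y'.
Proof. exact: linearBr. Qed.

Lemma tensZl (a : C) (x : H) (y : K) : (a *: x) ⊗ y = a *: (x ⊗ y).
Proof. exact: linearZl_LR. Qed.

Lemma tensZr (a : C) (x : H) (y : K) : x ⊗ (a *: y) = a *: (x ⊗ y).
Proof. exact: linearZr_LR. Qed.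

Lemma tens_sumr (x : H) (I : Type) (s : seq I) (F : I -> K) :
  x ⊗ (\sum_(i <- s) F i) = \sum_(i <- s) x ⊗ F i.
Proof. exact: linear_sumr. Qed.

Lemma tens_inner (x x' : H) (y y' : K) :
  inner (x ⊗ y) (x' ⊗ y') = inner x x' * inner y y'.
Proof. exact: tensor_inner. Qed.

Lemma tens_dense : dense [set z : H ⊠ K |
  exists s : seq (H * K), z = \sum_(p <- s) p.1 ⊗ p.2].
Proof. exact: tensor_dense. Qed.

Lemma tens_norm (x : H) (y : K) : `|x ⊗ y| = `|x| * `|y|.
Proof.
apply/eqP; rewrite -(@eqrXn2 _ 2)// ?mulr_ge0//; apply/eqP.
by rewrite exprMn -!inner_norm tens_inner.
Qed.

Lemma isometry_tens_ext (L : hilbertType R) (f g : isometry (H ⊠ K) L) :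
  (forall x y, f (x ⊗ y) = g (x ⊗ y)) -> f =1 g.
Proof.
move=> fg z; apply/eqP; rewrite -subr_eq0 -normr_le0.
apply/ler_addgt0Pr => e e0; rewrite add0r.
have e20 : 0 < e / 2 by rewrite divr_gt0.
have [_ [s ->] hs] := (iffLR (denseP _) tens_dense) z _ e20.
set w := \sum_(_ <- _) _ in hs.
have fgw : f w = g w.
  by rewrite /w !linear_sum; apply: eq_bigr => p _; exact: fg.
rewrite -(subrKA (f w)) [leRHS]splitr.
apply: le_trans (ler_normD _ _) _; apply: lerD.
  by rewrite isometry_dist; exact: ltW.
by rewrite fgw isometry_dist distrC; exact: ltW.
Qed.

End TensorTheory.

Section TensorMaps.
Variable R : realType.
Local Notation C := R[i].

Definition isometry_id (H : hilbertType R) : isometry H H :=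
  @Isometry R H H (@idfun H) (fun=> erefl).

Lemma tmap_exists (H H' K K' : hilbertType R)
    (A : isometry H H') (B : isometry K K') :
  exists f : isometry (H ⊠ K) (H' ⊠ K'),
    forall p : H * K, f (p.1 ⊗ p.2) = A p.1 ⊗ B p.2.
Proof.
apply: isometry_extension => [p q|]; first by rewrite !tens_inner !isometry_inner.
apply/denseP => z e e0.
have [_ [s ->] hs] := (iffLR (denseP _) (@tens_dense R H K)) z _ e0.
exists (\sum_(p <- s) p.1 ⊗ p.2) => //.
exists [seq (1, p) | p <- s]; rewrite big_map.
by apply: eq_bigr => p _; rewrite scale1r.
Qed.

(* Determined by its values on elementary tensors, see isometry_tens_ext. *)
Definition tmap (H H' K K' : hilbertType R) (A : isometry H H')
  (B : isometry K K') : isometry (H ⊠ K) (H' ⊠ K') :=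
  projT1 (cid (tmap_exists A B)).

Lemma tmapE (H H' K K' : hilbertType R) (A : isometry H H') (B : isometry K K')
  x y : tmap A B (x ⊗ y) = A x ⊗ B y.
Proof. by rewrite /tmap; case: cid => f hf /=; have := hf (x, y). Qed.

Lemma tassoc_exists (H K L : hilbertType R) :
  exists f : isometry (H ⊠ (K ⊠ L)) ((H ⊠ K) ⊠ L),
    forall p : H * K * L, f (p.1.1 ⊗ (p.1.2 ⊗ p.2)) = (p.1.1 ⊗ p.1.2) ⊗ p.2.
Proof.
apply: isometry_extension => [p q|]; first by rewrite !tens_inner mulrA.
set A := [set _ | _].
have AD u v : A u -> A v -> A (u + v).
  by move=> [s ->] [t ->]; exists (s ++ t); rewrite big_cat.
have A1 (x : H) w (e : C) : 0 < e -> exists2 v, A v & `|x ⊗ w - v| < e.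
  move=> e0; have x0 : 0 < `|x| + 1 by rewrite ltr_wpDl.
  have [_ [s ->] hs] := (iffLR (denseP _) (@tens_dense R K L)) w _ (divr_gt0 e0 x0).
  set v := \sum_(_ <- _) _ in hs; exists (x ⊗ v).
    exists [seq (1, ((x, p.1), p.2)) | p <- s]; rewrite big_map /v tens_sumr.
    by apply: eq_bigr => p _; rewrite scale1r.
  rewrite -tensBr.
  rewrite tens_norm; apply: (@le_lt_trans _ _ ((`|x| + 1) * `|w - v|)).
    by rewrite ler_wpM2r// lerDl.
  by rewrite mulrC -ltr_pdivlMr.
apply/denseP => z e e0; have e20 : 0 < e / 2 by rewrite divr_gt0.
have [_ [s ->] hs] := (iffLR (denseP _) (@tens_dense R H (K ⊠ L))) z _ e20.
have : exists2 v, A v & `|\sum_(p <- s) p.1 ⊗ p.2 - v| < e / 2.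
  elim: s {hs} (e / 2) e20 => [|p s IHs] r r0.
    by exists 0; [exists [::]; rewrite big_nil|rewrite big_nil subrr normr0].
  have r20 : 0 < r / 2 by rewrite divr_gt0.
  have [u Au hu] := A1 p.1 p.2 _ r20; have [v Av hv] := IHs _ r20.
  exists (u + v); first exact: AD.
  rewrite big_cons opprD addrACA [ltRHS]splitr.
  by apply: le_lt_trans (ler_normD _ _) _; exact: ltrD.
move=> [v Av hv]; exists v => //.
rewrite -(subrKA (\sum_(p <- s) p.1 ⊗ p.2)) [ltRHS]splitr.
by apply: le_lt_trans (ler_normD _ _) _; exact: ltrD.
Qed.

Definition tassoc (H K L : hilbertType R) :
  isometry (H ⊠ (K ⊠ L)) ((H ⊠ K) ⊠ L) := projT1 (cid (tassoc_exists H K L)).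

Lemma tassocE (H K L : hilbertType R) (x : H) (y : K) (z : L) :
  tassoc H K L (x ⊗ (y ⊗ z)) = (x ⊗ y) ⊗ z.
Proof. by rewrite /tassoc; case: cid => f hf /=; have := hf (x, y, z). Qed.

End TensorMaps.

(* The inverse is a field because it is needed as a function; it is determined
   by the (injective) isometry. *)
Record unitary (R : realType) (H K : hilbertType R) := Unitary {
  unitary_isometry :> isometry H K ;
  unitary_inv : K -> H ;
  unitary_invK : cancel unitary_inv unitary_isometry }.

Definition has_dim (R : realType) (n : nat) (H : hilbertType R) : Prop :=
  exists e : 'I_n -> H, forall x, exists! c : 'rV[R[i]]_n,
    x = \sum_(i < n) c ord0 i *: e i.

Definition infinite_dim (R : realType) (H : hilbertType R) : Prop :=
  forall n, ~ has_dim n H.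

Definition separable (T : topologicalType) : Prop :=
  exists2 D : set T, countable D & dense D.

Section Times.
Variable K : numDomainType.

Definition tadd (s t : {posnum K}) : {posnum K} := (s%:num + t%:num)%:pos.

Lemma taddA (r s t : {posnum K}) : tadd r (tadd s t) = tadd (tadd r s) t.
Proof. by apply: val_inj; rewrite /= addrA. Qed.

End Times.

Section RationalTimes.
Variable R : realType.

Lemma ratr_posnum_gt0 (t : {posnum rat}) : 0 < ratr t%:num :> R.
Proof. by rewrite ltr0q. Qed.

Definition qtime (t : {posnum rat}) : {posnum R} := PosNum (ratr_posnum_gt0 t).

Lemma qtimeD (s t : {posnum rat}) : qtime (tadd s t) = tadd (qtime s) (qtime t).
Proof. by apply: val_inj; rewrite /= rmorphD. Qed.

End RationalTimes.

Definition tcast (R : realType) (K : numDomainType)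
  (E : {posnum K} -> hilbertType R) (s t : {posnum K}) (e : s = t) (u : E s) :
  E t := ecast r (E r) e u.

(* (beta_{r,s} (x) 1_t) beta_{r+s,t} = (1_r (x) beta_{s,t}) beta_{r,s+t}; the two
   sides start from the propositionally, not definitionally, equal times
   (r + s) + t and r + (s + t), and land in the two bracketings of the triple
   tensor product, hence tcast and tassoc. *)
Definition coassociative (R : realType) (K : numDomainType)
    (E : {posnum K} -> hilbertType R)
    (beta : forall s t, isometry (E (tadd s t)) (E s ⊠ E t)) : Prop :=
  forall r s t (u : E (tadd (tadd r s) t)),
    tmap (beta r s) (isometry_id (E t)) (beta (tadd r s) t u) =
    tassoc (E r) (E s) (E t)
      (tmap (isometry_id (E r)) (beta s t)
        (beta r (tadd s t) (tcast (esym (taddA r s t)) u))).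

Record rational_subproduct_system (R : realType) := RationalSubproductSystem {
  sub_fiber :> {posnum rat} -> hilbertType R ;
  sub_dim2 : forall t, has_dim 2 (sub_fiber t) ;
  sub_beta : forall s t,
    isometry (sub_fiber (tadd s t)) (sub_fiber s ⊠ sub_fiber t) ;
  sub_coassoc : coassociative sub_beta }.

Definition borel (T : topologicalType) : set (set T) := <<s @open T >>.
Arguments borel : clear implicits.

Definition prod_sigma (X Y : Type) (F : set (set X)) (G : set (set Y)) :
  set (set (X * Y)) := <<s [set A `*` B | A in F & B in G] >>.

Definition sigma_measurable (X Y : Type) (F : set (set X)) (G : set (set Y))
  (f : X -> Y) : Prop := forall B, G B -> F (f @^-1` B).

Definition borel_pos (R : realType) : set (set {posnum R}) :=
  [set (fun t : {posnum R} => t%:num) @^-1` A | A in borel R].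
Arguments borel_pos : clear implicits.

Definition standard_borel (R : realType) (X : Type) (B : set (set X)) : Prop :=
  exists P : completePseudoMetricType R,
    [/\ hausdorff_space P, separable P &
        exists2 f : X -> P, bijective f & B = [set f @^-1` A | A in borel P]].

Section Arveson.
Variables (R : realType) (E : {posnum R} -> hilbertType R).

Definition total_space : Type := {t : {posnum R} & E t}.

Definition trivialization (H : hilbertType R) (U : forall t, unitary (E t) H)
  (p : total_space) : {posnum R} * H := (projT1 p, U (projT1 p) (projT2 p)).

Definition trivialization_inv (H : hilbertType R)
  (U : forall t, unitary (E t) H) (q : {posnum R} * H) : total_space :=
  existT _ q.1 (unitary_inv (U q.1) q.2).

Definition trivial_family (B : set (set total_space)) : Prop :=
  exists (H : hilbertType R) (U : forall t, unitary (E t) H),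
    [/\ separable H, infinite_dim H,
        sigma_measurable B (prod_sigma (borel_pos R) (borel H))
          (trivialization U) &
        sigma_measurable (prod_sigma (borel_pos R) (borel H)) B
          (trivialization_inv U)].

Definition total_mul
    (beta : forall s t, unitary (E (tadd s t)) (E s ⊠ E t))
    (p : total_space * total_space) : total_space :=
  let: (existT s f, existT t g) := p in
  existT _ (tadd s t) (unitary_inv (beta s t) (f ⊗ g)).

End Arveson.

(* arv_trivial: fibrewise unitaries onto a fixed H form a Borel isomorphism from
   the total space onto (0, oo) x H. *)
Record arveson_system (R : realType) := ArvesonSystem {
  arv_fiber :> {posnum R} -> hilbertType R ;
  arv_separable : forall t, separable (arv_fiber t) ;
  arv_beta : forall s t,
    unitary (arv_fiber (tadd s t)) (arv_fiber s ⊠ arv_fiber t) ;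
  arv_coassoc : coassociative arv_beta ;
  arv_borel : set (set (total_space arv_fiber)) ;
  arv_sigma : sigma_algebra setT arv_borel ;
  arv_standard : standard_borel R arv_borel ;
  arv_trivial : trivial_family arv_borel ;
  arv_mul_measurable : sigma_measurable (prod_sigma arv_borel arv_borel)
    arv_borel (total_mul arv_beta) }.

Record representation (R : realType) (E : rational_subproduct_system R)
    (A : arveson_system R) := Representation {
  repr_map : forall t, isometry (E t) (A (qtime R t)) ;
  repr_beta : forall s t (u : E (tadd s t)),
    arv_beta A (qtime R s) (qtime R t) (tcast (qtimeD R s t) (repr_map (tadd s t) u)) =
    tmap (repr_map s) (repr_map t) (sub_beta E s t u) }.

Section Pairs.
Variables (R : realType) (E : rational_subproduct_system R) (x y : forall t, E t).

Definition multiplicative_pair : Prop := exists2 a : R, 0 < a < 1 & forall s t,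
  [/\ `|x t| = 1, `|y t| = 1,
      inner (x t) (y t) = (a `^ (qtime R t)%:num)%:C,
      sub_beta E s t (x (tadd s t)) = x s ⊗ x t &
      sub_beta E s t (y (tadd s t)) = y s ⊗ y t].

Definition twisted_additive_pair : Prop := exists c b : R, 0 < c /\ forall s t,
  [/\ `|x t| = 1, inner (x t) (y t) = 0,
      `|y t| ^+ 2 = (if c == 1 then (qtime R t)%:num
        else (c `^ (2 * (qtime R t)%:num) - 1) / (c ^+ 2 - 1))%:C,
      sub_beta E s t (x (tadd s t)) = x s ⊗ x t &
      sub_beta E s t (y (tadd s t)) = y s ⊗ x t +
        ((c `^ (qtime R s)%:num)%:C *
          (cos (b * (qtime R s)%:num) +i* sin (b * (qtime R s)%:num))) *:
        (x s ⊗ y t)].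

End Pairs.

(* Main.v *)
From HB Require Import structures.
From mathcomp Require Import all_boot all_order all_algebra.
From mathcomp Require Import complex ring lra.
From mathcomp Require Import all_classical all_reals all_analysis.
From mathcomp Require Import measurable_realfun.
Require Import Defs.
Set Implicit Arguments. Unset Strict Implicit. Unset Printing Implicit Defensive.
Import Order.TTheory GRing.Theory Num.Theory Num.Def.
Import numFieldNormedType.Exports.
Local Open Scope classical_set_scope.
Local Open Scope complex_scope.
Local Open Scope ring_scope.

(** The fibres of the Arveson system are identified with one Hilbert space H, in
    which the system becomes an associative multiplication, isometric on tensors,
    H_s x H_t -> H_(s+t); write x y for the product. The representation embeds
    E_t as a two-dimensional subspace K_t of H, and K_(s+t) lies in the span of
    the products of K_s and K_t. All computations take place in H.

    Algebra. The space K_2t is a pencil of 2 x 2 matrices over K_t, and K_3t lies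
    both in K_2t K_t and in K_t K_2t. As K_3t is two-dimensional, K_2t must be
    spanned by two squares xx, yy, or by xx and some p yx + q xy, or by xy and yx
    ([trichotomy]). The last case is impossible at a time that can be halved, as
    all times can ([rational_types]). In the other cases the shape propagates to
    the multiples of t: K_nt is spanned by x^n and y^n, or by x^n and a sum of
    words with one letter y ([power_fiber], [twist_fiber]). Squares determine
    their lines, so pairs found at the times 1/n! match after extraction of
    roots, and together they give families X_t, Y_t for all positive rational t
    ([rational_families]): both multiplicative, or X multiplicative and
    Y_(s+t) = p_t Y_s X_t + q_s X_s Y_t with characters p, q and Y orthogonal
    to X.

    Analysis. It remains to show that the inner product of X and Y, in the first
    case, and p and q, in the second, do not vanish, and that the phase of q/p
    is exponential; moduli of characters of the positive rationals always are.
    The cyclic shifts a b |-> b a of the fibre at time 1, with b of length s, form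
    a one-parameter group. It is measurable, hence strongly continuous
    ([shift_continuous], through Steinhaus' theorem). Applied to X_(1/2) Y_(1/2), the
    shift by s gives the inner product |<X_s, Y_s>|^2 in the first case, and a
    positive multiple of p_s times the conjugate of q_s in the second. Both
    therefore have positive real part for small s ([unit_inner_small],
    [twisted_small]), and a character of modulus one that stays in the right
    half-plane near 0 is exponential ([circle_character]). *)

(** * Steinhaus' theorem *)

Section Steinhaus.
Variable R : realType.
Local Notation mu := (@lebesgue_measure R).

Lemma lebesgue_measure_shift (a : R) (A : set (measurableTypeR R)) : measurable A ->
  mu [set x | A (x + a)] = mu A.
Proof.
move=> mA.
have mf : measurable_fun setT ((fun x => x + a) : measurableTypeR R -> measurableTypeR R).
  exact: measurable_funD.
pose nu := pushforward mu ((fun x => x + a) : measurableTypeR R -> measurableTypeR R).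
symmetry; apply: (@lebesgue_measure_unique R nu) => // X [[u v] /= uv <-].
rewrite /nu /pushforward/= /preimage/=.
have -> : [set x | (`]u, v]%classic : set R) (x + a)] = `]u - a, v - a]%classic.
  by apply/seteqP; split => x /=; rewrite !in_itv/= => /andP[? ?]; apply/andP; split; lra.
rewrite !lebesgue_measure_itv/= !lte_fin ltrD2r; case: ifP => // _.
by rewrite -!EFinD; congr (_%:E); lra.
Qed.

(** Around a density point of A some ball of radius e meets A in measure more
    than 3/2 e. For s < e/2 that part of A and its translate by s both lie in an
    interval of length 5/2 e, so they cannot be disjoint. *)
Lemma steinhaus (A : set (measurableTypeR R)) : measurable A -> (0 < mu A)%E ->
  exists2 d : R, 0 < d & forall s : R, 0 < s < d -> exists2 t, A t & A (t + s).
Proof.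
move=> mA A0.
have [x Ax hx] : exists2 x, A x &
    (mu (A `&` ball x r) * (mu (ball x r))^-1)%E @[r --> 0^'+] --> ((\1_A x)%:E : \bar R).
  apply: contrapT => h.
  have [N [mN N0 hN]] := lebesgue_density mA.
  have : (mu A <= mu N)%E.
    apply: le_measure; rewrite ?inE// => x Ax; apply: hN => /= hx.
    by apply: h; exists x.
  by rewrite N0 leNgt A0.
move: hx; rewrite indicE mem_set// => hx.
have [e e0 he] : exists2 e : R, 0 < e & (mu (A `&` ball x e) > (3 / 2 * e)%:E)%E.
  have : \forall r \near 0^'+, ((3/4)%:E < mu (A `&` ball x r) * (mu (ball x r))^-1)%E.
    apply: (hx [set y | ((3/4)%:E < y)%E]); apply: open_nbhs_nbhs; split.
      exact: (@open_ereal_gt_ereal R (3/4)%:E).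
    by rewrite /= lte_fin; lra.
  move=> h.
  near (0 : R)^'+ => e.
  have e0 : 0 < e by [].
  exists e => //.
  have : ((3/4)%:E < mu (A `&` ball x e) * (mu (ball x e))^-1)%E by near: e.
  rewrite lebesgue_measure_ball ?(ltW e0)// inver mulrn_eq0/= gt_eqF//.
  rewrite lte_pdivlMr//; last by rewrite mulrn_wgt0.
  by apply: le_lt_trans; rewrite -EFinM lee_fin; lra.
exists (e / 2); first by rewrite divr_gt0.
move=> s /andP[s0 se]; apply: contrapT => h.
pose B := A `&` ball x e; pose B' := [set t | B (t + s)].
have mB : measurable B by apply: measurableI => //; exact: measurable_ball.
have mB' : measurable (B' : set (measurableTypeR R)).
  rewrite -[B']setTI; suff : measurable_fun setT
    ((fun x => x + s) : measurableTypeR R -> measurableTypeR R) by apply.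
  exact: measurable_funD.
have dis : B `&` B' = set0.
  by apply/seteqP; split => // t [[At _] [At' _]]; apply: h; exists t.
have : (mu (B `|` B') <= mu `](x - e * (3/2))%R, (x + e)%R[%classic)%E.
  apply: le_measure; rewrite ?inE//; first exact: measurableU.
  by move=> t [] [_]; rewrite /ball/= in_itv/= ltr_distlC => /andP[h1 h2]; apply/andP; split; lra.
have -> : mu (B `|` B') = (mu B + mu B)%E.
  rewrite -{2}(lebesgue_measure_shift s mB); exact: measureU.
rewrite lebesgue_measure_itv/= lte_fin.
rewrite ifT; last by lra.
apply/negP; rewrite -ltNge.
apply: (@lt_le_trans _ _ ((3 / 2 * e)%:E + (3 / 2 * e)%:E)%E); last by apply: leeD; exact: ltW.
by rewrite -!EFinD lte_fin; lra.
Unshelve. all: by end_near. Qed.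

(** One of countably many measurable sets covering ]0, 1[ has positive measure. *)
Lemma steinhaus_cover (A : nat -> set (measurableTypeR R)) :
  (forall n, measurable (A n)) -> (forall t : R, 0 < t < 1 -> exists n, A n t) ->
  exists (n : nat) (d : R), 0 < d /\ forall s : R, 0 < s < d -> exists2 t, A n t & A n (t + s).
Proof.
move=> mA cov.
have [n hn] : exists n, (0 < mu (A n))%E.
  apply: contrapT => h.
  have h0 n : mu (A n) = 0%E.
    apply/eqP; rewrite eq_le measure_ge0 andbT leNgt; apply/negP => ?; apply: h; by exists n.
  have : (mu `]0%R, 1%R[%classic <= mu (\bigcup_n A n))%E.
    apply: le_measure; rewrite ?inE//; first exact: bigcup_measurable.
    by move=> t /=; rewrite in_itv/= => /cov[n ?]; exists n.
  rewrite lebesgue_measure_itv/= lte_fin ltr01 oppr0 adde0.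
  apply/negP; rewrite -ltNge (@le_lt_trans _ _ 0%E)//.
  apply: (le_trans (measure_sigma_subadditive _ _ _ (fun x h => h))) => //.
    exact: bigcup_measurable.
  by rewrite eseries0// => *; exact: h0.
by have [d d0 hd] := steinhaus (mA n) hn; exists n, d.
Qed.
End Steinhaus.

(** * Products of vectors of one Hilbert space *)

Section HilbertAlgebra.
Variables (R : realType) (H : hilbertType R).
Local Notation C := R[i].
Implicit Types (u v x y : H).

Lemma innerDl u v x : inner (u + v) x = inner u x + inner v x.
Proof. exact: dotDl. Qed.
Lemma innerDr u v x : inner x (u + v) = inner x u + inner x v.
Proof. exact: dotDr. Qed.
Lemma innerZl (a : C) u x : inner (a *: u) x = a * inner u x.
Proof. exact: dotZl. Qed.
Lemma innerZr (a : C) u x : inner x (a *: u) = a^*%R * inner x u.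
Proof. exact: dotZr. Qed.
Lemma innerNl u x : inner (- u) x = - inner u x.
Proof. by rewrite -scaleN1r innerZl mulN1r. Qed.
Lemma inner0l x : inner 0 x = 0.
Proof. by rewrite -(scale0r 0) innerZl mul0r. Qed.
Lemma innerC u v : inner u v = (inner v u)^*%R.
Proof. exact: dotC. Qed.
Lemma inner_eq0 u : inner u u = 0 -> u = 0.
Proof. by rewrite inner_norm => /eqP; rewrite sqrf_eq0 normr_eq0 => /eqP. Qed.

Lemma inner_ext u v : (forall z, inner u z = inner v z) -> u = v.
Proof.
move=> h; apply/eqP; rewrite -subr_eq0; apply/eqP/inner_eq0.
by rewrite innerDl innerNl h subrr.
Qed.

Definition innerE := (innerDl, innerNl, innerZl, inner0l).

Definition indep x y := forall a b : C, a *: x + b *: y = 0 -> a = 0 /\ b = 0.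

End HilbertAlgebra.

(** A linear identity between vectors is a ring identity between their inner
    products with an arbitrary test vector. *)
Ltac vec := apply: inner_ext => ?; rewrite ?innerE; ring.

Section Indep.
Variables (R : realType) (H : hilbertType R).
Local Notation C := R[i].
Implicit Types (u v x y : H).

Lemma indep_neq0 x y : indep x y -> x != 0 /\ y != 0.
Proof.
move=> h; split; apply/eqP => e.
  have [] := h 1 0; first by rewrite e scaler0 scale0r addr0.
  by move=> /eqP; rewrite oner_eq0.
have [] := h 0 1; first by rewrite e scaler0 scale0r addr0.
by move=> _ /eqP; rewrite oner_eq0.
Qed.

Lemma indepC x y : indep x y -> indep y x.
Proof. by move=> h a b; rewrite addrC => /h[-> ->]. Qed.

Lemma indep_eq x y (a b a' b' : C) : indep x y ->
  a *: x + b *: y = a' *: x + b' *: y -> a = a' /\ b = b'.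
Proof.
move=> h e; have [] := h (a - a') (b - b').
  transitivity ((a *: x + b *: y) - (a' *: x + b' *: y)); first by vec.
  by rewrite e subrr.
by move=> /eqP; rewrite subr_eq0 => /eqP -> /eqP; rewrite subr_eq0 => /eqP ->.
Qed.

Lemma orth_indep x y : x != 0 -> y != 0 -> inner x y = 0 -> indep x y.
Proof.
move=> x0 y0 xy a b e.
have yx : inner y x = 0 by rewrite innerC xy rmorph0.
split; apply/eqP.
  have := congr1 (inner^~ x) e; rewrite !innerE yx mulr0 addr0 => /eqP.
  by rewrite mulf_eq0 inner_norm sqrf_eq0 normr_eq0 (negPf x0) orbF.
have := congr1 (inner^~ y) e; rewrite !innerE xy mulr0 add0r => /eqP.
by rewrite mulf_eq0 inner_norm sqrf_eq0 normr_eq0 (negPf y0) orbF.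
Qed.

(** z is the component of x orthogonal to y. *)
Lemma indep_sep x y : indep x y -> exists z, inner x z != 0 /\ inner y z = 0.
Proof.
move=> h; have [_ y0] := indep_neq0 h.
have yy : inner y y != 0 by apply: contra_neq y0; exact: inner_eq0.
pose z := x - (inner x y / inner y y) *: y.
have yz : inner y z = 0.
  by rewrite innerC /z !innerE divfK// subrr rmorph0.
exists z; split=> //.
apply/eqP => xz.
have : inner z z = 0 by rewrite {1}/z !innerE xz yz mulr0 oppr0 addr0.
move/inner_eq0 => z0; have [] := h 1 (- (inner x y / inner y y)).
  by rewrite scale1r scaleNr.
by move/eqP; rewrite oner_eq0.
Qed.

Lemma indep_comb x y (a b c d : C) : indep x y -> a * d - b * c != 0 ->
  indep (a *: x + b *: y) (c *: x + d *: y).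
Proof.
move=> h D s t e.
have [e1 e2] : s * a + t * c = 0 /\ s * b + t * d = 0.
  by apply: h; rewrite -e; vec.
have t0 : t * (a * d - b * c) = 0.
  transitivity (a * (s * b + t * d) - b * (s * a + t * c)); first by ring.
  by rewrite e1 e2 !mulr0 subr0.
have s0 : s * (a * d - b * c) = 0.
  transitivity (d * (s * a + t * c) - c * (s * b + t * d)); first by ring.
  by rewrite e1 e2 !mulr0 subr0.
split; apply/eqP; [move/eqP: s0|move/eqP: t0];
  by rewrite mulf_eq0 (negPf D) orbF.
Qed.

Lemma indep_det x y (a b c d : C) :
  indep (a *: x + b *: y) (c *: x + d *: y) -> a * d - b * c != 0.
Proof.
move=> h; apply/eqP => D.
have [d0 b0] : d = 0 /\ - b = 0.
  by apply: h; apply: inner_ext => z; rewrite !innerE;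
    transitivity ((a * d - b * c) * inner x z); [ring|rewrite D mul0r].
have [c0 a0] : c = 0 /\ - a = 0.
  by apply: h; apply: inner_ext => z; rewrite !innerE;
    transitivity ((a * d - b * c) * - inner y z); [ring|rewrite D mul0r].
have := h 1 0; rewrite scale1r scale0r addr0.
have -> : a = 0 by rewrite -[a]opprK a0 oppr0.
have -> : b = 0 by rewrite -[b]opprK b0 oppr0.
by rewrite !scale0r addr0 => /(_ erefl) [/eqP]; rewrite oner_eq0.
Qed.

End Indep.

(** A product system in which every fibre has been identified with H: the vector
    [M s t x y] is the image of the tensor of x (at time s) and y (at time t)
    under the inverse of the structure map at s, t. Associativity is then an
    equation in H, free of casts between fibres and of reassociations of triple
    tensors. The type T of times varies: real, rational, or the multiples of a
    step, indexed by nat. *)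
Record graded_product (R : realType) (H : hilbertType R) (T : Type)
    (add : T -> T -> T) (pos : T -> Prop) := GradedProduct {
  gmul :> T -> T -> H -> H -> H ;
  gmul_linl : forall s t y, linear (gmul s t ^~ y) ;
  gmul_linr : forall s t x, linear (gmul s t x) ;
  gmul_inner : forall s t x y x' y',
    inner (gmul s t x y) (gmul s t x' y') = inner x x' * inner y y' ;
  gmulA : forall r s t x y z, pos r -> pos s -> pos t ->
    gmul (add r s) t (gmul r s x y) z = gmul r (add s t) x (gmul s t y z) }.

Section GradedTheory.
Variables (R : realType) (H : hilbertType R) (T : Type).
Variables (add : T -> T -> T) (pos : T -> Prop).
Variable M : graded_product H add pos.
Local Notation C := R[i].

Lemma gmulDl s t x x' y : M s t (x + x') y = M s t x y + M s t x' y.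
Proof. by have := gmul_linl M s t y 1 x x'; rewrite !scale1r. Qed.
Lemma gmulDr s t x y y' : M s t x (y + y') = M s t x y + M s t x y'.
Proof. by have := gmul_linr M s t x 1 y y'; rewrite !scale1r. Qed.
Lemma gmul0l s t y : M s t 0 y = 0.
Proof. by apply: (@addrI _ (M s t 0 y)); rewrite -gmulDl !addr0. Qed.
Lemma gmul0r s t x : M s t x 0 = 0.
Proof. by apply: (@addrI _ (M s t x 0)); rewrite -gmulDr !addr0. Qed.
Lemma gmulZl s t (a : C) x y : M s t (a *: x) y = a *: M s t x y.
Proof. by have := gmul_linl M s t y a x 0; rewrite gmul0l !addr0. Qed.
Lemma gmulZr s t (a : C) x y : M s t x (a *: y) = a *: M s t x y.
Proof. by have := gmul_linr M s t x a y 0; rewrite gmul0r !addr0. Qed.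
Lemma gmulNl s t x y : M s t (- x) y = - M s t x y.
Proof. by rewrite -scaleN1r gmulZl scaleN1r. Qed.
Lemma gmulNr s t x y : M s t x (- y) = - M s t x y.
Proof. by rewrite -scaleN1r gmulZr scaleN1r. Qed.
Definition gmulE := (gmulDl, gmulDr, gmulNl, gmulNr, gmulZl, gmulZr).

Lemma gmul_norm s t x y : `|M s t x y| = `|x| * `|y|.
Proof.
apply/eqP; rewrite -(@eqrXn2 _ 2)// ?mulr_ge0//; apply/eqP.
by rewrite exprMn -!inner_norm gmul_inner.
Qed.

(** Pairing with the tensor of g and the component of x orthogonal to y leaves
    only a nonzero multiple of the squared norm of g. *)
Lemma gmul_peell0 s t x y g h : indep x y -> M s t x g + M s t y h = 0 -> g = 0 /\ h = 0.
Proof.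
have key x' y' g' h' : indep x' y' -> M s t x' g' + M s t y' h' = 0 -> g' = 0.
  move=> i e; have [z [xz yz]] := indep_sep i.
  have := congr1 (inner^~ (M s t z g')) e; rewrite !innerE !gmul_inner yz mul0r addr0.
  by move/eqP; rewrite mulf_eq0 (negPf xz) => /eqP/inner_eq0.
move=> i e; split; first exact: key i e.
by apply: key (indepC i) _; rewrite addrC; exact: e.
Qed.

Lemma gmul_peell s t x y g h g' h' : indep x y ->
  M s t x g + M s t y h = M s t x g' + M s t y h' -> g = g' /\ h = h'.
Proof.
move=> i e; have [] := @gmul_peell0 s t x y (g - g') (h - h') i.
  transitivity ((M s t x g + M s t y h) - (M s t x g' + M s t y h')).
    by rewrite !gmulE; vec.
  by rewrite e subrr.
by move=> /eqP; rewrite subr_eq0 => /eqP -> /eqP; rewrite subr_eq0 => /eqP ->.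
Qed.

Lemma gmul_peelr0 s t x y g h : indep x y -> M s t g x + M s t h y = 0 -> g = 0 /\ h = 0.
Proof.
have key x' y' g' h' : indep x' y' -> M s t g' x' + M s t h' y' = 0 -> g' = 0.
  move=> i e; have [z [xz yz]] := indep_sep i.
  have := congr1 (inner^~ (M s t g' z)) e; rewrite !innerE !gmul_inner yz mulr0 addr0.
  by move/eqP; rewrite mulf_eq0 (negPf xz) orbF => /eqP/inner_eq0.
move=> i e; split; first exact: key i e.
by apply: key (indepC i) _; rewrite addrC; exact: e.
Qed.

Lemma gmul_coef s t x y u v (a b c d a' b' c' d' : C) : indep x y -> indep u v ->
  a *: M s t x u + b *: M s t x v + c *: M s t y u + d *: M s t y v =
  a' *: M s t x u + b' *: M s t x v + c' *: M s t y u + d' *: M s t y v ->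
  [/\ a = a', b = b', c = c' & d = d'].
Proof.
move=> i j.
have E p q r e : p *: M s t x u + q *: M s t x v + r *: M s t y u + e *: M s t y v =
    M s t x (p *: u + q *: v) + M s t y (r *: u + e *: v) by rewrite !gmulE; vec.
rewrite !E => /(gmul_peell i)[].
by move=> /(indep_eq j)[-> ->] /(indep_eq j)[-> ->].
Qed.

End GradedTheory.

(** * Two-dimensional subproduct systems *)

Section MoreIndep.
Variables (R : realType) (H : hilbertType R).
Local Notation C := R[i].
Implicit Types (u v x y : H).

Lemma indep_or_line x y : x != 0 -> indep x y \/ exists c : C, y = c *: x.
Proof.
move=> x0; have [|h] := pselect (indep x y); [by left|right].
apply: contrapT => h'; apply: h => a b e.
have b0 : b = 0.
  apply/eqP; apply: contrapT => /negP b0; apply: h'; exists (- (a / b)).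
  have -> : y = b^-1 *: (a *: x + b *: y) - (a / b) *: x.
    by rewrite scalerDr !scalerA mulVf// scale1r [b^-1 * a]mulrC addrAC subrr add0r.
  by rewrite e scaler0 add0r scaleNr.
move: e; rewrite b0 scale0r addr0 => /eqP; rewrite scaler_eq0 (negPf x0) orbF => /eqP.
by [].
Qed.

Lemma indep_shear x y (c : C) : indep x y -> indep x (y + c *: x).
Proof.
move=> h; have := @indep_comb R H x y 1 0 c 1 h.
rewrite mul0r subr0 mul1r scale1r scale0r addr0 scale1r [c *: x + y]addrC.
by apply; exact: oner_neq0.
Qed.
End MoreIndep.

(** In [sp_sub], two elementary tensors suffice because a tensor in the product
    of a two-dimensional space with any other space is a sum of two of them. *)
Record subproduct (R : realType) (H : hilbertType R) (T : Type)
    (add : T -> T -> T) (pos : T -> Prop) (M : graded_product H add pos)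
    (K : T -> H -> Prop) : Prop := Subproduct {
  sp_lin : forall t (a : R[i]) x y, K t x -> K t y -> K t (a *: x + y) ;
  sp_basis : forall t, pos t -> exists x y, [/\ K t x, K t y, indep x y &
    forall z, K t z -> exists a b : R[i], z = a *: x + b *: y] ;
  sp_sub : forall s t u, pos s -> pos t -> K (add s t) u ->
    exists g g' h h', [/\ K s g, K s g', K t h, K t h' &
      u = M s t g h + M s t g' h'] }.

Section SubproductTheory.
Variables (R : realType) (H : hilbertType R) (T : Type).
Variables (add : T -> T -> T) (pos : T -> Prop) (M : graded_product H add pos).
Variables (K : T -> H -> Prop) (KP : subproduct M K).
Local Notation C := R[i].

Lemma sp0 t : pos t -> K t 0.
Proof.
move=> /(sp_basis KP)[x [y [Kx _ _ _]]].
by rewrite -(subrr x) addrC -scaleN1r; exact: (sp_lin KP).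
Qed.

Lemma spZ t (a : C) x : pos t -> K t x -> K t (a *: x).
Proof. by move=> t0 Kx; rewrite -[_ *: _]addr0; apply: (sp_lin KP) => //; exact: sp0. Qed.

Lemma spD t x y : K t x -> K t y -> K t (x + y).
Proof. by move=> Kx Ky; rewrite -[x]scale1r; exact: (sp_lin KP). Qed.

Lemma sp_comb t (a b : C) x y : pos t -> K t x -> K t y -> K t (a *: x + b *: y).
Proof. by move=> t0 Kx Ky; apply: (sp_lin KP) => //; exact: spZ. Qed.

Lemma sp_span t x y z : pos t -> K t x -> K t y -> indep x y -> K t z ->
  exists a b : C, z = a *: x + b *: y.
Proof.
move=> t0 + + + Kz; have [e [f [_ _ i sp]]] := sp_basis KP t0.
move=> /sp[a [b ->]] /sp[c [d ->]] /indep_det D; have [p [q ->]] := sp _ Kz.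
exists ((p * d - q * c) / (a * d - b * c)), ((q * a - p * b) / (a * d - b * c)).
by apply: inner_ext => w; rewrite !innerE; field.
Qed.

(** A dimension count: it turns an upper bound on K_t into an equality. *)
Lemma sp_recover t x y u v : pos t -> K t u -> K t v -> indep u v ->
  (exists a b : C, u = a *: x + b *: y) -> (exists a b : C, v = a *: x + b *: y) ->
  K t x /\ K t y.
Proof.
move=> t0 Ku Kv i [a [b eu]] [c [d ev]].
have D : a * d - b * c != 0 by apply: (@indep_det R H x y); rewrite -eu -ev.
split.
  have -> : x = (d / (a * d - b * c)) *: u + (- b / (a * d - b * c)) *: v.
    by rewrite eu ev; apply: inner_ext => w; rewrite !innerE; field.
  exact: sp_comb.
have -> : y = (- c / (a * d - b * c)) *: u + (a / (a * d - b * c)) *: v.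
  by rewrite eu ev; apply: inner_ext => w; rewrite !innerE; field.
exact: sp_comb.
Qed.

Lemma sp_decl s t x y u : pos s -> pos t -> K s x -> K s y -> indep x y ->
  K (add s t) u -> exists g h, [/\ K t g, K t h & u = M s t x g + M s t y h].
Proof.
move=> s0 t0 Kx Ky i /(sp_sub KP s0 t0)[g [g' [h [h' [Kg Kg' Kh Kh' ->]]]]].
have [a [b ->]] := sp_span s0 Kx Ky i Kg; have [c [d ->]] := sp_span s0 Kx Ky i Kg'.
exists (a *: h + c *: h'), (b *: h + d *: h'); split; try exact: sp_comb.
by rewrite !gmulE; vec.
Qed.

Lemma sp_dec s t x y u v w : pos s -> pos t -> K s x -> K s y -> indep x y ->
  K t u -> K t v -> indep u v -> K (add s t) w ->
  exists a b c d : C, w = a *: M s t x u + b *: M s t x v + c *: M s t y u + d *: M s t y v.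
Proof.
move=> s0 t0 Kx Ky i Ku Kv j /(sp_decl s0 t0 Kx Ky i)[g [h [Kg Kh ->]]].
have [a [b ->]] := sp_span t0 Ku Kv j Kg; have [c [d ->]] := sp_span t0 Ku Kv j Kh.
by exists a, b, c, d; rewrite !gmulE; vec.
Qed.

Lemma sp_other t x : pos t -> K t x -> x != 0 -> exists2 y, K t y & indep x y.
Proof.
move=> t0 Kx x0; have [e [f [Ke Kf i _]]] := sp_basis KP t0.
have [|[c ce]] := indep_or_line e x0; first by exists e.
have [|[d df]] := indep_or_line f x0; first by exists f.
have := @indep_det R H x 0 c 0 d 0; rewrite !scale0r !addr0 -ce -df => /(_ i).
by rewrite mulr0 mul0r subrr eqxx.
Qed.

End SubproductTheory.


(** The possible shapes of K_(t+t) inside the tensor square of K_t: spanned by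
    two squares; by a square and a vector p yx + q xy; by xy and yx. In the
    second shape y can be made orthogonal to x, see [type2_indep]; p or q may
    vanish, when all tensors in K_(t+t) share a factor. *)
Section Types.
Variables (R : realType) (H : hilbertType R) (T : Type).
Variables (add : T -> T -> T) (pos : T -> Prop) (M : graded_product H add pos).
Variables (K : T -> H -> Prop) (t : T).
Local Notation C := R[i].

Definition type1_data x y : Prop := [/\ K t x, K t y, indep x y,
  K (add t t) (M t t x x) & K (add t t) (M t t y y)].
Definition type1 : Prop := exists x y, type1_data x y.
Definition type2_data x y (p q : C) : Prop :=
  [/\ [/\ K t x, K t y, x != 0, y != 0 & inner x y = 0], (p != 0) || (q != 0),
    K (add t t) (M t t x x) & K (add t t) (p *: M t t y x + q *: M t t x y)].
Definition type2 : Prop := exists x y p q, type2_data x y p q.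
Definition type3 : Prop := exists x y, [/\ K t x, K t y, indep x y,
  K (add t t) (M t t x y) & K (add t t) (M t t y x)].
End Types.

(** * The shape of the tensor square in discrete time *)

Definition npos (n : nat) : Prop := (0 < n)%N.

Section Discrete.
Variables (R : realType) (H : hilbertType R) (M : graded_product H addn npos).
Variables (K : nat -> H -> Prop) (KP : subproduct M K).
Local Notation C := R[i].

Let pos1 : npos 1. Proof. by []. Qed.
Let pos2 : npos 2. Proof. by []. Qed.
Let pos3 : npos 3. Proof. by []. Qed.

(** A vector of K_3 is v P + w Q, with P = p1 x + p2 y and Q = q1 x + q2 y, since
    K_3 lies in the product of K_2 and K_1. It is also x A + y B with
    A = r1 v + s1 w and B = r2 v + s2 w in K_2, since K_3 lies in the product of
    K_1 and K_2. The eight equations compare the coordinates in the products of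
    three basis vectors. *)
Lemma threefold_coord x y v w (a1 a2 a3 a4 b1 b2 b3 b4 : C) u :
  K 1 x -> K 1 y -> indep x y -> K 2 v -> K 2 w -> indep v w ->
  v = a1 *: M 1 1 x x + a2 *: M 1 1 x y + a3 *: M 1 1 y x + a4 *: M 1 1 y y ->
  w = b1 *: M 1 1 x x + b2 *: M 1 1 x y + b3 *: M 1 1 y x + b4 *: M 1 1 y y ->
  K 3 u -> exists p1 p2 q1 q2 r1 r2 s1 s2 : C,
    [/\ u = M 2 1 v (p1 *: x + p2 *: y) + M 2 1 w (q1 *: x + q2 *: y),
      [/\ a1 * p1 + b1 * q1 = r1 * a1 + s1 * b1, a1 * p2 + b1 * q2 = r1 * a2 + s1 * b2,
        a2 * p1 + b2 * q1 = r1 * a3 + s1 * b3 & a2 * p2 + b2 * q2 = r1 * a4 + s1 * b4] &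
      [/\ a3 * p1 + b3 * q1 = r2 * a1 + s2 * b1, a3 * p2 + b3 * q2 = r2 * a2 + s2 * b2,
        a4 * p1 + b4 * q1 = r2 * a3 + s2 * b3 & a4 * p2 + b4 * q2 = r2 * a4 + s2 * b4]].
Proof.
move=> Kx Ky i Kv Kw j ev ew Ku.
have [P [Q [KP1 KQ eu]]] := @sp_decl _ _ _ _ _ _ _ KP 2 1 v w u pos2 pos1 Kv Kw j Ku.
have [A [B [KA KB eu']]] := @sp_decl _ _ _ _ _ _ _ KP 1 2 x y u pos1 pos2 Kx Ky i Ku.
have [p1 [p2 eP]] := sp_span KP pos1 Kx Ky i KP1.
have [q1 [q2 eQ]] := sp_span KP pos1 Kx Ky i KQ.
have [r1 [s1 eA]] := sp_span KP pos2 Kv Kw j KA.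
have [r2 [s2 eB]] := sp_span KP pos2 Kv Kw j KB.
exists p1, p2, q1, q2, r1, r2, s1, s2; rewrite -eP -eQ.
have as3 a b c : M 2 1 (M 1 1 a b) c = M 1 2 a (M 1 1 b c) by exact: (gmulA M).
have [|e1 e2] := @gmul_peell _ _ _ _ _ M 1 2 x y
   (M 1 1 (a1 *: x + a2 *: y) P + M 1 1 (b1 *: x + b2 *: y) Q)
   (M 1 1 (a3 *: x + a4 *: y) P + M 1 1 (b3 *: x + b4 *: y) Q) A B i.
  rewrite -eu' eu ev ew !gmulE !as3; vec.
split=> //.
- have [|? ? ? ?] := @gmul_coef _ _ _ _ _ M 1 1 x y x y
    (a1 * p1 + b1 * q1) (a1 * p2 + b1 * q2) (a2 * p1 + b2 * q1) (a2 * p2 + b2 * q2)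
    (r1 * a1 + s1 * b1) (r1 * a2 + s1 * b2) (r1 * a3 + s1 * b3) (r1 * a4 + s1 * b4) i i.
    transitivity A; first by rewrite -e1 eP eQ !gmulE; vec.
    by rewrite eA ev ew; vec.
  by split.
- have [|? ? ? ?] := @gmul_coef _ _ _ _ _ M 1 1 x y x y
    (a3 * p1 + b3 * q1) (a3 * p2 + b3 * q2) (a4 * p1 + b4 * q1) (a4 * p2 + b4 * q2)
    (r2 * a1 + s2 * b1) (r2 * a2 + s2 * b2) (r2 * a3 + s2 * b3) (r2 * a4 + s2 * b4) i i.
    transitivity B; first by rewrite -e2 eP eQ !gmulE; vec.
    by rewrite eB ev ew; vec.
  by split.
Qed.

(** The dimension of K_3 enters here: a linear functional of the coordinates of
    [threefold_coord] vanishes on a nonzero vector of K_3. So a shape of K_2 is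
    impossible as soon as the equations and one further linear condition leave
    only zero. *)
Lemma threefold x y v w (a1 a2 a3 a4 b1 b2 b3 b4 f1 f2 f3 f4 : C) :
  K 1 x -> K 1 y -> indep x y -> K 2 v -> K 2 w -> indep v w ->
  v = a1 *: M 1 1 x x + a2 *: M 1 1 x y + a3 *: M 1 1 y x + a4 *: M 1 1 y y ->
  w = b1 *: M 1 1 x x + b2 *: M 1 1 x y + b3 *: M 1 1 y x + b4 *: M 1 1 y y ->
  exists p1 p2 q1 q2 r1 r2 s1 s2 : C,
    [/\ ~ [/\ p1 = 0, p2 = 0, q1 = 0 & q2 = 0],
      f1 * p1 + f2 * p2 + f3 * q1 + f4 * q2 = 0,
      [/\ a1 * p1 + b1 * q1 = r1 * a1 + s1 * b1, a1 * p2 + b1 * q2 = r1 * a2 + s1 * b2,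
        a2 * p1 + b2 * q1 = r1 * a3 + s1 * b3 & a2 * p2 + b2 * q2 = r1 * a4 + s1 * b4] &
      [/\ a3 * p1 + b3 * q1 = r2 * a1 + s2 * b1, a3 * p2 + b3 * q2 = r2 * a2 + s2 * b2,
        a4 * p1 + b4 * q1 = r2 * a3 + s2 * b3 & a4 * p2 + b4 * q2 = r2 * a4 + s2 * b4]].
Proof.
move=> Kx Ky i Kv Kw j ev ew.
have [e [f [Ke Kf k _]]] := sp_basis KP pos3.
have [p1 [p2 [q1 [q2 [r1 [r2 [s1 [s2 [ee [E1 E2 E3 E4] [E5 E6 E7 E8]]]]]]]]]] :=
  threefold_coord Kx Ky i Kv Kw j ev ew Ke.
have [p1' [p2' [q1' [q2' [r1' [r2' [s1' [s2' [ef [F1 F2 F3 F4] [F5 F6 F7 F8]]]]]]]]]] :=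
  threefold_coord Kx Ky i Kv Kw j ev ew Kf.
pose m := f1 * p1 + f2 * p2 + f3 * q1 + f4 * q2.
pose n := f1 * p1' + f2 * p2' + f3 * q1' + f4 * q2'.
have [m0|m0] := eqVneq m 0.
  exists p1, p2, q1, q2, r1, r2, s1, s2; split=> // -[z1 z2 z3 z4].
  have [] := indep_neq0 k; rewrite ee z1 z2 z3 z4 !scale0r !addr0 !gmul0r addr0.
  by rewrite eqxx.
have lin (a b c d p q r s p' q' r' s' : C) : a * p + b * q = r * c + s * d ->
    a * p' + b * q' = r' * c + s' * d ->
    a * (n * p - m * p') + b * (n * q - m * q') =
    (n * r - m * r') * c + (n * s - m * s') * d.
  move=> h h'; transitivity (n * (a * p + b * q) - m * (a * p' + b * q')); first by ring.
  by rewrite h h'; ring.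
exists (n * p1 - m * p1'), (n * p2 - m * p2'), (n * q1 - m * q1'), (n * q2 - m * q2').
exists (n * r1 - m * r1'), (n * r2 - m * r2'), (n * s1 - m * s1'), (n * s2 - m * s2').
split; [|by rewrite /m /n; ring|by split; apply: lin|by split; apply: lin].
move=> [z1 z2 z3 z4]; have [|_ /eqP] := k n (- m); last by rewrite oppr_eq0 (negPf m0).
transitivity (M 2 1 v ((n * p1 - m * p1') *: x + (n * p2 - m * p2') *: y) +
              M 2 1 w ((n * q1 - m * q1') *: x + (n * q2 - m * q2') *: y)).
  by rewrite ee ef !gmulE; vec.
by rewrite z1 z2 z3 z4 !scale0r !addr0 !gmul0r addr0.
Qed.

Lemma pencil_root (a b c : C) : a != 0 -> exists t : C, a * t ^+ 2 + b * t + c = 0.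
Proof.
move=> a0; pose d := sqrtC (b ^+ 2 - 4 * a * c); exists ((d - b) / (2 * a)).
have dd : d ^+ 2 = b ^+ 2 - 4 * a * c by exact: sqrtCK.
have -> : a * ((d - b) / (2 * a)) ^+ 2 + b * ((d - b) / (2 * a)) + c =
  (d ^+ 2 - (b ^+ 2 - 4 * a * c)) / (4 * a) by field.
by rewrite dd subrr mul0r.
Qed.

Lemma rank1_tensor x y (a b c d : C) : a * d = b * c ->
  exists (s t p q : C), a *: M 1 1 x x + b *: M 1 1 x y + c *: M 1 1 y x + d *: M 1 1 y y =
    M 1 1 (s *: x + t *: y) (p *: x + q *: y).
Proof.
move=> D; have [a0|a0] := eqVneq a 0; last first.
  exists 1, (c / a), a, b; rewrite !gmulE; apply: inner_ext => z; rewrite !innerE.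
  have -> : d = b * c / a by rewrite -D mulrAC divff ?mul1r.
  by field.
have [b0|b0] := eqVneq b 0.
  by exists 0, 1, c, d; rewrite a0 b0 !gmulE; vec.
exists 1, (d / b), 0, b; rewrite !gmulE; apply: inner_ext => z; rewrite !innerE.
have -> : c = 0.
  by move/eqP: D; rewrite a0 mul0r eq_sym mulf_eq0 (negPf b0) => /eqP.
by rewrite a0; field.
Qed.

(** The determinant is a quadratic polynomial on the pencil v + t w of 2 x 2
    matrices spanning K_2, so it has a zero. *)
Lemma sp_elementary : exists a b, [/\ K 1 a, K 1 b, K 2 (M 1 1 a b) & M 1 1 a b != 0].
Proof.
have [x [y [Kx Ky i _]]] := sp_basis KP pos1.
have [v [w [Kv Kw j _]]] := sp_basis KP pos2.
have [a [b [c [d ev]]]] :=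
  @sp_dec _ _ _ _ _ _ _ KP 1 1 x y x y v pos1 pos1 Kx Ky i Kx Ky i Kv.
have [a' [b' [c' [d' ew]]]] :=
  @sp_dec _ _ _ _ _ _ _ KP 1 1 x y x y w pos1 pos1 Kx Ky i Kx Ky i Kw.
have key (u : H) (c1 c2 c3 c4 : C) : K 2 u -> u != 0 -> c1 * c4 = c2 * c3 ->
    u = c1 *: M 1 1 x x + c2 *: M 1 1 x y + c3 *: M 1 1 y x + c4 *: M 1 1 y y ->
    exists a b, [/\ K 1 a, K 1 b, K 2 (M 1 1 a b) & M 1 1 a b != 0].
  move=> Ku u0 D eu; have [s [t [p [q E]]]] := rank1_tensor x y D.
  exists (s *: x + t *: y), (p *: x + q *: y).
  by rewrite -E -eu; split=> //; exact: (sp_comb KP).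
have [v0 w0] := indep_neq0 j.
have [D|D] := eqVneq (a' * d') (b' * c'); first exact: (key w a' b' c' d').
have A0 : a' * d' - b' * c' != 0 by rewrite subr_eq0.
have [t ht] := pencil_root (a * d' + a' * d - b * c' - b' * c) (a * d - b * c) A0.
apply: (key (v + t *: w) (a + t * a') (b + t * b') (c + t * c') (d + t * d')).
- by apply: (spD KP) => //; exact: (spZ KP).
- apply/eqP => e; have [] := j 1 t; first by rewrite scale1r.
  by move/eqP; rewrite oner_eq0.
- by apply/eqP; rewrite -subr_eq0 -ht; apply/eqP; ring.
- by rewrite ev ew; vec.
Qed.

(** Adding a multiple of x to y changes p yx + q xy by a multiple of xx. *)
Lemma type2_indep x y (p q : C) : K 1 x -> K 1 y -> indep x y ->
  (p != 0) || (q != 0) -> K 2 (M 1 1 x x) -> K 2 (p *: M 1 1 y x + q *: M 1 1 x y) ->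
  type2 M K 1.
Proof.
move=> Kx Ky i pq Kxx Kxy; have [x0 _] := indep_neq0 i.
have xx : inner x x != 0 by apply: contra_neq x0; exact: inner_eq0.
pose c := - (inner y x / inner x x).
exists x, (y + c *: x), p, q; split=> //.
- have [_ y0] := indep_neq0 (indep_shear (c := c) i); split=> //.
    by apply: (spD KP) => //; exact: (spZ KP).
  by rewrite innerC !innerE mulNr divfK// subrr rmorph0.
- have -> : p *: M 1 1 (y + c *: x) x + q *: M 1 1 x (y + c *: x) =
    ((p + q) * c) *: M 1 1 x x + (p *: M 1 1 y x + q *: M 1 1 x y).
    by rewrite !gmulE; vec.
  exact: (sp_lin KP).
Qed.

(** K_2 contains an elementary tensor ab. If b is parallel to a, then K_2 is
    spanned by aa and some b2 ay + b3 ya + b4 yy; for b4 = 0 this is type 2, and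
    otherwise the equations for K_3 force b2 = b3, and adding a multiple of aa
    completes that vector to a multiple of the square of y + (b2 / b4) a. If a
    and b are independent, then K_2 is spanned by ab and some
    b1 aa + b3 ba + b4 bb, and the equations leave only one nonzero
    coefficient. *)
Lemma trichotomy : [\/ type1 M K 1, type2 M K 1 | type3 M K 1].
Proof.
have [a [b [Ka Kb Kab ab0]]] := sp_elementary.
have a0 : a != 0 by apply: contraNneq ab0 => ->; rewrite gmul0l.
have [i|[l bl]] := indep_or_line b a0; last first.
  have l0 : l != 0 by apply: contraNneq ab0 => l0; rewrite bl l0 scale0r gmul0r.
  have Kaa : K 2 (M 1 1 a a).
    have -> : M 1 1 a a = l^-1 *: M 1 1 a b.
      by rewrite bl gmulE scalerA mulVf// scale1r.
    exact: (spZ KP).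
  have aa0 : M 1 1 a a != 0.
    by apply: contraNneq ab0 => h; rewrite bl gmulE h scaler0.
  have [y Ky i] := sp_other KP pos1 Ka a0.
  have [w Kw j] := sp_other KP pos2 Kaa aa0.
  have [b1 [b2 [b3 [b4 ew]]]] :=
    @sp_dec _ _ _ _ _ _ _ KP 1 1 a y a y w pos1 pos1 Ka Ky i Ka Ky i Kw.
  pose w' := w + (- b1) *: M 1 1 a a.
  have ew' : w' = 0 *: M 1 1 a a + b2 *: M 1 1 a y + b3 *: M 1 1 y a + b4 *: M 1 1 y y.
    by rewrite /w' ew; vec.
  have Kw' : K 2 w' by apply: (spD KP) => //; exact: (spZ KP).
  have j' : indep (M 1 1 a a) w' by exact: indep_shear.
  have [b40|b40] := eqVneq b4 0.
    constructor 2; apply: (@type2_indep a y b3 b2) => //.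
      apply/norP => -[/negPn/eqP z3 /negPn/eqP z2].
      have [_] := indep_neq0 j'; rewrite ew' b40 z2 z3 !scale0r !addr0.
      by rewrite eqxx.
    have -> : b3 *: M 1 1 y a + b2 *: M 1 1 a y = w' by rewrite ew' b40; vec.
    exact: Kw'.
  have [b23|b23] := eqVneq b2 b3.
    constructor 1; exists a, (y + (b2 / b4) *: a); split=> //.
    - by apply: (spD KP) => //; exact: (spZ KP).
    - exact: indep_shear.
    have -> : M 1 1 (y + (b2 / b4) *: a) (y + (b2 / b4) *: a) =
        b4^-1 *: w' + (b2 / b4) ^+ 2 *: M 1 1 a a.
      by rewrite !gmulE ew' -b23; apply: inner_ext => z; rewrite !innerE; field.
    exact: (sp_comb KP).
  have ea : M 1 1 a a = 1 *: M 1 1 a a + 0 *: M 1 1 a y + 0 *: M 1 1 y a + 0 *: M 1 1 y y.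
    by vec.
  have [p1 [p2 [q1 [q2 [r1 [r2 [s1 [s2 [nz p10 [E1 E2 E3 E4] [E5 E6 E7 E8]]]]]]]]]] :=
    threefold 1 0 0 0 Ka Ky i Kaa Kw' j' ea ew'.
  case: nz; have {}p10 : p1 = 0 by rewrite -p10; ring.
  have q2s2 : q2 = s2.
    by apply: (mulfI b40); rewrite -[LHS]add0r -(mul0r p2) E8; ring.
  have q20 : q2 = 0.
    have : (b2 - b3) * q2 = 0.
      transitivity ((r2 * 0 + s2 * b2) - (0 * p2 + b3 * q2)); first by rewrite -q2s2; ring.
      by rewrite E6 subrr.
    by move/eqP; rewrite mulf_eq0 subr_eq0 (negPf b23) => /eqP.
  have q10 : q1 = 0.
    apply: (mulfI b40); transitivity (0 * p1 + b4 * q1); first by ring.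
    by rewrite E7 -q2s2 q20; ring.
  have s10 : s1 = 0.
    apply: (mulfI b40); transitivity (r1 * 0 + s1 * b4); first by ring.
    by rewrite -E4 q20; ring.
  split=> //; transitivity (1 * p2 + 0 * q2); first by ring.
  by rewrite E2 s10; ring.
have [w Kw j] := sp_other KP pos2 Kab ab0.
have [b1 [b2 [b3 [b4 ew]]]] :=
  @sp_dec _ _ _ _ _ _ _ KP 1 1 a b a b w pos1 pos1 Ka Kb i Ka Kb i Kw.
pose w' := w + (- b2) *: M 1 1 a b.
have ew' : w' = b1 *: M 1 1 a a + 0 *: M 1 1 a b + b3 *: M 1 1 b a + b4 *: M 1 1 b b.
  by rewrite /w' ew; vec.
have Kw' : K 2 w' by apply: (spD KP) => //; exact: (spZ KP).
have j' : indep (M 1 1 a b) w' by exact: indep_shear.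
have [_ w0] := indep_neq0 j'.
have Kline (c : C) u : w' = c *: u -> K 2 u.
  move=> wu; have c0 : c != 0 by apply: contraNneq w0 => c0; rewrite wu c0 scale0r.
  have -> : u = c^-1 *: w' by rewrite wu scalerA mulVf// scale1r.
  exact: (spZ KP).
have ea : M 1 1 a b = 0 *: M 1 1 a a + 1 *: M 1 1 a b + 0 *: M 1 1 b a + 0 *: M 1 1 b b.
  by vec.
have [b10|b10] := eqVneq b1 0; have [b40|b40] := eqVneq b4 0.
- constructor 3; exists a, b; split=> //.
  by apply: (Kline b3); rewrite ew' b10 b40; vec.
- have [b30|b30] := eqVneq b3 0.
    constructor 2; apply: (@type2_indep b a 1 0) => //.
    + exact: indepC.
    + by rewrite oner_eq0.
    + by apply: (Kline b4); rewrite ew' b10 b30; vec.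
    + by rewrite scale0r scale1r addr0.
  have [p1 [p2 [q1 [q2 [r1 [r2 [s1 [s2 [nz p20 [E1 E2 E3 E4] [E5 E6 E7 E8]]]]]]]]]] :=
    threefold 0 1 0 0 Ka Kb i Kab Kw' j' ea ew'.
  case: nz; have {}p20 : p2 = 0 by rewrite -p20; ring.
  have q10 : q1 = 0.
    apply: (mulfI b30); transitivity (0 * p1 + b3 * q1); first by ring.
    by rewrite E5 b10; ring.
  have s20 : s2 = 0.
    apply: (mulfI b30); transitivity (r2 * 0 + s2 * b3); first by ring.
    by rewrite -E7 q10; ring.
  have q20 : q2 = 0.
    apply: (mulfI b40); transitivity (0 * p2 + b4 * q2); first by ring.
    by rewrite E8 s20; ring.
  have s10 : s1 = 0.
    apply: (mulfI b40); transitivity (r1 * 0 + s1 * b4); first by ring.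
    by rewrite -E4 p20; ring.
  split=> //; transitivity (1 * p1 + 0 * q1); first by ring.
  by rewrite E3 s10; ring.
- have [b30|b30] := eqVneq b3 0.
    constructor 2; apply: (@type2_indep a b 0 1) => //.
    + by rewrite oner_eq0 orbT.
    + by apply: (Kline b1); rewrite ew' b30 b40; vec.
    + by rewrite scale0r scale1r add0r.
  have [p1 [p2 [q1 [q2 [r1 [r2 [s1 [s2 [nz q20 [E1 E2 E3 E4] [E5 E6 E7 E8]]]]]]]]]] :=
    threefold 0 0 0 1 Ka Kb i Kab Kw' j' ea ew'.
  case: nz; have {}q20 : q2 = 0 by rewrite -q20; ring.
  have s20 : s2 = 0.
    apply: (mulfI b30); transitivity (r2 * 0 + s2 * b3); first by ring.
    by rewrite -E7 b40; ring.
  have q10 : q1 = 0.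
    apply: (mulfI b30); transitivity (0 * p1 + b3 * q1); first by ring.
    by rewrite E5 s20; ring.
  have s10 : s1 = 0.
    apply: (mulfI b10); transitivity (r1 * 0 + s1 * b1); first by ring.
    by rewrite -E1 q10; ring.
  split=> //.
    transitivity (1 * p1 + 0 * q1); first by ring.
    by rewrite E3 s10; ring.
  transitivity (1 * p2 + 0 * q2); first by ring.
  by rewrite E4 s10; ring.
- have [p1 [p2 [q1 [q2 [r1 [r2 [s1 [s2 [nz q10 [E1 E2 E3 E4] [E5 E6 E7 E8]]]]]]]]]] :=
    threefold 0 0 1 0 Ka Kb i Kab Kw' j' ea ew'.
  case: nz; have {}q10 : q1 = 0 by rewrite -q10; ring.
  have s10 : s1 = 0.
    apply: (mulfI b10); transitivity (r1 * 0 + s1 * b1); first by ring.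
    by rewrite -E1 q10; ring.
  have s20 : s2 = 0.
    apply: (mulfI b10); transitivity (r2 * 0 + s2 * b1); first by ring.
    by rewrite -E5 q10; ring.
  have q20 : q2 = 0.
    apply: (mulfI b40); transitivity (0 * p2 + b4 * q2); first by ring.
    by rewrite E8 s20; ring.
  split=> //.
    transitivity (1 * p1 + 0 * q1); first by ring.
    by rewrite E3 s10; ring.
  transitivity (1 * p2 + 0 * q2); first by ring.
  by rewrite E4 s10; ring.
Qed.
End Discrete.

(** * Propagation along the multiples of a step *)

Section Propagation.
Variables (R : realType) (H : hilbertType R) (M : graded_product H addn npos).
Variables (K : nat -> H -> Prop) (KP : subproduct M K).
Local Notation C := R[i].

(** [power x n] and [twist p q x y n] are the solutions X, Y of
    X_(i+j) = X_i X_j and Y_(i+j) = p^j Y_i X_j + q^i X_i Y_j with X_1 = x and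
    Y_1 = y. Their values at 0 are junk: times are positive. *)
Fixpoint power (x : H) (n : nat) : H :=
  if n is m.+1 then (if m is 0%N then x else M m 1 (power x m) x) else x.

Fixpoint twist (p q : C) (x y : H) (n : nat) : H :=
  if n is m.+1 then
    (if m is 0%N then y
     else p *: M m 1 (twist p q x y m) x + q ^+ m *: M m 1 (power x m) y)
  else y.

Lemma powerS x n : (0 < n)%N -> power x n.+1 = M n 1 (power x n) x.
Proof. by case: n. Qed.

Lemma twistS p q x y n : (0 < n)%N -> twist p q x y n.+1 =
  p *: M n 1 (twist p q x y n) x + q ^+ n *: M n 1 (power x n) y.
Proof. by case: n. Qed.

Lemma powerD x i j : (0 < i)%N -> (0 < j)%N ->
  power x (i + j) = M i j (power x i) (power x j).
Proof.
move=> i0; elim: j => // -[_ _|j IHj _]; first by rewrite addn1 powerS.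
rewrite addnS powerS ?addn_gt0 ?i0// IHj// [power x j.+2]powerS// -[in RHS]addn1.
exact: gmulA.
Qed.

Lemma twistD p q x y i j : (0 < i)%N -> (0 < j)%N -> twist p q x y (i + j) =
  p ^+ j *: M i j (twist p q x y i) (power x j) +
  q ^+ i *: M i j (power x i) (twist p q x y j).
Proof.
move=> i0; elim: j => // -[_ _|j IHj _]; first by rewrite addn1 twistS.
rewrite addnS twistS ?addn_gt0 ?i0// IHj// [power x j.+2]powerS// powerD//.
have E a b c : M (i + j.+1) 1 (M i j.+1 a b) c = M i j.+2 a (M j.+1 1 b c).
  by rewrite -[j.+2]addn1; exact: gmulA.
rewrite [twist p q x y j.+2]twistS// !gmulE !E [p ^+ j.+2]exprS exprD.
vec.
Qed.

Lemma power_indep x y n : indep x y -> (0 < n)%N -> indep (power x n) (power y n).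
Proof.
move=> i; elim: n => // -[//|n IHn] _ a b; rewrite !(@powerS _ n.+1)// -!gmulZr.
move=> /(gmul_peell0 (IHn _))[]// /eqP + /eqP; rewrite !scaler_eq0.
by have [/negPf -> /negPf ->] := indep_neq0 i; rewrite !orbF => /eqP -> /eqP ->.
Qed.

Lemma power_neq0 x n : x != 0 -> (0 < n)%N -> power x n != 0.
Proof.
move=> x0; elim: n => // -[//|n IHn] _; rewrite powerS//.
by rewrite -normr_eq0 gmul_norm mulf_neq0 ?normr_eq0 ?IHn.
Qed.

Lemma twist_orth p q x y n : inner x y = 0 -> (0 < n)%N ->
  inner (power x n) (twist p q x y n) = 0.
Proof.
move=> xy; elim: n => // -[//|n IHn] _; rewrite powerS// twistS//.
by rewrite innerDr !innerZr !gmul_inner IHn// xy mul0r !mulr0 addr0.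
Qed.

Lemma twist_neq0 p q x y n : x != 0 -> y != 0 -> inner x y = 0 ->
  (p != 0) || (q != 0) -> (0 < n)%N -> twist p q x y n != 0.
Proof.
move=> x0 y0 xy pq; have i := orth_indep x0 y0 xy.
elim: n => // -[//|n IHn] _; rewrite twistS//; apply/eqP => e.
have [] := @gmul_peelr0 _ _ _ _ _ M n.+1 1 x y
  (p *: twist p q x y n.+1) (q ^+ n.+1 *: power x n.+1) i.
  by rewrite !gmulE.
move=> /eqP + /eqP; rewrite !scaler_eq0 (negPf (IHn _))// orbF => p0.
rewrite (negPf (power_neq0 _ _))// orbF expf_eq0/= => q0.
by move: pq; rewrite p0 q0.
Qed.

(** For n >= 2 a vector of K_(n+1) is x^n g + y^n h, and also x A + y B with A and
    B in K_n. Peeling off the first factor x or y shows that x^(n-1) g and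
    y^(n-1) h lie in K_n = <x^n, y^n>, so g is a multiple of x and h one of y.
    Thus K_(n+1) is contained in, hence equal to, the span of the two powers. *)
Lemma power_fiber x y : K 1 x -> K 1 y -> indep x y ->
  K 2 (M 1 1 x x) -> K 2 (M 1 1 y y) -> forall n, (0 < n)%N ->
  K n (power x n) /\ K n (power y n).
Proof.
move=> Kx Ky i Kxx Kyy; elim=> // -[//|[//|m] IHn _].
have [Kxn Kyn] := IHn isT; set n := m.+2 in IHn Kxn Kyn *.
have n0 : npos n by []. have m0 : npos m.+1 by [].
have pos1 : npos 1 by [].
have in_ := power_indep i n0; have im := power_indep i m0.
have [e [f [Ke Kf k _]]] := sp_basis KP (isT : npos n.+1).
suff span u : K n.+1 u -> exists a b : C, u = a *: power x n.+1 + b *: power y n.+1.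
  exact: (sp_recover KP (isT : npos n.+1) Ke Kf k (span _ Ke) (span _ Kf)).
move=> Ku; have Ku1 : K (n + 1) u by rewrite addn1.
have [g [h [Kg Kh eu]]] := sp_decl KP n0 pos1 Kxn Kyn in_ Ku1.
have [A [B [KA KB eu']]] := @sp_decl _ _ _ _ _ _ _ KP 1 n x y u pos1 n0 Kx Ky i Ku.
have E a b c : M n 1 (M 1 m.+1 a b) c = M 1 n a (M m.+1 1 b c).
  by have := @gmulA _ _ _ _ _ M 1 m.+1 1 a b c; rewrite addn1; exact.
have [|eA eB] := @gmul_peell _ _ _ _ _ M 1 n x y
    (M m.+1 1 (power x m.+1) g) (M m.+1 1 (power y m.+1) h) A B i.
  by rewrite -eu' eu -!E -!(@powerD _ 1 m.+1).
have [g1 [g2 eg]] := sp_span KP pos1 Kx Ky i Kg.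
have [h1 [h2 eh]] := sp_span KP pos1 Kx Ky i Kh.
have [a1 [a2 eA']] := sp_span KP n0 Kxn Kyn in_ KA.
have [b1 [b2 eB']] := sp_span KP n0 Kxn Kyn in_ KB.
have [|_ g20 _ _] := @gmul_coef _ _ _ _ _ M m.+1 1 (power x m.+1) (power y m.+1) x y
    g1 g2 0 0 a1 0 0 a2 im i.
  transitivity A; first by rewrite -eA eg !gmulE; vec.
  by rewrite eA' !(@powerS _ m.+1)//; vec.
have [|_ _ h10 _] := @gmul_coef _ _ _ _ _ M m.+1 1 (power x m.+1) (power y m.+1) x y
    0 0 h1 h2 b1 0 0 b2 im i.
  transitivity B; first by rewrite -eB eh !gmulE; vec.
  by rewrite eB' !(@powerS _ m.+1)//; vec.
exists g1, h2; rewrite eu eg eh g20 h10 !scale0r addr0 add0r !gmulE.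
by rewrite !(@powerS _ n).
Qed.

(** As for [power_fiber], with y^n replaced by the twisted power
    Y_n = p^(n-1) y x^(n-1) + q x Y_(n-1). For a vector x^n g + Y_n h of K_(n+1),
    peeling off the first factor leaves x^(n-1) g + q Y_(n-1) h and
    p^(n-1) x^(n-1) h in K_n; their coordinates show that h = c p x and
    g = g1 x + c q^n y for some c. *)
Lemma twist_fiber x y p q : type2_data M K 1 x y p q -> forall n, (0 < n)%N ->
  K n (power x n) /\ K n (twist p q x y n).
Proof.
move=> [[Kx Ky x0 y0 xy] pq Kxx Kyx]; have i := orth_indep x0 y0 xy.
have indn n : (0 < n)%N -> indep (power x n) (twist p q x y n).
  by move=> n0; apply: orth_indep; [exact: power_neq0|exact: twist_neq0|exact: twist_orth].
elim=> // -[//|[//|m] IHn _].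
have [Kxn Kyn] := IHn isT; set n := m.+2 in IHn Kxn Kyn *.
have n0 : npos n by []. have m0 : npos m.+1 by [].
have pos1 : npos 1 by [].
have in_ := indn n n0; have im := indn m.+1 m0.
have [e [f [Ke Kf k _]]] := sp_basis KP (isT : npos n.+1).
suff span u : K n.+1 u -> exists a b : C, u = a *: power x n.+1 + b *: twist p q x y n.+1.
  exact: (sp_recover KP (isT : npos n.+1) Ke Kf k (span _ Ke) (span _ Kf)).
move=> Ku; have Ku1 : K (n + 1) u by rewrite addn1.
have [g [h [Kg Kh eu]]] := sp_decl KP n0 pos1 Kxn Kyn in_ Ku1.
have [A [B [KA KB eu']]] := @sp_decl _ _ _ _ _ _ _ KP 1 n x y u pos1 n0 Kx Ky i Ku.
have E a b c : M n 1 (M 1 m.+1 a b) c = M 1 n a (M m.+1 1 b c).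
  by have := @gmulA _ _ _ _ _ M 1 m.+1 1 a b c; rewrite addn1; exact.
have [|eA eB] := @gmul_peell _ _ _ _ _ M 1 n x y
    (M m.+1 1 (power x m.+1) g + q *: M m.+1 1 (twist p q x y m.+1) h)
    (p ^+ m.+1 *: M m.+1 1 (power x m.+1) h) A B i.
  rewrite -eu' eu (_ : power x n = M 1 m.+1 x (power x m.+1)); last exact: (@powerD _ 1 m.+1).
  rewrite (_ : twist p q x y n = p ^+ m.+1 *: M 1 m.+1 y (power x m.+1) +
    q *: M 1 m.+1 x (twist p q x y m.+1)); last exact: (@twistD _ _ _ _ 1 m.+1).
  by rewrite !gmulE !E; vec.
have [g1 [g2 eg]] := sp_span KP pos1 Kx Ky i Kg.
have [h1 [h2 eh]] := sp_span KP pos1 Kx Ky i Kh.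
have [a1 [a2 eA']] := sp_span KP n0 Kxn Kyn in_ KA.
have [b1 [b2 eB']] := sp_span KP n0 Kxn Kyn in_ KB.
have [|_ Eg Eh1 Eh2] := @gmul_coef _ _ _ _ _ M m.+1 1 (power x m.+1) (twist p q x y m.+1) x y
    g1 g2 (q * h1) (q * h2) a1 (a2 * q ^+ m.+1) (a2 * p) 0 im i.
  transitivity A; first by rewrite -eA eg eh !gmulE; vec.
  by rewrite eA' /n (@powerS _ m.+1)// (@twistS _ _ _ _ m.+1)//; vec.
have [|_ Fh2 Fp _] := @gmul_coef _ _ _ _ _ M m.+1 1 (power x m.+1) (twist p q x y m.+1) x y
    (p ^+ m.+1 * h1) (p ^+ m.+1 * h2) 0 0 b1 (b2 * q ^+ m.+1) (b2 * p) 0 im i.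
  transitivity B; first by rewrite -eB eh !gmulE; vec.
  by rewrite eB' /n (@powerS _ m.+1)// (@twistS _ _ _ _ m.+1)//; vec.
have h20 : h2 = 0.
  have [q0|q0] := eqVneq q 0; last by apply: (mulfI q0); rewrite Eh2 mulr0.
  have p0 : p != 0 by move: pq; rewrite q0 eqxx orbF.
  have b20 : b2 = 0 by apply: (mulIf p0); rewrite -Fp mul0r.
  by apply: (@mulfI _ (p ^+ m.+1)); rewrite ?expf_neq0// Fh2 b20 mul0r mulr0.
have [c [eh1 eg2]] : exists c, h1 = c * p /\ g2 = c * q ^+ n.
  have [p0|p0] := eqVneq p 0.
    have q0 : q != 0 by move: pq; rewrite p0 eqxx.
    exists (g2 / q ^+ n); rewrite divfK ?expf_neq0//; split=> //.
    by rewrite p0 mulr0; apply: (mulfI q0); rewrite Eh1 p0 !mulr0.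
  exists (h1 / p); rewrite divfK//; split=> //.
  apply: (mulIf p0); rewrite Eg mulrAC -Eh1 /n [q ^+ m.+2]exprS.
  by field.
exists g1, c; rewrite eu eg eh h20 eh1 eg2 (@powerS _ n)// (@twistS _ _ _ _ n)// !gmulE; vec.
Qed.

(** In the alternating case K_3 is spanned by xyx and yxy, so K_4 is spanned by
    xyxy and yxyx, the squares of xy and yx. *)
Lemma type3_double : type3 M K 1 -> type1 M K 2.
Proof.
move=> [x [y [Kx Ky i Kxy Kyx]]].
have pos1 : npos 1 by []. have pos2 : npos 2 by []. have pos3 : npos 3 by [].
pose a := M 1 1 x y; pose b := M 1 1 y x.
have j : indep a b.
  move=> s t e; have [] := @gmul_coef _ _ _ _ _ M 1 1 x y x y 0 s t 0 0 0 0 0 i i.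
    transitivity (0 : H); last by vec.
    by rewrite -e /a /b; vec.
  by [].
have as3 u v w : M 2 1 (M 1 1 u v) w = M 1 2 u (M 1 1 v w) by exact: (gmulA M).
have K3 u : K 3 u -> exists c d : C, u = c *: M 2 1 a x + d *: M 2 1 b y.
  move=> Ku.
  have [p1 [p2 [q1 [q2 [r1 [r2 [s1 [s2 [eu [E1 E2 E3 E4] [E5 E6 E7 E8]]]]]]]]]] :=
    @threefold_coord _ _ _ _ KP x y a b 0 1 0 0 0 0 1 0 u Kx Ky i Kxy Kyx j
      ltac:(rewrite /a; vec) ltac:(rewrite /b; vec) Ku.
  have p20 : p2 = 0.
    by transitivity (1 * p2 + 0 * q2); [ring|rewrite E4; ring].
  have q10 : q1 = 0.
    by transitivity (0 * p1 + 1 * q1); [ring|rewrite E5; ring].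
  by exists p1, q2; rewrite eu p20 q10 !scale0r addr0 add0r !gmulE.
have indaxby : indep (M 2 1 a x) (M 2 1 b y).
  move=> s t; rewrite -!gmulZr => /(gmul_peell0 j)[/eqP + /eqP].
  rewrite !scaler_eq0; have [/negPf -> /negPf ->] := indep_neq0 i.
  by rewrite !orbF => /eqP -> /eqP ->.
have [e [f [Ke Kf k _]]] := sp_basis KP pos3.
have [Kax Kby] := sp_recover KP pos3 Ke Kf k (K3 _ Ke) (K3 _ Kf).
have K4 u : K 4 u -> exists c d : C, u = c *: M 2 2 a a + d *: M 2 2 b b.
  move=> Ku.
  have [g [h [Kg Kh eu]]] := @sp_decl _ _ _ _ _ _ _ KP 3 1 _ _ u pos3 pos1 Kax Kby indaxby Ku.
  have [g1 [g2 eg]] := sp_span KP pos1 Kx Ky i Kg.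
  have [h1 [h2 eh]] := sp_span KP pos1 Kx Ky i Kh.
  have [c1 [c2 [c3 [c4 eu']]]] :=
    @sp_dec _ _ _ _ _ _ _ KP 2 2 a b a b u pos2 pos2 Kxy Kyx j Kxy Kyx j Ku.
  have as4 v w z : M 3 1 (M 2 1 v w) z = M 2 2 v (M 1 1 w z) by exact: (@gmulA _ _ _ _ _ M 2 1 1).
  have [] := @gmul_peell _ _ _ _ _ M 2 2 a b (M 1 1 x g) (M 1 1 y h)
     (c1 *: a + c2 *: b) (c3 *: a + c4 *: b) j.
    by rewrite -!as4 -eu eu' !gmulE; vec.
  rewrite eg eh /a /b => ex ey.
  have [|? _ _ _] := @gmul_coef _ _ _ _ _ M 1 1 x y x y g1 g2 0 0 0 c1 c2 0 i i.
    transitivity (M 1 1 x (g1 *: x + g2 *: y)); first by rewrite !gmulE; vec.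
    by rewrite ex; vec.
  have [|_ _ _ ?] := @gmul_coef _ _ _ _ _ M 1 1 x y x y 0 0 h1 h2 0 c3 c4 0 i i.
    transitivity (M 1 1 y (h1 *: x + h2 *: y)); first by rewrite !gmulE; vec.
    by rewrite ey; vec.
  subst g1 h2; exists g2, h1; rewrite eu eg eh !scale0r addr0 add0r.
  by rewrite !as4 !gmulE.
have [e' [f' [Ke' Kf' k' _]]] := sp_basis KP (isT : npos 4).
have [Kaa Kbb] := sp_recover KP (isT : npos 4) Ke' Kf' k' (K4 _ Ke') (K4 _ Kf').
by exists a, b.
Qed.

End Propagation.

(** * The types at rational times *)

Definition gp_pull (R : realType) (H : hilbertType R) (T T' : Type)
    (add : T -> T -> T) (pos : T -> Prop) (M : graded_product H add pos)
    (add' : T' -> T' -> T') (pos' : T' -> Prop) (f : T' -> T)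
    (fD : forall s t, f (add' s t) = add (f s) (f t))
    (fpos : forall t, pos' t -> pos (f t)) : graded_product H add' pos'.
Proof.
apply: (@GradedProduct R H T' add' pos' (fun s t => M (f s) (f t))).
- by move=> s t y; exact: (gmul_linl M).
- by move=> s t y; exact: (gmul_linr M).
- by move=> s t *; exact: (gmul_inner M).
- by move=> r s t x y z r0 s0 t0; rewrite !fD; apply: (gmulA M); exact: fpos.
Defined.

Lemma sp_pull (R : realType) (H : hilbertType R) (T T' : Type)
    (add : T -> T -> T) (pos : T -> Prop) (M : graded_product H add pos) K
    (add' : T' -> T' -> T') (pos' : T' -> Prop) (f : T' -> T)
    (fD : forall s t, f (add' s t) = add (f s) (f t))
    (fpos : forall t, pos' t -> pos (f t)) :
  subproduct M K -> subproduct (gp_pull M fD fpos) (K \o f).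
Proof.
move=> KP; split=> [t a x y|t /fpos/(sp_basis KP)//|s t u s0 t0 /=].
  exact: (sp_lin KP).
by rewrite fD => /(sp_sub KP); apply; exact: fpos.
Qed.

Section GenericTypes.
Variables (R : realType) (H : hilbertType R) (T : Type).
Variables (add : T -> T -> T) (pos : T -> Prop) (M : graded_product H add pos).
Hypothesis posD : forall s t, pos s -> pos t -> pos (add s t).
Variables (K : T -> H -> Prop) (KP : subproduct M K).
Local Notation C := R[i].

(** Squares single out lines of K_t: when K_(t+t) is spanned by xx and yy, a
    square uu in it has no xy component, so u is a multiple of x or of y. When
    K_(t+t) is of type 2 it has no yy component, so u is a multiple of x. This
    is what makes vectors found at different scales comparable. *)
Lemma squares1 t x y u : pos t -> K t x -> K t y -> indep x y ->
  K (add t t) (M t t x x) -> K (add t t) (M t t y y) ->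
  K t u -> K (add t t) (M t t u u) ->
  (exists c : C, u = c *: x) \/ (exists c : C, u = c *: y).
Proof.
move=> t0 Kx Ky i Kxx Kyy Ku; have [a [b ->]] := sp_span KP t0 Kx Ky i Ku.
have j : indep (M t t x x) (M t t y y).
  move=> c d e; have [] := @gmul_coef _ _ _ _ _ M t t x y x y c 0 0 d 0 0 0 0 i i; last by [].
  transitivity (0 : H); last by vec.
  by rewrite -e; vec.
move=> Kuu; have [c [d e]] := sp_span KP (posD t0 t0) Kxx Kyy j Kuu.
have [|_ ab _ _] := @gmul_coef _ _ _ _ _ M t t x y x y (a * a) (a * b) (b * a) (b * b) c 0 0 d i i.
  by transitivity (M t t (a *: x + b *: y) (a *: x + b *: y)); [rewrite !gmulE|rewrite e]; vec.
move/eqP: ab; rewrite mulf_eq0 => /orP[]/eqP ->; [right; exists b|left; exists a];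
  by rewrite scale0r ?addr0 ?add0r.
Qed.

Lemma type2_indep_sq t x y p q : type2_data M K t x y p q ->
  indep (M t t x x) (p *: M t t y x + q *: M t t x y).
Proof.
move=> [[Kx Ky x0 y0 xy] pq _ _]; have i := orth_indep x0 y0 xy.
move=> c d e; have [] := @gmul_coef _ _ _ _ _ M t t x y x y c (d * q) (d * p) 0 0 0 0 0 i i.
  transitivity (0 : H); last by vec.
  by rewrite -e; vec.
move=> -> /eqP + /eqP; rewrite !mulf_eq0 => h1 h2 _; split=> //; apply/eqP.
by case/orP: pq => /negPf z; [move: h2|move: h1]; rewrite z orbF.
Qed.

Lemma squares2 t x y p q u : pos t -> type2_data M K t x y p q ->
  K t u -> K (add t t) (M t t u u) -> exists c : C, u = c *: x.
Proof.
move=> t0 D Ku Kuu; have j := type2_indep_sq D.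
case: D => [[Kx Ky x0 y0 xy] pq Kxx Kyx]; have i := orth_indep x0 y0 xy.
move: Kuu; have [a [b ->]] := sp_span KP t0 Kx Ky i Ku.
move=> Kuu; have [c [d e]] := sp_span KP (posD t0 t0) Kxx Kyx j Kuu.
have [|_ _ _ bb] := @gmul_coef _ _ _ _ _ M t t x y x y (a * a) (a * b) (b * a) (b * b)
    c (d * q) (d * p) 0 i i.
  by transitivity (M t t (a *: x + b *: y) (a *: x + b *: y)); [rewrite !gmulE|rewrite e]; vec.
by exists a; move/eqP: bb; rewrite mulf_eq0 orbb => /eqP ->; rewrite scale0r addr0.
Qed.

Lemma types_exclusive t : pos t -> type1 M K t -> ~ type2 M K t.
Proof.
move=> t0 [x [y [Kx Ky i Kxx Kyy]]] [u [v [p [q D]]]].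
have [a xa] := squares2 t0 D Kx Kxx; have [b yb] := squares2 t0 D Ky Kyy.
have := @indep_det R H u 0 a 0 b 0; rewrite !scale0r !addr0 -xa -yb => /(_ i).
by rewrite mulr0 mul0r subrr eqxx.
Qed.

Lemma type2_scale t x y p q (a b c : C) : pos t -> a != 0 -> b != 0 -> c != 0 ->
  type2_data M K t x y p q -> type2_data M K t (a *: x) (b *: y) (c * p) (c * q).
Proof.
move=> t0 a0 b0 c0 [[Kx Ky x0 y0 xy] pq Kxx Kyx].
split; first split.
- exact: (spZ KP).
- exact: (spZ KP).
- by rewrite scaler_eq0 negb_or a0.
- by rewrite scaler_eq0 negb_or b0.
- by rewrite innerZl innerZr xy !mulr0.
- by rewrite !mulf_eq0 !negb_or c0.
- by rewrite !gmulE; apply: (spZ KP); [exact: posD|apply: (spZ KP) => //; exact: posD].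
- have -> : (c * p) *: M t t (b *: y) (a *: x) + (c * q) *: M t t (a *: x) (b *: y) =
    (a * b * c) *: (p *: M t t y x + q *: M t t x y) by rewrite !gmulE; vec.
  by apply: (spZ KP) => //; exact: posD.
Qed.

End GenericTypes.

Section DiscreteMultiples.
Variables (R : realType) (H : hilbertType R) (M : graded_product H addn npos).
Variables (K : nat -> H -> Prop) (KP : subproduct M K).
Local Notation C := R[i].

Lemma powerZ (a : C) x n : (0 < n)%N -> power M (a *: x) n = a ^+ n *: power M x n.
Proof.
elim: n => // -[//|n IHn] _; rewrite !(@powerS _ _ _ _ n.+1)// IHn// !gmulE scalerA.
by rewrite mulrC -exprS.
Qed.

Lemma twistZ (a p q : C) x y n : (0 < n)%N ->
  twist M p q x (a *: y) n = a *: twist M p q x y n.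
Proof.
elim: n => // -[//|n IHn] _.
by rewrite !(@twistS _ _ _ _ _ _ _ n.+1)// IHn// !gmulE; vec.
Qed.

Lemma type1_power x y n : K 1 x -> K 1 y -> indep x y ->
    K 2 (M 1 1 x x) -> K 2 (M 1 1 y y) -> (0 < n)%N ->
  [/\ K n (power M x n), K n (power M y n), indep (power M x n) (power M y n),
    K (n + n) (M n n (power M x n) (power M x n)) &
    K (n + n) (M n n (power M y n) (power M y n))].
Proof.
move=> Kx Ky i Kxx Kyy n0; rewrite -!powerD//.
have nn0 : (0 < n + n)%N by rewrite addn_gt0 n0.
have [? ?] := power_fiber KP Kx Ky i Kxx Kyy n0.
have [? ?] := power_fiber KP Kx Ky i Kxx Kyy nn0.
by split=> //; exact: power_indep.
Qed.

Lemma type2_power x y p q n : type2_data M K 1 x y p q -> (0 < n)%N ->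
  type2_data M K n (power M x n) (twist M p q x y n) (p ^+ n) (q ^+ n).
Proof.
move=> D n0; have nn0 : (0 < n + n)%N by rewrite addn_gt0 n0.
have [? ?] := twist_fiber KP D n0; have [? ?] := twist_fiber KP D nn0.
case: (D) => [[Kx Ky x0 y0 xy] pq Kxx Kyx]; split; first split=> //.
- exact: power_neq0.
- exact: twist_neq0.
- exact: twist_orth.
- by rewrite !expf_eq0 n0.
- by rewrite -powerD.
- by rewrite -twistD.
Qed.
End DiscreteMultiples.

Definition qpos (t : rat) : Prop := 0 < t.

Section Rational.
Variables (R : realType) (H : hilbertType R)
  (M : graded_product H (+%R : rat -> rat -> rat) qpos).
Variables (K : rat -> H -> Prop) (KP : subproduct M K).
Local Notation C := R[i].

Let qposD (s t : rat) : qpos s -> qpos t -> qpos (s + t).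
Proof. exact: addr_gt0. Qed.

Section Step.
Variables (tau : rat) (tau0 : qpos tau).

Let stepD (i j : nat) : (i + j)%N%:R * tau = i%:R * tau + j%:R * tau.
Proof. by rewrite natrD mulrDl. Qed.
Let step_pos (i : nat) : npos i -> qpos (i%:R * tau).
Proof. by move=> i0; rewrite /qpos mulr_gt0// ltr0n. Qed.

Definition step_gp : graded_product H addn npos := gp_pull M stepD step_pos.
Definition step_fiber : nat -> H -> Prop := fun n => K (n%:R * tau).

Lemma step_sp : subproduct step_gp step_fiber.
Proof. exact: sp_pull. Qed.

Lemma step_type1_data n x y : type1_data step_gp step_fiber n x y <->
  type1_data M K (n%:R * tau) x y.
Proof. by rewrite /type1_data /step_fiber stepD. Qed.

Lemma step_type1 n : type1 step_gp step_fiber n -> type1 M K (n%:R * tau).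
Proof.
move=> [u [v [? ? ? Kuu Kvv]]]; exists u, v; split=> //.
  by move: Kuu; rewrite /step_fiber stepD.
by move: Kvv; rewrite /step_fiber stepD.
Qed.

Lemma step_type2 n x y p q : type2_data step_gp step_fiber n x y p q <->
  type2_data M K (n%:R * tau) x y p q.
Proof. by rewrite /type2_data /step_fiber stepD. Qed.

End Step.

(** The alternating type cannot occur at a time that can be halved: each of the
    three types at tau / 2 becomes type 1 or type 2 at tau. *)
Lemma rational_types tau : qpos tau -> type1 M K tau \/ type2 M K tau.
Proof.
move=> tau0; have t20 : qpos (tau / 2) by rewrite /qpos divr_gt0.
have e : tau = 2%:R * (tau / 2) by rewrite mulrC divfK.
rewrite e; case: (trichotomy (step_sp t20)).
- move=> [x [y [Kx Ky i Kxx Kyy]]]; left; apply: step_type1 => //.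
  have [? ? ? ? ?] := type1_power (step_sp t20) Kx Ky i Kxx Kyy (isT : (0 < 2)%N).
  by exists (power (step_gp t20) x 2), (power (step_gp t20) y 2).
- move=> [x [y [p [q D]]]]; right.
  have := type2_power (step_sp t20) D (isT : (0 < 2)%N).
  move/step_type2 => D2; by eexists _, _, _, _; exact: D2.
- by move=> /(type3_double (step_sp t20)) T1; left; exact: step_type1.
Qed.

End Rational.

(** * From the factorial grids to rational times *)

Lemma dependent_chain (A : Type) (P : nat -> A -> Prop) (Q : nat -> A -> A -> Prop) a0 :
  P 0 a0 -> (forall n a, P n a -> exists2 b, P n.+1 b & Q n a b) ->
  exists f : nat -> A, forall n, P n (f n) /\ Q n (f n) (f n.+1).
Proof.
move=> P0 step.
have /choice[g hg] : forall na : nat * A, exists b,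
    P na.1 na.2 -> P na.1.+1 b /\ Q na.1 na.2 b.
  move=> [n a]; have [/step[b ? ?]|] := pselect (P n a); first by exists b.
  by exists a.
pose f := fix f n := if n is m.+1 then g (m, f m) else a0.
have Pf n : P n (f n) by elim: n => // n /(hg (n, f n))[].
by exists f => n; split=> //; have [] := hg (n, f n) (Pf n).
Qed.

Section FactorialGrid.

(** The grids of step 1 / n! increase with n, and each rational lies on all but
    finitely many of them. *)
Definition grid (n k : nat) : rat := k%:R / n`!%:R.

Lemma fact_dvd n m : (n`! %| (n + m)`!)%N.
Proof.
apply/dvdnP; exists ('C(n + m, n) * m`!)%N.
by rewrite -mulnA [(m`! * _)%N]mulnC -[in m`!](addKn n m) bin_fact// leq_addr.
Qed.

Lemma grid_fine n k m : grid n k = grid (n + m) (k * ((n + m)`! %/ n`!)).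
Proof.
have d := fact_dvd n m.
have n0 : n`!%:R != 0 :> rat by rewrite pnatr_eq0 -lt0n fact_gt0.
have m0 : (n + m)`!%:R != 0 :> rat by rewrite pnatr_eq0 -lt0n fact_gt0.
apply: (mulIf m0); rewrite /grid divfK// natrM.
rewrite -[X in _ / _ * X%:R](divnK d) natrM; field.
exact: n0.
Qed.

Lemma grid_inj n k l : grid n k = grid n l -> k = l.
Proof.
have n0 : n`!%:R != 0 :> rat by rewrite pnatr_eq0 -lt0n fact_gt0.
by move=> /(divIf n0)/eqP; rewrite eqr_nat => /eqP.
Qed.

Lemma gridP (s : rat) n : 0 < s -> (`|denq s| <= n)%N -> exists2 k, (0 < k)%N & s = grid n k.
Proof.
move=> s0 dn; have d0 : (0 < `|denq s|)%N by rewrite absz_gt0 denq_neq0.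
have [e he] : exists e, n`! = (e * `|denq s|)%N.
  by apply/dvdnP; apply: dvdn_fact; rewrite d0.
have ns : 0 < numq s by rewrite numq_gt0.
have e0 : (0 < e)%N by move: (fact_gt0 n); rewrite he muln_gt0 => /andP[].
exists (`|numq s| * e)%N; first by rewrite muln_gt0 e0 andbT absz_gt0 gt_eqF.
rewrite /grid he !natrM.
rewrite [LHS](_ : s = (`|numq s|%:R / `|denq s|%:R)); last first.
  rewrite -[LHS]divq_num_den; congr (_ / _).
    by rewrite -[in LHS](gtz0_abs ns).
  by rewrite -[in LHS](gtz0_abs (denq_gt0 s)).
have e0' : e%:R != 0 :> rat by rewrite pnatr_eq0 -lt0n.
have d0' : `|denq s|%:R != 0 :> rat by rewrite pnatr_eq0 -lt0n.
by field; rewrite e0' d0'.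
Qed.

Lemma grid_common (s t : rat) : 0 < s -> 0 < t ->
  exists n i j, [/\ (0 < i)%N, (0 < j)%N, s = grid n i & t = grid n j].
Proof.
move=> s0 t0; pose n := maxn `|denq s| `|denq t|.
have [i i0 si] := gridP s0 (leq_maxl _ _ : (_ <= n)%N).
have [j j0 tj] := gridP t0 (leq_maxr _ _ : (_ <= n)%N).
by exists n, i, j.
Qed.

Lemma gridD n i j : grid n (i + j) = grid n i + grid n j.
Proof. by rewrite /grid natrD mulrDl. Qed.

Lemma grid_glue (A : Type) (f : nat -> nat -> A) :
  (forall n k, (0 < k)%N -> f n k = f n.+1 (k * n.+1)%N) ->
  exists F : rat -> A, forall n k, (0 < k)%N -> F (grid n k) = f n k.
Proof.
move=> fE.
have fine n k m : (0 < k)%N -> f n k = f (n + m)%N (k * ((n + m)`! %/ n`!))%N.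
  move=> k0; elim: m => [|m ->]; first by rewrite addn0 divnn fact_gt0 muln1.
  have d := fact_dvd n m.
  have q0 : (0 < (n + m)`! %/ n`!)%N.
    rewrite divn_gt0; last exact: fact_gt0.
    by apply: dvdn_leq => //; exact: fact_gt0.
  rewrite fE; last by rewrite muln_gt0 k0.
  by rewrite addnS -mulnA [(_ * (n + m).+1)%N]mulnC muln_divA// -factS.
have F1 (s : rat) : exists a, forall n k, (0 < k)%N -> s = grid n k -> a = f n k.
  have [[n [k [k0 e]]]|h] := pselect (exists n k, (0 < k)%N /\ s = grid n k).
    exists (f n k) => m l l0 e'; rewrite (fine n k m)// (fine m l n)// [(m + n)%N]addnC.
    congr f; apply: (@grid_inj (n + m)); rewrite -grid_fine [in RHS]addnC -grid_fine.
    by rewrite -e.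
  exists (f 0 0)%N => n k k0 e; case: h; by exists n, k.
have [F hF] := choice F1; exists F => n k k0; exact: hF.
Qed.
End FactorialGrid.

Section Refinement.
Variables (R : realType) (H : hilbertType R).
Variable M : graded_product H (+%R : rat -> rat -> rat) qpos.
Variables (K : rat -> H -> Prop) (KP : subproduct M K).
Local Notation C := R[i].

Let qposD (s t : rat) : qpos s -> qpos t -> qpos (s + t).
Proof. exact: addr_gt0. Qed.

Lemma root_exists (a : C) n : (0 < n)%N -> a != 0 -> exists2 r : C, r != 0 & r ^+ n = a.
Proof.
move=> n0 a0; exists (n.-root a); last by rewrite rootCK.
by rewrite rootC_eq0.
Qed.

Lemma power_norm (M' : graded_product H addn npos) (x : H) n : (0 < n)%N ->
  `|power M' x n| = `|x| ^+ n.
Proof.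
by elim: n => // -[//|n IHn] _; rewrite !(@powerS _ _ _ _ n.+1)// gmul_norm IHn// -exprSr.
Qed.

Lemma norm1_root (x : C) n : (0 < n)%N -> 0 <= x -> x ^+ n = 1 -> x = 1.
Proof. by move=> n0 x0 /eqP; rewrite pexpr_eq1// => /eqP. Qed.

Section OneStep.
Variables (tau sigma : rat) (tau0 : qpos tau) (sigma0 : qpos sigma) (N : nat).
Hypotheses (N0 : (0 < N)%N) (tauE : tau = N%:R * sigma).
Local Notation P := (step_gp M sigma0).
Local Notation L := (step_gp M tau0).

Let timeE k : k%:R * tau = (k * N)%:R * sigma.
Proof. by rewrite natrM -mulrA -tauE. Qed.

Lemma power_power x k : (0 < k)%N -> power L (power P x N) k = power P x (k * N).
Proof.
elim: k => // -[_ _|k IHk _]; first by rewrite mul1n.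
rewrite (@powerS _ _ _ _ k.+1)// IHk// [in RHS]mulSnr powerD ?muln_gt0//.
by rewrite /= !timeE mul1n.
Qed.

Lemma twist_twist p q x y k : (0 < k)%N ->
  twist L (p ^+ N) (q ^+ N) (power P x N) (twist P p q x y N) k = twist P p q x y (k * N).
Proof.
elim: k => // -[_ _|k IHk _]; first by rewrite mul1n.
rewrite (@twistS _ _ _ _ _ _ _ k.+1)// IHk// power_power// [in RHS]mulSnr twistD ?muln_gt0//.
by rewrite /= !timeE mul1n -exprM [(N * _)%N]mulnC.
Qed.

Let one_sigma : 1%:R * sigma = sigma. Proof. exact: mul1r. Qed.

(** The powers a^N and b^N of a type 1 pair a, b at the finer step have their
    squares in K_(tau+tau), hence are multiples of x and y in some order; an N-th
    root of the coefficient corrects a and b. A type 2 pair at the finer step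
    would propagate to tau. *)
Lemma refine1 x y : type1_data M K tau x y -> `|x| = 1 -> `|y| = 1 ->
  exists x' y', [/\ type1_data M K sigma x' y', `|x'| = 1, `|y'| = 1,
    power P x' N = x & power P y' N = y].
Proof.
move=> D nx ny.
have [T1|[a [b [p [q D2]]]]] := rational_types KP sigma0; last first.
  exfalso; apply: (types_exclusive qposD KP tau0); first by exists x, y; exact: D.
  rewrite -one_sigma in D2.
  have := type2_power (step_sp KP sigma0) (proj2 (step_type2 M K sigma0 1 _ _ _ _) D2) N0.
  by move=> /step_type2; rewrite -tauE => D3; eexists _, _, _, _; exact: D3.
have key a b : type1_data M K sigma a b -> (exists c : C, power P a N = c *: x) ->
    (exists c : C, power P b N = c *: y) ->
    exists x' y', [/\ type1_data M K sigma x' y', `|x'| = 1, `|y'| = 1,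
      power P x' N = x & power P y' N = y].
  move=> [Ka Kb i Kaa Kbb] [c ec] [d ed]; have [a0 b0] := indep_neq0 i.
  have c0 : c != 0.
    by apply: contraNneq (power_neq0 P a0 N0) => c0; rewrite ec c0 scale0r.
  have d0 : d != 0.
    by apply: contraNneq (power_neq0 P b0 N0) => d0; rewrite ed d0 scale0r.
  have [r r0 rN] := root_exists N0 (invr_neq0 c0).
  have [s s0 sN] := root_exists N0 (invr_neq0 d0).
  have ex : power P (r *: a) N = x by rewrite powerZ// rN ec scalerA mulVf// scale1r.
  have ey : power P (s *: b) N = y by rewrite powerZ// sN ed scalerA mulVf// scale1r.
  exists (r *: a), (s *: b); split=> //.
  - split; try exact: (spZ KP).
    + have := @indep_comb _ _ a b r 0 0 s i.
      by rewrite !scale0r addr0 add0r mul0r subr0; apply; rewrite mulf_neq0.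
    + by rewrite !gmulE !scalerA; apply: (spZ KP) => //; exact: qposD.
    + by rewrite !gmulE !scalerA; apply: (spZ KP) => //; exact: qposD.
  - by apply: (@norm1_root _ N) => //; rewrite -(power_norm P)// ex.
  - by apply: (@norm1_root _ N) => //; rewrite -(power_norm P)// ey.
case: T1 => a [b Dab]; have Dab' := Dab; rewrite -one_sigma in Dab'.
have [Ka Kb i Kaa Kbb] := proj2 (step_type1_data M K sigma0 1 _ _) Dab'.
have [KaN KbN j KaaN KbbN] := proj1 (step_type1_data M K sigma0 N _ _)
  (type1_power (step_sp KP sigma0) Ka Kb i Kaa Kbb N0).
rewrite -tauE in KaN KbN KaaN KbbN.
case: (D) => [Kx Ky k Kxx Kyy].
have dep (u v : H) (c d : C) w : indep u v -> u = c *: w -> v = d *: w -> False.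
  move=> h eu ev; have := @indep_det R H w 0 c 0 d 0; rewrite !scale0r !addr0 -eu -ev => /(_ h).
  by rewrite mulr0 mul0r subrr eqxx.
have [[c ec]|[c ec]] := squares1 qposD KP tau0 Kx Ky k Kxx Kyy KaN KaaN;
  have [[d ed]|[d ed]] := squares1 qposD KP tau0 Kx Ky k Kxx Kyy KbN KbbN.
- by have := dep _ _ _ _ _ j ec ed.
- by apply: (key a b) => //; [exists c|exists d].
- apply: (key b a); [|by exists d|by exists c].
  by case: Dab => ? ? ? ? ?; split=> //; exact: indepC.
- by have := dep _ _ _ _ _ j ec ed.
Qed.

(** By [squares2] the power a^N is a multiple of x, and the twisted power,
    orthogonal to it, is a multiple of y. Comparing the vectors of K_(tau+tau),
    (p1^N, q1^N) is proportional to (p, q). Three rescalings, by an N-th root in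
    the cases of a and (p1, q1), turn proportionality into equality. *)
Lemma refine2 x y p q : type2_data M K tau x y p q -> `|x| = 1 ->
  exists x' y' p' q', [/\ type2_data M K sigma x' y' p' q', `|x'| = 1,
    power P x' N = x, twist P p' q' x' y' N = y & p' ^+ N = p /\ q' ^+ N = q].
Proof.
move=> D nx.
have up a b (p' q' : C) : type2_data M K sigma a b p' q' ->
    type2_data M K tau (power P a N) (twist P p' q' a b N) (p' ^+ N) (q' ^+ N).
  rewrite -{1}one_sigma tauE => /(proj2 (step_type2 M K sigma0 1 _ _ _ _)) D2.
  apply: (proj1 (step_type2 M K sigma0 N _ _ _ _)).
  exact: (type2_power (step_sp KP sigma0) D2 N0).
have [T1|[a [b [p1 [q1 D1]]]]] := rational_types KP sigma0.
  exfalso; apply: (types_exclusive qposD KP tau0); last by exists x, y, p, q; exact: D.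
  case: T1 => a [b Dab]; rewrite -one_sigma in Dab.
  have [Ka Kb i Kaa Kbb] := proj2 (step_type1_data M K sigma0 1 _ _) Dab.
  have := proj1 (step_type1_data M K sigma0 N _ _)
    (type1_power (step_sp KP sigma0) Ka Kb i Kaa Kbb N0).
  by rewrite -tauE => D3; eexists _, _; exact: D3.
case: (D) => [[Kx Ky x0 y0 xy] pq Kxx Kyx]; have i := orth_indep x0 y0 xy.
have second a' b' (p' q' : C) : type2_data M K sigma a' b' p' q' ->
    power P a' N = x -> exists2 c : C, c != 0 & twist P p' q' a' b' N = c *: y.
  move=> /up[[_ Kt _ t0 xt] _ _ _] ex; rewrite ex in xt.
  have [c [d e]] := sp_span KP tau0 Kx Ky i Kt.
  have xx : inner x x != 0 by apply: contra_neq x0; exact: inner_eq0.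
  have c0 : c = 0.
    have := xt; rewrite innerC e !innerE [inner y x]innerC xy rmorph0 mulr0 addr0.
    rewrite rmorphM/= -innerC => /eqP; rewrite mulf_eq0 (negPf xx) orbF conjC_eq0.
    by move=> /eqP.
  exists d; last by rewrite e c0 scale0r add0r.
  by apply: contraNneq t0 => d0; rewrite e c0 d0 !scale0r addr0.
have [[Kp _ pw0 _ _] _ Kpp _] := up _ _ _ _ D1.
have [xi ex] := squares2 qposD KP tau0 D Kp Kpp.
have xi0 : xi != 0 by apply: contraNneq pw0 => z; rewrite ex z scale0r.
have [r r0 rN] := root_exists N0 (invr_neq0 xi0).
have exr : power P (r *: a) N = x by rewrite powerZ// rN ex scalerA mulVf// scale1r.
have o0 : (1 : C) != 0 := oner_neq0 _.
have D2 := type2_scale qposD KP sigma0 r0 o0 o0 D1.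
have [c c0 ec] := second _ _ _ _ D2 exr.
have [t [t0 tp tq]] : exists t : C, [/\ t != 0, p1 ^+ N = t * p & q1 ^+ N = t * q].
  have := up _ _ _ _ D2; rewrite exr ec !mul1r => -[_ pq1 _].
  rewrite !gmulE !scalerA => K1.
  have [s [t e]] := sp_span KP (qposD tau0 tau0) Kxx Kyx (type2_indep_sq D) K1.
  have [|_ eq ep _] := @gmul_coef _ _ _ _ _ M tau tau x y x y
      0 (q1 ^+ N * c) (p1 ^+ N * c) 0 s (t * q) (t * p) 0 i i.
    transitivity ((p1 ^+ N * c) *: M tau tau y x + (q1 ^+ N * c) *: M tau tau x y).
      by vec.
    by rewrite e; vec.
  have ep' : p1 ^+ N = t / c * p by rewrite mulrAC -ep mulfK.
  have eq' : q1 ^+ N = t / c * q by rewrite mulrAC -eq mulfK.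
  exists (t / c); split=> //; apply: contraTneq pq1 => z.
  by rewrite ep' eq' z !mul0r eqxx.
have [l l0 lN] := root_exists N0 (invr_neq0 t0).
have D3 := type2_scale qposD KP sigma0 r0 o0 l0 D1.
have [d d0 ed] := second _ _ _ _ D3 exr.
have D4 := type2_scale qposD KP sigma0 r0 (invr_neq0 d0) l0 D1.
exists (r *: a), (d^-1 *: b), (l * p1), (l * q1); split=> //.
- by apply: (@norm1_root _ N) => //; rewrite -(power_norm P)// exr.
- rewrite twistZ//; move: ed; rewrite scale1r => ->.
  by rewrite scalerA mulVf// scale1r.
- by rewrite !exprMn lN tp tq !mulrA mulVf// !mul1r.
Qed.

End OneStep.
End Refinement.

Section Families.
Variables (R : realType) (H : hilbertType R).
Variable M : graded_product H (+%R : rat -> rat -> rat) qpos.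
Variables (K : rat -> H -> Prop) (KP : subproduct M K).
Local Notation C := R[i].

Definition unit_family (X : rat -> H) : Prop :=
  (forall s, 0 < s -> K s (X s) /\ `|X s| = 1) /\
  (forall s t, 0 < s -> 0 < t -> X (s + t) = M s t (X s) (X t)).

Definition unit_pair (X Y : rat -> H) : Prop :=
  [/\ unit_family X, unit_family Y & forall s, 0 < s -> indep (X s) (Y s)].

Definition twisted_family (X Y : rat -> H) (p q : rat -> C) : Prop :=
  [/\ forall s, 0 < s -> [/\ K s (Y s), Y s != 0 & inner (X s) (Y s) = 0],
      forall s t, 0 < s -> 0 < t ->
        [/\ p (s + t) = p s * p t, q (s + t) = q s * q t &
          Y (s + t) = p t *: M s t (Y s) (X t) + q s *: M s t (X s) (Y t)] &
      forall s, 0 < s -> (p s != 0) || (q s != 0)].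

Let tau n := grid n 1.
Let tau0 n : qpos (tau n).
Proof. by rewrite /qpos /tau /grid mul1r invr_gt0 ltr0n fact_gt0. Qed.
Let tauE n : tau n = n.+1%:R * tau n.+1.
Proof. by rewrite /tau /grid !mul1r factS natrM invfM mulrA divff ?mul1r// pnatr_eq0. Qed.
Let gridE n k : k%:R * tau n = grid n k.
Proof. by rewrite /tau /grid mul1r. Qed.
Let L n := step_gp M (tau0 n).

Lemma unit_family_glue (x : nat -> H) (X : rat -> H) :
  (forall n k, (0 < k)%N -> K (grid n k) (power (L n) (x n) k)) ->
  (forall n, `|x n| = 1) ->
  (forall n k, (0 < k)%N -> X (grid n k) = power (L n) (x n) k) -> unit_family X.
Proof.
move=> Kx nx XE; split=> [s s0|s t s0 t0].
  have [n k0 ->] := gridP s0 (leqnn _); rewrite XE//; split; first exact: Kx.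
  by rewrite power_norm// nx expr1n.
have [n [i [j [i0 j0 -> ->]]]] := grid_common s0 t0.
by rewrite -gridD !XE ?addn_gt0 ?i0// powerD//= !gridE.
Qed.

(** The pair found at time 1 is refined successively to the times 1 / n!, each
    time so that its powers reproduce the previous pair exactly. The powers of
    all these pairs are then values of functions of rational time. *)
Theorem rational_families :
  (exists X Y, unit_pair X Y) \/
  (exists X Y p q, unit_family X /\ twisted_family X Y p q).
Proof.
case: (rational_types KP (tau0 0)) => [[x [y D]]|[x [y [p [q D]]]]]; [left|right].
- case: (D) => Kx Ky i Kxx Kyy; have [x0 y0] := indep_neq0 i.
  have nrm (z : H) : z != 0 -> `| (`|z|^-1 : C) *: z| = 1.
    by move=> z0; rewrite normrZ normfV normr_id mulVf// normr_eq0.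
  have D' : type1_data M K (tau 0) ((`|x|^-1 : C) *: x) ((`|y|^-1 : C) *: y).
    split; try exact: (spZ KP).
    + have := @indep_comb _ _ x y (`|x|^-1) 0 0 (`|y|^-1) i.
      rewrite !scale0r addr0 add0r mul0r subr0; apply.
      by rewrite mulf_neq0// invr_eq0 normr_eq0.
    + by rewrite !gmulE !scalerA; apply: (spZ KP) => //; apply: addr_gt0; exact: tau0.
    + by rewrite !gmulE !scalerA; apply: (spZ KP) => //; apply: addr_gt0; exact: tau0.
  pose St n (a : H * H) := [/\ type1_data M K (tau n) a.1 a.2, `|a.1| = 1 & `|a.2| = 1].
  pose Lk n (a b : H * H) := power (L n.+1) b.1 n.+1 = a.1 /\ power (L n.+1) b.2 n.+1 = a.2.
  have [|n [a1 a2] [/= Da n1 n2]|f hf] := @dependent_chain _ St Lk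
    ((`|x|^-1 : C) *: x, (`|y|^-1 : C) *: y).
  + by split=> //=; exact: nrm.
  + have [x' [y' [D1 ? ? ? ?]]] := refine1 KP (tau0 n) (tau0 n.+1) (ltn0Sn n) (tauE n) Da n1 n2.
    by exists (x', y').
  have compat (g : H * H -> H) : (forall n, power (L n.+1) (g (f n.+1)) n.+1 = g (f n)) ->
      exists F : rat -> H, forall n k, (0 < k)%N -> F (grid n k) = power (L n) (g (f n)) k.
    move=> h; apply: grid_glue => n k k0.
    by rewrite -h (power_power M (tau0 n) (tau0 n.+1) (ltn0Sn n) (tauE n)).
  have [X XE] := compat fst (fun n => proj1 (proj2 (hf n))).
  have [Y YE] := compat snd (fun n => proj2 (proj2 (hf n))).
  have all n k : (0 < k)%N -> [/\ K (grid n k) (power (L n) (f n).1 k),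
      K (grid n k) (power (L n) (f n).2 k) &
      indep (power (L n) (f n).1 k) (power (L n) (f n).2 k)].
    move=> k0; have [[+ _ _] _] := hf n; rewrite -[tau n]mul1r => D1.
    have [Ka Kb j Kaa Kbb] := proj2 (step_type1_data M K (tau0 n) 1 _ _) D1.
    have [] := type1_power (step_sp KP (tau0 n)) Ka Kb j Kaa Kbb k0.
    by rewrite /step_fiber gridE.
  exists X, Y; split.
  + apply: (@unit_family_glue (fst \o f)) => //= [n k k0|n]; first by have [] := all n k k0.
    by have [[]] := hf n.
  + apply: (@unit_family_glue (snd \o f)) => //= [n k k0|n]; first by have [] := all n k k0.
    by have [[]] := hf n.
  + move=> s s0; have [k k0 ->] := gridP s0 (leqnn _); rewrite XE// YE//.
    by have [] := all `|denq s|%N _ k0.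
- have x0 : x != 0 by case: D => -[].
  have D' : type2_data M K (tau 0) ((`|x|^-1 : C) *: x) y p q.
    have o0 : (1 : C) != 0 := oner_neq0 _.
    have xi : (`|x|^-1 : C) != 0 by rewrite invr_eq0 normr_eq0.
    have := type2_scale (fun s t => @addr_gt0 _ s t) KP (tau0 0) xi o0 o0 D.
    by rewrite scale1r !mul1r.
  pose St n (a : (H * H) * (C * C)) :=
    type2_data M K (tau n) a.1.1 a.1.2 a.2.1 a.2.2 /\ `|a.1.1| = 1.
  pose Lk n (a b : (H * H) * (C * C)) := [/\ power (L n.+1) b.1.1 n.+1 = a.1.1,
    twist (L n.+1) b.2.1 b.2.2 b.1.1 b.1.2 n.+1 = a.1.2,
    b.2.1 ^+ n.+1 = a.2.1 & b.2.2 ^+ n.+1 = a.2.2].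
  have [|n [[a1 a2] [p' q']] [/= Da n1]|f hf] := @dependent_chain _ St Lk
    ((`|x|^-1 : C) *: x, y, (p, q)).
  + by split=> //=; rewrite normrZ normfV normr_id mulVf// normr_eq0.
  + have [x1 [y1 [p1 [q1 [D1 ? ? ? [? ?]]]]]] :=
      refine2 KP (tau0 n) (tau0 n.+1) (ltn0Sn n) (tauE n) Da n1.
    by exists (x1, y1, (p1, q1)).
  pose fx n := (f n).1.1; pose fy n := (f n).1.2.
  pose fp n := (f n).2.1; pose fq n := (f n).2.2.
  have lx n : power (L n.+1) (fx n.+1) n.+1 = fx n by have [_ []] := hf n.
  have ly n : twist (L n.+1) (fp n.+1) (fq n.+1) (fx n.+1) (fy n.+1) n.+1 = fy n.
    by have [_ []] := hf n.
  have lp n : fp n.+1 ^+ n.+1 = fp n by have [_ []] := hf n.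
  have lq n : fq n.+1 ^+ n.+1 = fq n by have [_ []] := hf n.
  have [X XE] : exists F : rat -> H, forall n k, (0 < k)%N ->
      F (grid n k) = power (L n) (fx n) k.
    apply: grid_glue => n k k0.
    by rewrite -lx (power_power M (tau0 n) (tau0 n.+1) (ltn0Sn n) (tauE n)).
  have [Y YE] : exists F : rat -> H, forall n k, (0 < k)%N ->
      F (grid n k) = twist (L n) (fp n) (fq n) (fx n) (fy n) k.
    apply: grid_glue => n k k0; rewrite -lx -ly -lp -lq.
    by rewrite (twist_twist M (tau0 n) (tau0 n.+1) (ltn0Sn n) (tauE n)).
  have [P PE] : exists F : rat -> C, forall n k, (0 < k)%N -> F (grid n k) = fp n ^+ k.
    by apply: grid_glue => n k k0; rewrite -lp -exprM mulnC.
  have [Q QE] : exists F : rat -> C, forall n k, (0 < k)%N -> F (grid n k) = fq n ^+ k.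
    by apply: grid_glue => n k k0; rewrite -lq -exprM mulnC.
  have all n k : (0 < k)%N -> type2_data M K (grid n k) (power (L n) (fx n) k)
      (twist (L n) (fp n) (fq n) (fx n) (fy n) k) (fp n ^+ k) (fq n ^+ k).
    move=> k0; have [[+ _] _] := hf n; rewrite -[tau n]mul1r => D1.
    have := type2_power (step_sp KP (tau0 n)) (proj2 (step_type2 M K (tau0 n) 1 _ _ _ _) D1) k0.
    by move=> /(proj1 (step_type2 M K (tau0 n) k _ _ _ _)); rewrite gridE.
  exists X, Y, P, Q; split; last split.
  + apply: (@unit_family_glue fx) => //= [n k k0|n]; first by have [[]] := all n k k0.
    by have [[]] := hf n.
  + move=> s s0; have [k k0 ->] := gridP s0 (leqnn _); rewrite XE// YE//.
    by have [[]] := all `|denq s|%N _ k0.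
  + move=> s t s0 t0; have [n [i [j [i0 j0 -> ->]]]] := grid_common s0 t0.
    rewrite -gridD !(XE, YE, PE, QE) ?addn_gt0 ?i0// !exprD.
    by rewrite twistD//= !gridE.
  + move=> s s0; have [k k0 ->] := gridP s0 (leqnn _); rewrite PE// QE//.
    by have [] := all `|denq s|%N _ k0.
Qed.

End Families.

(** * Continuity of the shifts *)

Section Approximation.
Variables (R : realType).
Local Notation C := R[i].

Definition rsq (H : hilbertType R) (x : H) : R := complex.Re (inner x x).

Lemma rsqE (H : hilbertType R) (x : H) : inner x x = (rsq x)%:C.
Proof.
rewrite /rsq RRe_real//; apply/CrealP.
by rewrite -innerC.
Qed.

Lemma norm_lt_rsq (H : hilbertType R) (x : H) (e : R) : 0 < e ->
  (`|x| < e%:C) = (rsq x < e ^+ 2).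
Proof.
move=> e0; rewrite -(@ltr_pXn2r _ 2)// ?nnegrE//; last by rewrite lecR ltW.
by rewrite -inner_norm rsqE -rmorphXn ltcR.
Qed.

Lemma lipschitz_ext (H L : hilbertType R) (A : set H) (f g : H -> L) (k : C) :
  dense A -> 0 <= k -> (forall x y, `|f x - f y| <= k * `|x - y|) ->
  (forall x y, `|g x - g y| <= k * `|x - y|) -> (forall x, A x -> f x = g x) -> f =1 g.
Proof.
move=> dA k0 hf hg fg x; apply/eqP; rewrite -subr_eq0 -normr_le0.
apply/ler_addgt0Pr => e e0; rewrite add0r.
have k1 : 0 < k + 1 by rewrite ltr_wpDl.
have e1 : 0 < e / 2 / (k + 1) by rewrite !divr_gt0.
have [y Ay xy] := iffLR (denseP _) dA x _ e1.
rewrite -(subrKA (f y)) [leRHS]splitr.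
have key : k * `|x - y| <= e / 2.
  apply: (@le_trans _ _ ((k + 1) * `|x - y|)).
    by rewrite ler_wpM2r// lerDl.
  by rewrite mulrC -ler_pdivlMr// ltW.
apply: le_trans (ler_normD _ _) _; apply: lerD; first exact: le_trans (hf _ _) key.
by rewrite fg// distrC; exact: le_trans (hg _ _) key.
Qed.

End Approximation.

Section Shift.
Variables (R : realType) (H : hilbertType R).
Local Notation C := R[i].
Variable M : graded_product H (+%R : R -> R -> R) (fun t => 0 < t).
Hypothesis M_dense : forall s t, 0 < s -> 0 < t ->
  dense [set z | exists l : seq (H * H), z = \sum_(p <- l) M s t p.1 p.2].

(** The cyclic shift of the fibre at time 1: it moves an end piece of length t to
    the front. *)
Definition is_shift (t : R) (U : isometry H H) : Prop :=
  forall a b, U (M (1 - t) t a b) = M t (1 - t) b a.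

Lemma shift_exists t : 0 < t < 1 -> exists U, is_shift t U.
Proof.
move=> /andP[t0 t1]; have t1' : 0 < 1 - t by rewrite subr_gt0.
have [||U hU] := @isometry_extension R H H (H * H)%type
  (fun p => M (1 - t) t p.1 p.2) (fun p => M t (1 - t) p.2 p.1).
- by move=> p q; rewrite !gmul_inner mulrC.
- apply/denseP => z e e0; have [_ [l ->] hl] := iffLR (denseP _) (M_dense t1' t0) z _ e0.
  exists (\sum_(p <- l) M (1 - t) t p.1 p.2) => //.
  exists [seq (1, p) | p <- l]; rewrite big_map.
  by apply: eq_bigr => p _; rewrite scale1r.
- by exists U => a b; exact: (hU (a, b)).
Qed.

(** Both sides move the end pieces t, s of a b c, of lengths 1-s-t, t, s, to the
    front; the triple products are total in H. *)
Lemma shift_add s t (Us Ut Ust : isometry H H) : 0 < s -> 0 < t -> s + t < 1 ->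
  is_shift s Us -> is_shift t Ut -> is_shift (s + t) Ust -> forall x, Ust x = Ut (Us x).
Proof.
move=> s0 t0 st1 hs ht hst.
pose r := 1 - (s + t); have r0 : 0 < r by rewrite subr_gt0.
have e1 : 1 - s = r + t by rewrite /r; ring.
have e2 : 1 - t = s + r by rewrite /r; ring.
have rt0 : 0 < r + t by rewrite addr_gt0.
have triple a b c : Ust (M (1 - s) s (M r t a b) c) = Ut (Us (M (1 - s) s (M r t a b) c)).
  have -> : Us (M (1 - s) s (M r t a b) c) = M (1 - t) t (M s r c a) b.
    by rewrite hs e1 e2 (gmulA M).
  rewrite ht e1 (gmulA M)// [t + s]addrC hst e2 -/r [s + t]addrC.
  exact: (gmulA M).
have double z c : Ust (M (1 - s) s z c) = Ut (Us (M (1 - s) s z c)).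
  apply: (@lipschitz_ext R H H _ (fun z => Ust (M (1 - s) s z c))
    (fun z => Ut (Us (M (1 - s) s z c))) `|c| (M_dense r0 t0)) => //.
  - by move=> x y; rewrite isometry_dist -gmulNl -gmulDl gmul_norm mulrC.
  - by move=> x y; rewrite !isometry_dist -gmulNl -gmulDl gmul_norm mulrC.
  - move=> _ [l ->]; elim: l => [|p l IHl].
      by rewrite big_nil !gmul0l !linear0.
    by rewrite big_cons gmulDl !linearD IHl triple.
have s1 : 0 < 1 - s by rewrite e1.
apply: (@lipschitz_ext R H H _ Ust (Ut \o Us) 1 (M_dense s1 s0)) => //.
- by move=> x y; rewrite isometry_dist mul1r.
- by move=> x y; rewrite /= !isometry_dist mul1r.
- move=> _ [l ->]; elim: l => [|p l IHl]; first by rewrite /= big_nil !linear0.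
  by move: IHl; rewrite big_cons /= !linearD double => ->.
Qed.

Hypothesis H_separable : separable H.
Hypothesis M_measurable : forall a b g : H,
  measurable_fun (`]0%R, 1%R[%classic : set R)
    (fun t : R => complex.Re (inner (M (1 - t) t a b) g)).
Hypothesis M_measurable' : forall a b g : H,
  measurable_fun (`]0%R, 1%R[%classic : set R)
    (fun t : R => complex.Re (inner (M t (1 - t) b a) g)).

Lemma dense_sequence : exists d : nat -> H, forall x (e : C), 0 < e -> exists n, `|x - d n| < e.
Proof.
case: H_separable => D /countable_injP[f fi] dD.
have /choice[d hd] : forall n : nat, exists x, (exists2 y, D y & f y = n) -> D x /\ f x = n.
  move=> n; have [[y Dy fy]|h] := pselect (exists2 y, D y & f y = n); first by exists y.
  by exists 0.
exists d => x e e0; have [y Dy xy] := iffLR (denseP _) dD x _ e0.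
exists (f y); have [] := hd (f y); first by exists y.
by move=> Dd /(fi _ _ (mem_set Dd) (mem_set Dy)) ->.
Qed.

(** Approximations of a vector and of its shift by t: the shift by t takes
    [W d l t] to [W' d l t]. *)
Let W (d : nat -> H) (l : seq (nat * nat)) (t : R) : H :=
  \sum_(p <- l) M (1 - t) t (d p.1) (d p.2).
Let W' (d : nat -> H) (l : seq (nat * nat)) (t : R) : H :=
  \sum_(p <- l) M t (1 - t) (d p.2) (d p.1).

Lemma W_dense d (t : R) : (forall x (e : C), 0 < e -> exists n, `|x - d n| < e) ->
  0 < t < 1 -> forall f (e : C), 0 < e -> exists l, `|f - W d l t| < e.
Proof.
move=> hd /andP[t0 t1] f e e0; have t1' : 0 < 1 - t by rewrite subr_gt0.
have e20 : 0 < e / 2 by rewrite divr_gt0.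
have [_ [s ->] hs] := iffLR (denseP _) (M_dense t1' t0) f _ e20.
have one a b (r : C) : 0 < r -> exists p : nat * nat,
    `|M (1 - t) t a b - M (1 - t) t (d p.1) (d p.2)| < r.
  move=> r0; have r20 : 0 < r / 2 by rewrite divr_gt0.
  have a1 : 0 < `|a| + 1 by rewrite ltr_wpDl.
  have [j hj] := hd b _ (divr_gt0 r20 a1).
  have b1 : 0 < `|d j| + 1 by rewrite ltr_wpDl.
  have [i hi] := hd a _ (divr_gt0 r20 b1).
  exists (i, j) => /=.
  have -> : M (1 - t) t a b - M (1 - t) t (d i) (d j) =
    M (1 - t) t a (b - d j) + M (1 - t) t (a - d i) (d j) by rewrite !gmulE; vec.
  apply: le_lt_trans (ler_normD _ _) _; rewrite !gmul_norm [ltRHS]splitr ltrD//.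
    apply: (@le_lt_trans _ _ ((`|a| + 1) * `|b - d j|)); first by rewrite ler_wpM2r// lerDl.
    by rewrite mulrC -ltr_pdivlMr.
  apply: (@le_lt_trans _ _ (`|a - d i| * (`|d j| + 1))); first by rewrite ler_wpM2l// lerDl.
  by rewrite -ltr_pdivlMr.
have [l hl] : exists l, `|\sum_(p <- s) M (1 - t) t p.1 p.2 - W d l t| < e / 2.
  elim: s {hs} (e / 2) e20 => [|p s IHs] r r0.
    by exists [::]; rewrite /W !big_nil subrr normr0.
  have r20 : 0 < r / 2 by rewrite divr_gt0.
  have [i hi] := one p.1 p.2 _ r20; have [l hl] := IHs _ r20.
  exists (i :: l); rewrite /W !big_cons opprD addrACA [ltRHS]splitr.
  by apply: le_lt_trans (ler_normD _ _) _; exact: ltrD.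
exists l; rewrite -(subrKA (\sum_(p <- s) M (1 - t) t p.1 p.2)) [ltRHS]splitr.
by apply: le_lt_trans (ler_normD _ _) _; exact: ltrD.
Qed.

Lemma inner_sum (I : Type) (l : seq I) (F : I -> H) g :
  inner (\sum_(p <- l) F p) g = \sum_(p <- l) inner (F p) g.
Proof.
elim: l => [|p l IHl]; first by rewrite !big_nil inner0l.
by rewrite !big_cons innerDl IHl.
Qed.

Lemma Re_innerC (x y : H) : complex.Re (inner x y) = complex.Re (inner y x).
Proof. by rewrite innerC; case: (inner y x). Qed.

Lemma rsqB (x y : H) : rsq (x - y) = rsq x + rsq y - 2 * complex.Re (inner x y).
Proof.
rewrite /rsq (dnormB inner) [inner x y + _]addrC.
by case: (inner x x) (inner y y) (inner x y) => [? ?] [? ?] [? ?] /=; ring.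
Qed.

(** As the norm of F t is constant, being within a given distance of g is a
    condition on the inner product of F t with g. *)
Lemma measurable_ball_set (F : R -> H) (c : R) g (e : R) :
  (forall t, rsq (F t) = c) ->
  measurable_fun (`]0%R, 1%R[%classic : set R) (fun t : R => complex.Re (inner (F t) g)) ->
  measurable ((`]0%R, 1%R[%classic : set R) `&` [set t | rsq (F t - g) < e]).
Proof.
move=> Fc mF.
have -> : [set t | rsq (F t - g) < e] =
  (fun t => complex.Re (inner (F t) g)) @^-1` `](c + rsq g - e) / 2, +oo[%classic.
  apply/seteqP; split=> t /=; rewrite rsqB Fc in_itv/= andbT; lra.
by apply: mF => //; exact: measurable_itv.
Qed.

Lemma Re_sum (I : Type) (l : seq I) (F : I -> C) :
  complex.Re (\sum_(p <- l) F p) = \sum_(p <- l) complex.Re (F p).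
Proof. exact: raddf_sum. Qed.

(** A measurable one-parameter group of isometries is continuous. With e a quarter
    of the norm of f, the times t at which f is e-close to W(t) and the shift
    W'(t) is e-close to d_m form measurable sets, indexed by the list defining W
    and by m, and cover ]0, 1[. By Steinhaus' theorem one of them contains t and
    t + s for every small s. Then the shifts of f by t and by t + s are both
    2e-close to d_m; as the second is the shift by t of the shift of f by s, the
    latter is within |f| of f. *)
Lemma shift_continuous (f : H) : f != 0 -> exists2 delta : R, 0 < delta &
  forall s, 0 < s < delta -> s < 1 ->
    exists2 U, is_shift s U & 0 < complex.Re (inner (U f) f).
Proof.
move=> f0; have [d hd] := dense_sequence.
pose n0 : R := complex.Re `|f|.
have nf : `|f| = n0%:C by rewrite /n0 RRe_real.
have n00 : 0 < n0 by rewrite -ltcR -nf normr_gt0.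
pose e := n0 / 4; have e0 : 0 < e by rewrite divr_gt0.
(* The countably many lists and indices are encoded by natural numbers. *)
pose B (n : nat) (t : R) := if @unpickle (seq (nat * nat) * nat)%type n is Some lm then
  rsq (W d lm.1 t - f) < e ^+ 2 /\ rsq (W' d lm.1 t - d lm.2) < e ^+ 2 else False.
pose A (n : nat) : set R := (`]0%R, 1%R[%classic : set R) `&` [set t | B n t].
have constW l t : rsq (W d l t) = \sum_(p <- l) \sum_(q <- l)
    complex.Re (inner (d p.1) (d q.1) * inner (d p.2) (d q.2)).
  rewrite /rsq /W inner_sum Re_sum; apply: eq_bigr => p _.
  rewrite Re_innerC inner_sum Re_sum; apply: eq_bigr => q _.
  by rewrite Re_innerC gmul_inner.
have constW' l t : rsq (W' d l t) = \sum_(p <- l) \sum_(q <- l)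
    complex.Re (inner (d p.2) (d q.2) * inner (d p.1) (d q.1)).
  rewrite /rsq /W' inner_sum Re_sum; apply: eq_bigr => p _.
  rewrite Re_innerC inner_sum Re_sum; apply: eq_bigr => q _.
  by rewrite Re_innerC gmul_inner.
have mA n : measurable (A n).
  rewrite /A /B; case: (unpickle n) => [[l m]|]; last
    by rewrite [X in _ `&` X](_ : _ = set0) ?setI0.
  rewrite [X in measurable X](_ : _ =
    ((`]0%R, 1%R[%classic : set R) `&` [set t | rsq (W d l t - f) < e ^+ 2]) `&`
    ((`]0%R, 1%R[%classic : set R) `&` [set t | rsq (W' d l t - d m) < e ^+ 2])); last first.
    by apply/seteqP; split=> t /=; [move=> [? []]|move=> [[? ?] [? ?]]].
  apply: measurableI; (apply: measurable_ball_set => [t|];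
    first by [exact: constW|exact: constW']).
    rewrite (_ : (fun _ => _) = fun t : R => \sum_(p <- l)
       complex.Re (inner (M (1 - t) t (d p.1) (d p.2)) f)); last first.
      by apply/funext => t; rewrite inner_sum Re_sum.
    by apply: measurable_sum => p; exact: M_measurable.
  rewrite (_ : (fun _ => _) = fun t : R => \sum_(p <- l)
     complex.Re (inner (M t (1 - t) (d p.2) (d p.1)) (d m))); last first.
    by apply/funext => t; rewrite inner_sum Re_sum.
  by apply: measurable_sum => p; exact: M_measurable'.
have eC : 0 < e%:C :> C by rewrite ltcR.
have cov t : 0 < t < 1 -> exists n, A n t.
  move=> t01; have [l hl] := W_dense hd t01 f eC.
  have [m hm] := hd (W' d l t) _ eC.
  exists (pickle (l, m)); split; first by rewrite /= in_itv.
  rewrite /= /B pickleK /=; split; last by rewrite -norm_lt_rsq.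
  by rewrite -norm_lt_rsq// distrC.
have [n [delta [delta0 hA]]] := steinhaus_cover mA cov.
exists delta => // s sd s1; have [t At Ats] := hA s sd.
have s0 : 0 < s by case/andP: sd.
have [t01 Bt] : 0 < t < 1 /\ B n t by case: At => + ?; rewrite /= in_itv.
have [ts01 Bts] : 0 < t + s < 1 /\ B n (t + s) by case: Ats => + ?; rewrite /= in_itv.
move: Bt Bts; rewrite /B; case: (unpickle n) => [[l m]|[]//] /= [h3 h4] [h1 h2].
case/andP: (t01) => t0 t1.
case/andP: (ts01) => _ ts1.
have [Us hUs] : exists U, is_shift s U by apply: shift_exists; rewrite s0.
have [Ut hUt] := shift_exists t01.
have [Uts hUts] : exists U, is_shift (s + t) U by apply: shift_exists; rewrite addrC.
exists Us => //.
have key r U : is_shift r U -> rsq (W d l r - f) < e ^+ 2 ->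
    rsq (W' d l r - d m) < e ^+ 2 -> `|U f - d m| < e%:C + e%:C.
  move=> hU g1 g2; rewrite -(subrKA (W' d l r)).
  apply: le_lt_trans (ler_normD _ _) _; apply: ltrD; last by rewrite norm_lt_rsq.
  have <- : U (W d l r) = W' d l r.
    by rewrite linear_sum; apply: eq_bigr => p _; exact: hU.
  by rewrite isometry_dist distrC norm_lt_rsq.
have k1 := key _ _ hUt h3 h4.
have k2 : `|Uts f - d m| < e%:C + e%:C 
  by apply: (key (s + t)) => //; rewrite [s + t]addrC.
have k3 : `|Us f - f| < n0%:C.
  rewrite -(isometry_dist Ut) -(shift_add s0 t0 _ hUs hUt hUts); last by rewrite addrC.
  rewrite -(subrKA (d m)); apply: le_lt_trans (ler_normD _ _) _.
  have -> : n0%:C = (e%:C + e%:C) + (e%:C + e%:C) :> C.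
    by rewrite -!rmorphD /e; congr (_%:C); field.
  by apply: ltrD => //; rewrite distrC.
move: k3; rewrite norm_lt_rsq// rsqB.
have -> : rsq (Us f) = rsq f by rewrite /rsq isometry_inner.
have n2 : 0 < n0 ^+ 2 by rewrite exprn_gt0.
have E : n0 ^+ 2 = rsq f.
  have : inner f f = (n0 ^+ 2)%:C by rewrite inner_norm nf rmorphXn.
  by rewrite rsqE => /complexI ->.
by move: n2; rewrite E; lra.
Qed.

End Shift.

(** * From Arveson systems to products on a fixed space *)

Section UnitaryTheory.
Variables (R : realType) (H K : hilbertType R).

Lemma isometry_inj (f : isometry H K) : injective f.
Proof.
move=> x y e; apply/eqP; rewrite -subr_eq0 -normr_eq0 -(isometry_dist f).
by rewrite e subrr normr0.
Qed.

Variable u : unitary H K.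

Lemma unitaryK : cancel u (unitary_inv u).
Proof. by move=> x; apply: (@isometry_inj u); rewrite (unitary_invK u). Qed.

Lemma unitary_inv_linear : linear (unitary_inv u).
Proof.
move=> a x y; apply: (@isometry_inj u).
by rewrite linearP !(unitary_invK u).
Qed.

Lemma unitary_inv_inner x y : inner (unitary_inv u x) (unitary_inv u y) = inner x y.
Proof. by rewrite -(isometry_inner u) !(unitary_invK u). Qed.

End UnitaryTheory.

Section PositivePart.
Variable K : numDomainType.

Definition topos (t : K) : {posnum K} :=
  if pselect (0 < t) is left h then PosNum h else 1%:pos.

Lemma toposK (t : K) : 0 < t -> (topos t)%:num = t.
Proof. by move=> t0; rewrite /topos; case: pselect. Qed.

Lemma topos_num (t : {posnum K}) : topos t%:num = t.
Proof. by apply: val_inj; rewrite /= toposK. Qed.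

Lemma toposD (s t : K) : 0 < s -> 0 < t -> topos (s + t) = tadd (topos s) (topos t).
Proof.
by move=> s0 t0; apply: val_inj; rewrite /= !toposK// addr_gt0.
Qed.
End PositivePart.

Section FiniteTensors.
Variables (R : realType).
Local Notation C := R[i].

Lemma has_dim2_orthonormal (H : hilbertType R) : has_dim 2 H ->
  exists u v : H, [/\ inner u u = 1, inner v v = 1, inner u v = 0 &
    forall x, x = inner x u *: u + inner x v *: v].
Proof.
move=> [e he]; pose a := e ord0; pose b := e (lift ord0 ord0).
have span x : exists c d : C, x = c *: a + d *: b.
  have [c [-> _]] := he x; exists (c ord0 ord0), (c ord0 (lift ord0 ord0)).
  by rewrite !big_ord_recl big_ord0 addr0.
have i : indep a b.
  move=> c d h; have [z [hz uz]] := he 0.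
  have z0 : z = 0 by apply: uz; rewrite big1// => k _; rewrite mxE scale0r.
  have : z = \row_(k < 2) (if k == ord0 then c else d).
    by apply: uz; rewrite !big_ord_recl big_ord0 addr0 !mxE/= -h.
  rewrite z0 => /rowP h'; have := h' ord0; have := h' (lift ord0 ord0).
  by rewrite !mxE/= => <- <-.
have [a0 _] := indep_neq0 i.
have nrm (z : H) : z != 0 -> inner ((`|z|^-1 : C) *: z) ((`|z|^-1 : C) *: z) = 1.
  move=> z0; rewrite inner_norm normrZ normfV normr_id mulVf ?expr1n//.
  by rewrite normr_eq0.
have aa : inner a a != 0 by apply: contra_neq a0; exact: inner_eq0.
pose b' := b + (- (inner b a / inner a a)) *: a.
have ib : indep a b' := indep_shear i.
have [_ b0] := indep_neq0 ib.
have ab : inner a b' = 0 by rewrite innerC !innerE mulNr divfK// subrr rmorph0.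
have na : (`|a|^-1 : C) != 0 by rewrite invr_eq0 normr_eq0.
have nb : (`|b'|^-1 : C) != 0 by rewrite invr_eq0 normr_eq0.
exists ((`|a|^-1 : C) *: a), ((`|b'|^-1 : C) *: b').
have uv : inner ((`|a|^-1 : C) *: a) ((`|b'|^-1 : C) *: b') = 0.
  by rewrite innerZl innerZr ab !mulr0.
split=> //; try exact: nrm.
set u := _ *: a in uv *; set v := _ *: b' in uv *.
have uu : inner u u = 1 := nrm _ a0. have vv : inner v v = 1 := nrm _ b0.
have vu : inner v u = 0 by rewrite innerC uv rmorph0.
move=> x; have [c [d ->]] := span x; pose k := inner b a / inner a a.
have -> : c *: a + d *: b = (c * `|a| + d * k * `|a|) *: u + (d * `|b'|) *: v.
  have ev : `|b'| *: v = b' by rewrite scalerA divff ?scale1r// normr_eq0.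
  have eu : `|a| *: u = a by rewrite scalerA divff ?scale1r// normr_eq0.
  rewrite scalerDl -!scalerA eu ev /b' -/k; rewrite /k; vec.
by clearbody u v; rewrite !innerE uu vv uv vu !mulr1 !mulr0 addr0 add0r.
Qed.

Lemma norm_inner_le (H : hilbertType R) (x y : H) : `|inner x y| <= `|x| * `|y|.
Proof.
have := dot_CS (@inner R H) x y; rewrite /pnorm !inner_norm !sqrCK//.
Qed.

(** The orthogonal projection onto the span of the four products of basis vectors
    fixes the elementary tensors; being Lipschitz, it fixes the whole completed
    tensor product. *)
Lemma tensor_dim2 (H K : hilbertType R) (z : H ⊠ K) : has_dim 2 H -> has_dim 2 K ->
  exists g g' h h', z = g ⊗ h + g' ⊗ h'.
Proof.
move=> /has_dim2_orthonormal[u [v [uu vv uv sH]]] /has_dim2_orthonormal[u' [v' [uu' vv' uv' sK]]].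
pose P (w : H ⊠ K) := inner w (u ⊗ u') *: (u ⊗ u') + inner w (u ⊗ v') *: (u ⊗ v') +
  (inner w (v ⊗ u') *: (v ⊗ u') + inner w (v ⊗ v') *: (v ⊗ v')).
have nrm (L : hilbertType R) (e : L) : inner e e = 1 -> `|e| = 1.
  by rewrite inner_norm => /eqP; rewrite pexpr_eq1// => /eqP.
have PE w : P w = w.
  apply: (@lipschitz_ext R _ _ _ P id (1 + 1 + (1 + 1)) (@tens_dense R H K)).
  - by rewrite !addr_ge0.
  - move=> x y; have -> : P x - P y = P (x - y) by rewrite /P; vec.
    have one (e : H ⊠ K) : `|e| = 1 -> `|inner (x - y) e *: e| <= 1 * `|x - y|.
      by move=> ne; rewrite normrZ ne mulr1 mul1r (le_trans (norm_inner_le _ _))// ne mulr1.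
    have n1 (a : H) (b : K) : inner a a = 1 -> inner b b = 1 -> `|a ⊗ b| = 1.
      by move=> /nrm na /nrm nb; rewrite tens_norm na nb mulr1.
    rewrite !mulrDl /P; do 2?[apply: le_trans (ler_normD _ _) _; apply: lerD];
      apply: one; exact: n1.
  - by move=> x y; rewrite !mulrDl !mul1r -addrA lerDl !addr_ge0.
  - move=> _ [l ->]; elim: l => [|[a b] l IHl].
      by rewrite big_nil /P !inner0l !scale0r !addr0.
    have PD x y : P (x + y) = P x + P y by rewrite /P; vec.
    rewrite big_cons PD IHl; congr (_ + _) => /=.
    rewrite [in RHS](sH a) [in RHS](sK b) /P !tens_inner !tensDl !tensDr !tensZl !tensZr.
    by vec.
exists u, v, (inner z (u ⊗ u') *: u' + inner z (u ⊗ v') *: v'),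
  (inner z (v ⊗ u') *: u' + inner z (v ⊗ v') *: v').
by rewrite -[LHS]PE /P !tensDr !tensZr.
Qed.

End FiniteTensors.

Section SigmaPreimage.

Lemma generated_preimage (T X : Type) (S : set (set T)) (G : set (set X)) (f : T -> X) :
  sigma_algebra setT S -> (forall B, G B -> S (f @^-1` B)) ->
  forall B, <<s G >> B -> S (f @^-1` B).
Proof.
move=> [S0 SC SU] hG B /(_ [set B | S (f @^-1` B)]); apply; split; last exact: hG; split.
- by rewrite /= preimage_set0.
- by move=> A SA; have := SC _ SA; rewrite !setTD.
- by move=> F SF; rewrite /= preimage_bigcup; exact: SU.
Qed.

Variable R : realType.

Definition measurable_on_unit (P : set R) : Prop :=
  measurable ((`]0%R, 1%R[%classic : set R) `&` P).

Lemma sigma_measurable_on_unit : sigma_algebra setT (measurable_on_unit).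
Proof.
split=> [|A mA|F mF]; rewrite /measurable_on_unit.
- by rewrite setI0.
- rewrite setTD (_ : _ `&` _ = (`]0%R, 1%R[%classic : set R) `\`
    ((`]0%R, 1%R[%classic : set R) `&` A)); last first.
    by apply/seteqP; split=> x /=; [move=> [? ?]; split=> // -[]|
      move=> [? h]; split=> // ?; apply: h].
  by apply: measurableD => //; exact: measurable_itv.
- by rewrite setI_bigcupr; apply: bigcup_measurable => k _; exact: mF.
Qed.

End SigmaPreimage.

Section Transport.
Variables (R : realType) (A : arveson_system R) (H : hilbertType R).
Variable U : forall t, unitary (A t) H.
Local Notation C := R[i].
Local Notation V := (fun t => unitary_inv (U t)).

(** The product of the Arveson system, read in H through the trivialization. *)
Definition time_mul (s t : {posnum R}) (a b : H) : H :=
  U (tadd s t) (unitary_inv (arv_beta A s t) (V s a ⊗ V t b)).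

Lemma U_tcast s t (e : s = t) (u : A s) : U t (tcast e u) = U s u.
Proof. by case: t / e. Qed.

Lemma time_mul_linl s t y : linear (time_mul s t ^~ y).
Proof.
move=> a x x'; rewrite /time_mul (unitary_inv_linear (U s)) tensDl tensZl.
by rewrite (unitary_inv_linear (arv_beta A s t)) linearP.
Qed.

Lemma time_mul_linr s t x : linear (time_mul s t x).
Proof.
move=> a y y'; rewrite /time_mul (unitary_inv_linear (U t)) tensDr tensZr.
by rewrite (unitary_inv_linear (arv_beta A s t)) linearP.
Qed.

Lemma time_mul_inner s t x y x' y' :
  inner (time_mul s t x y) (time_mul s t x' y') = inner x x' * inner y y'.
Proof.
by rewrite /time_mul isometry_inner unitary_inv_inner tens_inner !unitary_inv_inner.
Qed.

Lemma time_mulA r s t a b c :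
  time_mul (tadd r s) t (time_mul r s a b) c = time_mul r (tadd s t) a (time_mul s t b c).
Proof.
rewrite /time_mul !unitaryK.
set x := V r a; set y := V s b; set z := V t c.
set u := unitary_inv (arv_beta A (tadd r s) t) _.
rewrite -(U_tcast (esym (taddA r s t))); congr (U _ _).
apply: (@isometry_inj _ _ _ (arv_beta A r (tadd s t))); rewrite (unitary_invK (arv_beta A _ _)).
apply: (@isometry_inj _ _ _ (tmap (isometry_id (A r)) (arv_beta A s t))).
apply: (@isometry_inj _ _ _ (tassoc (A r) (A s) (A t))).
have := @arv_coassoc R A r s t u; rewrite (unitary_invK (arv_beta A _ _)) !tmapE => <-.
by rewrite (unitary_invK (arv_beta A r s)) (unitary_invK (arv_beta A s t)) /= tassocE.
Qed.

Definition real_product : graded_product H (+%R : R -> R -> R) (fun t => 0 < t).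
Proof.
apply: (@GradedProduct R H R _ _ (fun s t => time_mul (topos s) (topos t))).
- by move=> s t y; exact: time_mul_linl.
- by move=> s t x; exact: time_mul_linr.
- by move=> s t *; exact: time_mul_inner.
- by move=> r s t x y z r0 s0 t0; rewrite !toposD//; exact: time_mulA.
Defined.

Lemma real_product_dense s t : 0 < s -> 0 < t ->
  dense [set z | exists l : seq (H * H), z = \sum_(p <- l) real_product s t p.1 p.2].
Proof.
move=> _ _; apply/denseP => z e e0; set s' := topos s; set t' := topos t.
pose W : H -> A s' ⊠ A t' := fun z => arv_beta A s' t' (V (tadd s' t') z).
have [_ [l ->] hl] := iffLR (denseP _) (@tens_dense R (A s') (A t')) (W z) _ e0.
exists (\sum_(p <- [seq (U s' p.1, U t' p.2) | p <- l]) real_product s t p.1 p.2).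
  by eexists.
move: hl; congr (_ < _); rewrite big_map.
have -> : \sum_(p <- l) p.1 ⊗ p.2 =
    W (\sum_(p <- l) real_product s t (U s' p.1) (U t' p.2)).
  have WD x y : W (x + y) = W x + W y.
    have := unitary_inv_linear (U (tadd s' t')) 1 x y.
    by rewrite !scale1r /W => ->; rewrite linearD.
  elim: l => [|p l IHl].
    rewrite !big_nil; apply: (@addrI _ (W 0)).
    by rewrite -WD !addr0.
  by rewrite !big_cons WD IHl /W /= /time_mul !unitaryK (unitary_invK (arv_beta A _ _)).
by rewrite /W isometry_dist -(isometry_dist (U (tadd s' t'))) !(unitary_invK (U _)).
Qed.

Hypothesis Umeas : sigma_measurable (@arv_borel R A) (prod_sigma (borel_pos R) (borel H))
  (trivialization U).
Hypothesis Vmeas : sigma_measurable (prod_sigma (borel_pos R) (borel H)) (@arv_borel R A)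
  (trivialization_inv U).

Lemma open_Re_inner (g : H) (c : R) : open [set h : H | c < complex.Re (inner h g)].
Proof.
rewrite openE => h /= hc; apply/nbhs_ballP.
pose r : R := complex.Re (inner h g) - c; have r0 : 0 < r by rewrite subr_gt0.
have g1 : 0 < `|g| + 1 by rewrite ltr_wpDl.
have e0 : 0 < r%:C / (`|g| + 1) by rewrite divr_gt0// ltcR.
exists (r%:C / (`|g| + 1)) => //= h'; rewrite -ball_normE /ball_/= => hh.
have : `|inner (h - h') g| < r%:C.
  apply: le_lt_trans (norm_inner_le _ _) _.
  apply: (@le_lt_trans _ _ (`|h - h'| * (`|g| + 1))); first by rewrite ler_wpM2l// lerDl.
  by rewrite -ltr_pdivlMr.
move=> /(le_lt_trans (normc_ge_Re _)); rewrite ltcR innerDl innerNl.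
have -> : complex.Re (inner h g - inner h' g) =
  complex.Re (inner h g) - complex.Re (inner h' g) by rewrite raddfB.
by move=> /ltr_normlW; rewrite /r; lra.
Qed.

(** The map is the composite of the constant sections a and b at the times u(t)
    and v(t), which are measurable because the inverse trivialization is, of the
    multiplication, of the trivialization, and of a continuous functional. *)
Lemma real_product_measurable (u v : R -> R) (a b g : H) :
  measurable_fun setT u -> measurable_fun setT v ->
  (forall t, 0 < t < 1 -> 0 < u t) -> (forall t, 0 < t < 1 -> 0 < v t) ->
  measurable_fun (`]0%R, 1%R[%classic : set R)
    (fun t : R => complex.Re (inner (real_product (u t) (v t) a b) g)).
Proof.
move=> mu mv u0 v0.
pose F (t : R) := total_mul (arv_beta A)
  (trivialization_inv U (topos (u t), a), trivialization_inv U (topos (v t), b)).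
have sig := sigma_measurable_on_unit R.
have arg (w : R -> R) (x : H) : measurable_fun setT w -> (forall t, 0 < t < 1 -> 0 < w t) ->
    forall B, @arv_borel R A B ->
      measurable_on_unit ((fun t => trivialization_inv U (topos (w t), x)) @^-1` B).
  move=> mw w0 B /Vmeas; apply: (@generated_preimage R _ _ _ (fun t => (topos (w t), x))) => //.
  move=> _ [_ [P bP <-] [Q bQ <-]].
  have -> : (fun t => (topos (w t), x)) @^-1` (((fun t : {posnum R} => t%:num) @^-1` P) `*` Q) =
    [set t | P (topos (w t))%:num /\ Q x] by [].
  have [Qx|Qx] := pselect (Q x); last first.
    rewrite /measurable_on_unit (_ : _ `&` _ = set0)//.
    by apply/seteqP; split=> t //= -[_ []].
  rewrite /measurable_on_unit (_ : _ `&` _ = (`]0%R, 1%R[%classic : set R) `&` (w @^-1` P)).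
    apply: measurableI; first exact: measurable_itv.
    rewrite -[_ @^-1` _]setTI; apply: mw => //.
    by apply: bP; split; [exact: sigma_algebra_measurable|exact: open_measurable].
  apply/seteqP; split=> t /=; rewrite in_itv/= => -[t01 h]; split=> //.
    by case: h; rewrite toposK// w0.
  by split=> //; rewrite toposK// w0.
have mF B : @arv_borel R A B -> measurable_on_unit (F @^-1` B).
  move=> /(@arv_mul_measurable R A).
  apply: (@generated_preimage R _ _ _ (fun t => (trivialization_inv U (topos (u t), a),
    trivialization_inv U (topos (v t), b)))) => //.
  move=> _ [P bP [Q bQ <-]].
  have := measurableI _ _ (arg u a mu u0 _ bP) (arg v b mv v0 _ bQ).
  by rewrite setIACA setIid.
move=> mD; apply: (measurability _ (RGenOInfty.measurableE R)) => // _ [_ [c ->] <-].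
rewrite (_ : _ @^-1` _ =
  F @^-1` [set p | c < complex.Re (inner (trivialization U p).2 g)]); last first.
  by apply/seteqP; split=> t /=; rewrite in_itv/= andbT.
apply: (mF [set p | c < complex.Re (inner (trivialization U p).2 g)]).
apply: (Umeas (B := [set q | c < complex.Re (inner q.2 g)])).
apply: sub_sigma_algebra; exists setT.
  by exists setT => //; apply: sub_sigma_algebra; exact: openT.
exists [set h : H | c < complex.Re (inner h g)].
  by apply: sub_sigma_algebra; exact: open_Re_inner.
by apply/seteqP; split=> q //= [].
Qed.

End Transport.

(** * Characters of the positive rationals *)

Section Characters.
Variable R : realType.
Local Notation C := R[i].

Definition character (K : pzRingType) (g : rat -> K) : Prop :=
  forall s t, 0 < s -> 0 < t -> g (s + t) = g s * g t.

Lemma character_mulrn (K : pzRingType) (g : rat -> K) s n : character g -> 0 < s -> (0 < n)%N ->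
  g (n%:R * s) = g s ^+ n.
Proof.
move=> gm s0; elim: n => // -[_ _|n IHn _]; first by rewrite mul1r.
rewrite -natr1 mulrDl mul1r gm ?IHn// ?mulr_gt0 ?ltr0n//.
by rewrite -exprSr.
Qed.

Lemma additive_mulrn (g : rat -> R) s n :
  (forall s t, 0 < s -> 0 < t -> g (s + t) = g s + g t) -> 0 < s -> (0 < n)%N ->
  g (n%:R * s) = n%:R * g s.
Proof.
move=> gm s0; elim: n => // -[_ _|n IHn _]; first by rewrite !mul1r.
rewrite -natr1 mulrDl mul1r gm ?IHn// ?mulr_gt0 ?ltr0n//.
by rewrite -[in RHS]natr1 mulrDl mul1r.
Qed.

Lemma posratP (t : rat) : 0 < t -> exists k n, [/\ (0 < k)%N, (0 < n)%N & t = k%:R / n%:R].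
Proof.
move=> t0; have [k k0 tE] := gridP t0 (leqnn _).
by exists k, (`|denq t|)`!%N; split=> //; exact: fact_gt0.
Qed.

Lemma positive_character (g : rat -> R) : character g -> (forall s, 0 < s -> 0 < g s) ->
  forall t, 0 < t -> g t = g 1 `^ ratr t.
Proof.
move=> gm g0 t t0; have [k [n [k0 n0 tE]]] := posratP t0.
have n0' : n%:R != 0 :> R by rewrite pnatr_eq0 -lt0n.
apply/eqP; rewrite -(@eqrXn2 _ n)// ?powR_ge0 ?ltW ?g0//; apply/eqP.
rewrite -[in RHS]powR_mulrn ?powR_ge0// -powRrM.
have -> : ratr t * n%:R = k%:R :> R by rewrite tE fmorph_div /= !ratr_nat divfK.
rewrite powR_mulrn ?ltW ?g0// -(character_mulrn gm)// -(character_mulrn gm)//.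
congr g; rewrite mulr1 tE mulrC divfK//; by rewrite pnatr_eq0 -lt0n.
Qed.

Lemma additive_on_rat (g : rat -> R) :
  (forall s t, 0 < s -> 0 < t -> g (s + t) = g s + g t) ->
  forall t, 0 < t -> g t = ratr t * g 1.
Proof.
move=> gm t t0; have [k [n [k0 n0 tE]]] := posratP t0.
have n0' : n%:R != 0 :> R by rewrite pnatr_eq0 -lt0n.
apply: (mulfI n0'); rewrite -(additive_mulrn gm)// mulrA.
have -> : n%:R * ratr t = k%:R :> R by rewrite tE fmorph_div /= !ratr_nat mulrC divfK.
rewrite -(additive_mulrn gm)//; congr g.
by rewrite mulr1 tE mulrC divfK// pnatr_eq0 -lt0n.
Qed.

Definition cis (x : R) : C := cos x +i* sin x.

Lemma cisD x y : cis (x + y) = cis x * cis y.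
Proof.
rewrite /cis cosD sinD; apply/eqP.
by rewrite eq_complex /= [sin x * cos y + _]addrC !eqxx.
Qed.

Lemma cis_mulrn x n : cis (n%:R * x) = cis x ^+ n.
Proof.
elim: n => [|n IHn]; first by rewrite mul0r /cis cos0 sin0 expr0.
by rewrite exprSr -IHn -cisD -natr1 mulrDl mul1r.
Qed.

Lemma cos_gt0_small (x : R) : - pi < x < pi -> 0 < cos x -> - (pi / 2) < x < pi / 2.
Proof.
have key (y : R) : 0 <= y -> y < pi -> 0 < cos y -> y < pi / 2.
  move=> y0 yp; have p0 := pi_gt0 R; rewrite -cos_pihalf ltr_cos// in_itv/=;
    by apply/andP; split; lra.
move=> /andP[x1 x2] c0; have p0 := pi_gt0 R; have [x0|x0] := leP 0 x.
  by have := key x x0 x2 c0; lra.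
have := key (- x); rewrite cosN => /(_ _ _ c0); lra.
Qed.

(** Where g stays in the right half-plane it has an argument in ]-pi/2, pi/2[.
    This argument is additive along the multiples j r < d of a rational r: the sum
    of the arguments at j r and at r lies in ]-pi, pi[ and has a positive cosine,
    hence lies in ]-pi/2, pi/2[ again. *)
Lemma circle_character (g : rat -> C) (d : rat) : character g -> 0 < d ->
  (forall s, 0 < s -> `|g s| = 1) ->
  (forall s, 0 < s < d -> 0 < complex.Re (g s)) ->
  exists b : R, forall t, 0 < t -> g t = cis (b * ratr t).
Proof.
move=> gm d0 g1 gRe.
pose al (s : rat) : R := asin (complex.Im (g s)).
have p0 := pi_gt0 R.
have alP s : 0 < s < d -> g s = cis (al s) /\ - (pi / 2) < al s < pi / 2.
  move=> sd; have := gRe s sd; have /g1 : 0 < s by case/andP: sd.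
  rewrite /al; case: (g s) => x y /= nxy x0.
  have xy : x ^+ 2 + y ^+ 2 = 1.
    by move: nxy => /(congr1 (fun z => z ^+ 2)); rewrite -add_Re2_Im2 /= expr1n => -[].
  have y1 : -1 < y < 1.
    by apply/andP; split; nra.
  have yle : -1 <= y <= 1 by case/andP: y1 => /ltW -> /ltW ->.
  split; last first.
    rewrite asin_gtNpi2 ?asin_ltpi2//; case/andP: y1 => ? ?; apply/andP;
      by split=> //; exact: ltW.
  rewrite /cis asinK ?in_itv//= cos_asin//.
  have -> : 1 - y ^+ 2 = x ^+ 2 by rewrite -xy addrK.
  by rewrite sqrtr_sqr gtr0_norm.
have uniq s x : 0 < s < d -> g s = cis x -> - (pi / 2) < x < pi / 2 -> x = al s.
  move=> sd gx /andP[x1 x2]; have [ga /andP[a1 a2]] := alP s sd.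
  apply: sin_inj; rewrite ?in_itv/= ?ltW//.
  by have := gx; rewrite ga /cis => -[_ ->].
have add r j : 0 < r -> (0 < j)%N -> j%:R * r < d -> al (j%:R * r) = j%:R * al r.
  move=> r0; elim: j => // -[_ _ _|j IHj _ jd]; first by rewrite !mul1r.
  have jd' : j.+1%:R * r < d.
    by apply: le_lt_trans jd; rewrite ler_pM2r// ler_nat.
  have rd : 0 < r < d.
    by rewrite r0 (le_lt_trans _ jd)// ler_peMl ?ler1n// ltW.
  have jr0 : 0 < j.+1%:R * r by rewrite mulr_gt0 ?ltr0n.
  have [ej /andP[j1 j2]] : g (j.+1%:R * r) = cis (j.+1%:R * al r) /\
      - (pi / 2) < j.+1%:R * al r < pi / 2.
    by rewrite -IHj//; apply: alP; rewrite jr0.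
  have [er /andP[r1 r2]] := alP r rd.
  have jd2 : 0 < j.+2%:R * r < d by rewrite jd mulr_gt0 ?ltr0n.
  have E : g (j.+2%:R * r) = cis (j.+2%:R * al r).
    have -> : j.+2%:R * al r = j.+1%:R * al r + al r by rewrite -[in LHS]natr1 mulrDl mul1r.
    have -> : j.+2%:R * r = j.+1%:R * r + r by rewrite -[in LHS]natr1 mulrDl mul1r.
    by rewrite gm// ej er cisD.
  symmetry; apply: uniq => //; apply: cos_gt0_small.
    by rewrite -natr1 mulrDl mul1r; apply/andP; split; lra.
  by have := gRe _ jd2; rewrite E.
have [N Nd] : exists N : nat, (N.+1%:R : rat)^-1 < d.
  have [N _ hN] := near_infty_natSinv_lt (PosNum d0).
  by exists N; apply: hN => /=.
exists (N.+1%:R * al (N.+1%:R)^-1) => t t0.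
have [k [n [k0 n0 tE]]] := posratP t0.
pose r : rat := (N.+1 * n)%:R^-1.
have Nn0 : (N.+1 * n)%:R != 0 :> rat by rewrite pnatr_eq0 -lt0n muln_gt0.
have n0' : n%:R != 0 :> rat by rewrite pnatr_eq0 -lt0n.
have N0 : N.+1%:R != 0 :> rat by rewrite pnatr_eq0.
have r0 : 0 < r by rewrite invr_gt0 ltr0n muln_gt0.
have tr : t = (k * N.+1)%:R * r.
  by rewrite tE /r !natrM invfM mulrA mulfK.
have nr : (N.+1%:R)^-1 = n%:R * r.
  by rewrite /r natrM invfM mulrCA divff// mulr1.
have rd : 0 < r < d.
  by rewrite r0 (le_lt_trans _ Nd)// nr ler_peMl ?ler1n// ltW.
rewrite {1}tr (character_mulrn gm)// ?muln_gt0 ?k0//.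
have [-> _] := alP r rd; rewrite -cis_mulrn nr add//; last by rewrite -nr.
congr cis; rewrite tE fmorph_div /= !ratr_nat natrM.
have n0R : n%:R != 0 :> R by rewrite pnatr_eq0 -lt0n.
by field.
Qed.

End Characters.

(** * Normal forms of the families *)

Section Normalisation.
Variables (R : realType) (H : hilbertType R).
Variable M : graded_product H (+%R : rat -> rat -> rat) qpos.
Variables (K : rat -> H -> Prop) (KP : subproduct M K).
Local Notation C := R[i].

Hypothesis shift : forall f : H, f != 0 -> exists2 d : rat, 0 < d &
  forall s, 0 < s < d -> s < 1 -> exists2 U : isometry H H,
    (forall a b, U (M (1 - s) s a b) = M s (1 - s) b a) &
    0 < complex.Re (inner (U f) f).

Lemma innerXX X s : unit_family M K X -> 0 < s -> inner (X s) (X s) = 1.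
Proof. by move=> [XK _] /XK[_ n1]; rewrite inner_norm n1 expr1n. Qed.

(** For s < 1/2, the shift by s moves the end piece of length s of the vector
    X_(1/2) Y_(1/2) to the front, so it exchanges a piece of X with one of Y. *)
Section Halves.
Variable s : rat.
Hypotheses (s0 : 0 < s) (s2 : s < 1 / 2).
Let h : rat := 1 / 2.
Let r : rat := h - s.

Let h0 : 0 < h. Proof. by rewrite /h divr_gt0. Qed.
Let r0 : 0 < r. Proof. by rewrite /r subr_gt0. Qed.
Let rs : r + s = h. Proof. exact: subrK. Qed.
Let sr : s + r = h. Proof. by rewrite addrC. Qed.
Let hr : h + r = 1 - s. Proof. by rewrite /r /h; field. Qed.
Let rh : r + h = 1 - s. Proof. by rewrite addrC. Qed.

Lemma shift_half (U : isometry H H) x y z :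
  (forall a b, U (M (1 - s) s a b) = M s (1 - s) b a) ->
  U (M (1 / 2) (1 / 2) x (M (1 / 2 - s) s y z)) =
  M s (1 - s) z (M (1 / 2) (1 / 2 - s) x y).
Proof.
move=> hU; have := gmulA M x y z h0 r0 s0; rewrite rs hr => <-.
exact: hU.
Qed.

Lemma split_first x y z w :
  M (1 / 2) (1 / 2) (M s (1 / 2 - s) x y) (M s (1 / 2 - s) z w) =
  M s (1 - s) x (M (1 / 2) (1 / 2 - s) (M (1 / 2 - s) s y z) w).
Proof.
have := gmulA M x y (M s r z w) s0 r0 h0; rewrite sr rh => ->.
by have := gmulA M y z w r0 s0 r0; rewrite rs sr => ->.
Qed.

Lemma halves X : unit_family M K X ->
  X (1 / 2) = M s (1 / 2 - s) (X s) (X (1 / 2 - s)) /\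
  X (1 / 2) = M (1 / 2 - s) s (X (1 / 2 - s)) (X s).
Proof. by move=> [_ XD]; rewrite -!XD// sr rs. Qed.

Lemma shift_units X Y (U : isometry H H) :
  (forall a b, U (M (1 - s) s a b) = M s (1 - s) b a) ->
  unit_family M K X -> unit_family M K Y ->
  inner (U (M (1 / 2) (1 / 2) (X (1 / 2)) (Y (1 / 2))))
    (M (1 / 2) (1 / 2) (X (1 / 2)) (Y (1 / 2))) =
  inner (Y s) (X s) * inner (X s) (Y s).
Proof.
move=> hU Xu Yu; have [X1 X2] := halves Xu; have [Y1 Y2] := halves Yu.
rewrite {1}Y2 (shift_half _ _ _ hU) Y1 {2}X1 split_first !gmul_inner X2 gmul_inner.
by rewrite (innerXX Xu r0) (innerXX Yu r0) mul1r mulr1.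
Qed.

(** The shifted vector begins with X_s or Y_s, the vector itself with X_s; since
    X and Y are orthogonal, only one of the four terms survives. *)
Lemma shift_twisted X Y p q (U : isometry H H) :
  (forall a b, U (M (1 - s) s a b) = M s (1 - s) b a) ->
  unit_family M K X -> twisted_family M K X Y p q ->
  inner (U (M (1 / 2) (1 / 2) (X (1 / 2)) (Y (1 / 2))))
    (M (1 / 2) (1 / 2) (X (1 / 2)) (Y (1 / 2))) =
  p s * (q s)^*%R * inner (Y (1 / 2 - s)) (Y (1 / 2 - s)).
Proof.
move=> hU Xu [Y0 YD _]; have [X1 X2] := halves Xu.
have Y1 : Y (1 / 2) = p (1 / 2 - s) *: M s (1 / 2 - s) (Y s) (X (1 / 2 - s)) +
    q s *: M s (1 / 2 - s) (X s) (Y (1 / 2 - s)).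
  by have [_ _ <-] := YD _ _ s0 r0; rewrite sr.
have Y2 : Y (1 / 2) = p s *: M (1 / 2 - s) s (Y (1 / 2 - s)) (X s) +
    q (1 / 2 - s) *: M (1 / 2 - s) s (X (1 / 2 - s)) (Y s).
  by have [_ _ <-] := YD _ _ r0 s0; rewrite rs.
have [_ _ os] := Y0 _ s0; have [_ _ or] := Y0 _ r0.
have os' : inner (Y s) (X s) = 0 by rewrite innerC os rmorph0.
have or' : inner (Y (1 / 2 - s)) (X (1 / 2 - s)) = 0 by rewrite innerC or rmorph0.
set f := M _ _ _ _.
have Uf : U f = p s *: M s (1 - s) (X s) (M (1 / 2) (1 / 2 - s) (X (1 / 2)) (Y (1 / 2 - s))) +
    q (1 / 2 - s) *: M s (1 - s) (Y s) (M (1 / 2) (1 / 2 - s) (X (1 / 2)) (X (1 / 2 - s))).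
  by rewrite /f Y2 !gmulE linearD !linearZ /= !(shift_half _ _ _ hU).
have fE : f = M s (1 - s) (X s) (p (1 / 2 - s) *: M (1 / 2) (1 / 2 - s)
      (M (1 / 2 - s) s (X (1 / 2 - s)) (Y s)) (X (1 / 2 - s)) +
    q s *: M (1 / 2) (1 / 2 - s) (X (1 / 2)) (Y (1 / 2 - s))).
  by rewrite /f Y1 X1 !gmulE !split_first -X2 -X1.
rewrite Uf fE innerDl !innerZl !gmul_inner os' mul0r mulr0 addr0 (innerXX Xu s0) mul1r.
rewrite innerDr !innerZr !gmul_inner or' !mulr0 add0r.
have h1 : 0 < 1 / 2 :> rat by [].
by rewrite (innerXX Xu h1) mul1r mulrA.
Qed.
End Halves.

(** By continuity the inner product of [shift_units] has positive real part. *)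
Lemma unit_inner_small X Y : unit_family M K X -> unit_family M K Y ->
  exists2 d : rat, 0 < d & forall s, 0 < s < d -> inner (X s) (Y s) != 0.
Proof.
move=> Xu Yu; have h0 : 0 < 1 / 2 :> rat by rewrite divr_gt0.
have f0 : M (1 / 2) (1 / 2) (X (1 / 2)) (Y (1 / 2)) != 0.
  by rewrite -normr_eq0 gmul_norm (proj2 (Xu.1 _ h0)) (proj2 (Yu.1 _ h0)) mulr1 oner_eq0.
have [d d0 hd] := shift f0.
exists (Num.min d (1 / 2)) => [|s /andP[s0]]; first by rewrite lt_min d0.
rewrite lt_min => /andP[sd s2].
have [||U hU] := hd s; [by rewrite s0|by apply: lt_trans s2 _; rewrite ltr_pdivrMr// mul1r ltr1n|].
rewrite (shift_units s0 s2 hU Xu Yu); apply: contraTneq => ->.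
by rewrite mulr0 ltxx.
Qed.

Lemma twisted_small X Y p q : unit_family M K X -> twisted_family M K X Y p q ->
  exists2 d : rat, 0 < d & forall s, 0 < s < d -> 0 < complex.Re (p s * (q s)^*%R).
Proof.
move=> Xu Yu; have h0 : 0 < 1 / 2 :> rat by rewrite divr_gt0.
have [Y0 _ _] := Yu; have [_ Yh0 _] := Y0 _ h0.
have f0 : M (1 / 2) (1 / 2) (X (1 / 2)) (Y (1 / 2)) != 0.
  by rewrite -normr_eq0 gmul_norm (proj2 (Xu.1 _ h0)) mul1r normr_eq0.
have [d d0 hd] := shift f0.
exists (Num.min d (1 / 2)) => [|s /andP[s0]]; first by rewrite lt_min d0.
rewrite lt_min => /andP[sd s2].
have [||U hU] := hd s; [by rewrite s0|by apply: lt_trans s2 _; rewrite ltr_pdivrMr// mul1r ltr1n|].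
rewrite (shift_twisted s0 s2 hU Xu Yu) rsqE.
have r0 : 0 <= rsq (Y (1 / 2 - s)).
  by rewrite /rsq -lecR -rsqE dnorm_ge0.
case: (p s * _) => a b /=; rewrite mulr0 subr0 => ab0.
by rewrite -(pmulr_lgt0 _ (_ : 0 < rsq (Y (1 / 2 - s))))//; rewrite lt0r r0 andbT;
  apply: contraTneq ab0 => ->; rewrite mulr0 ltxx.
Qed.

Lemma Re_norm (z : C) : `|z| = (complex.Re `|z|)%:C.
Proof. by rewrite RRe_real. Qed.

Lemma unit_scale (X : rat -> H) (g : rat -> C) : character g ->
  (forall s, 0 < s -> `|g s| = 1) -> unit_family M K X ->
  unit_family M K (fun s => g s *: X s).
Proof.
move=> gm g1 [XK XD]; split=> [s s0|s t s0 t0].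
  have [Kx nx] := XK s s0; split; first exact: (spZ KP).
  by rewrite normrZ nx g1// mulr1.
by rewrite gm// XD// !gmulE scalerA.
Qed.

(** g t is a power of g (t / N). *)
Lemma character_neq0 (g : rat -> C) : character g ->
  (exists2 d : rat, 0 < d & forall s, 0 < s < d -> g s != 0) ->
  forall t, 0 < t -> g t != 0.
Proof.
move=> gM [d d0 hd] t t0.
have [N [N0 Nt]] : exists N : nat, (0 < N)%N /\ t / N%:R < d.
  have td : 0 < d / t by rewrite divr_gt0.
  have [N _ hN] := near_infty_natSinv_lt (PosNum td).
  exists N.+1; split=> //; have := hN N (leqnn _); rewrite /= ltr_pdivlMr// mulrC.
  by [].
have -> : t = N%:R * (t / N%:R) by rewrite mulrC divfK// pnatr_eq0 -lt0n.
have t1 : 0 < t / N%:R by rewrite divr_gt0// ltr0n.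
by rewrite (character_mulrn gM)// expf_neq0// hd// t1.
Qed.

Lemma character_polar (g : rat -> C) : character g -> (forall t, 0 < t -> g t != 0) ->
  exists (c : R) (th : rat -> C), [/\ 0 < c, character th,
    forall t, 0 < t -> `|th t| = 1 &
    forall t, 0 < t -> g t = (c `^ ratr t)%:C * th t /\ `|g t| = (c `^ ratr t)%:C].
Proof.
move=> gM g0; pose r t : R := complex.Re `|g t|.
have rE t : `|g t| = (r t)%:C by exact: Re_norm.
have r0 t : 0 < t -> 0 < r t by move=> t0; rewrite -ltcR -rE normr_gt0 g0.
have rM : character r.
  by move=> s t s0 t0; apply: (@complexI R); rewrite -rE gM// normrM !rE rmorphM.
exists (r 1), (fun t => g t / `|g t|); split; first exact: r0.
- by move=> s t s0 t0; rewrite gM// normrM invfM mulrACA.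
- by move=> t t0; rewrite normrM normfV normr_id divff// normr_eq0 g0.
- move=> t t0; rewrite -(positive_character rM r0 t0) -rE; split=> //.
  by rewrite mulrC divfK// normr_eq0 g0.
Qed.

(** The inner product of the two families is a nonvanishing character; its modulus
    is an exponential, and multiplying Y by its phase leaves only the modulus.
    The base is less than 1 because X_1 and Y_1 are independent. *)
Theorem unit_pair_normal X Y : unit_pair M K X Y -> exists Z (a : R),
  [/\ 0 < a < 1, unit_family M K Z &
    forall t, 0 < t -> inner (X t) (Z t) = (a `^ ratr t)%:C].
Proof.
move=> [Xu Yu ind]; pose phi s := inner (X s) (Y s).
have phiM : character phi by move=> s t s0 t0; rewrite /phi Xu.2// Yu.2// gmul_inner.
have phi0 := character_neq0 phiM (unit_inner_small Xu Yu).
have [a [th [a0 thM th1 phiE]]] := character_polar phiM phi0.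
exists (fun t => th t *: Y t), a; split.
- rewrite a0/=.
  have one : (0 : rat) < 1 by [].
  have xx := innerXX Xu one; have yy := innerXX Yu one.
  have [_ v0] := indep_neq0 (indep_shear (c := - inner (Y 1) (X 1)) (ind 1 one)).
  have : 0 < inner (Y 1 + - inner (Y 1) (X 1) *: X 1) (Y 1 + - inner (Y 1) (X 1) *: X 1).
    by rewrite dnorm_gt0.
  rewrite innerDr innerZr !innerDl !innerZl xx yy mulr1 subrr mulr0 addr0 mulNr.
  rewrite -/(phi 1) [inner (Y 1) (X 1)]innerC -/(phi 1) mulrC -normCK subr_gt0.
  have [_ ->] := phiE _ one; rewrite rmorph1 powRr1 ?ltW//.
  by rewrite -rmorphXn /= ltcR expr_lt1// ltW.
- exact: unit_scale.
- move=> t t0; rewrite innerZr -/(phi t); have [-> _] := phiE t t0.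
  by rewrite mulrCA [_^*%R * _]mulrC -normCK th1// expr1n mulr1.
Qed.

(** Dividing Y by p turns the rule into W_(s+t) = W_s X_t + k_s X_s W_t with
    k = q / p. The modulus of k is an exponential c^t, and its phase is one by
    [circle_character]. Hence N_(s+t) = N_s + c^(2s) N_t for the squared norms N of
    W: for c = 1 this is additivity, and otherwise symmetry in s and t, applied
    to t and 1, determines N up to the factor N_1, which is scaled away. *)
Theorem twisted_normal X Y p q : unit_family M K X -> twisted_family M K X Y p q ->
  exists (Z : rat -> H) (c b : R), 0 < c /\ forall s t, 0 < s -> 0 < t ->
    [/\ K t (Z t), inner (X t) (Z t) = 0,
      inner (Z t) (Z t) = (if c == 1 then ratr t
        else (c `^ (2 * ratr t) - 1) / (c ^+ 2 - 1))%:C &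
      Z (s + t) = M s t (Z s) (X t) +
        ((c `^ ratr s)%:C * cis (b * ratr s)) *: M s t (X s) (Z t)].
Proof.
move=> Xu Yu; have [Y0 YD _] := Yu.
have [d d0 hd] := twisted_small Xu Yu.
have pM : character p by move=> s t s0 t0; have [] := YD s t s0 t0.
have qM : character q by move=> s t s0 t0; have [] := YD s t s0 t0.
have p0 : forall t, 0 < t -> p t != 0.
  apply: (character_neq0 pM); exists d => // s /hd; apply: contraTneq => ->.
  by rewrite mul0r ltxx.
have q0 : forall t, 0 < t -> q t != 0.
  apply: (character_neq0 qM); exists d => // s /hd; apply: contraTneq => ->.
  by rewrite rmorph0 mulr0 ltxx.
pose k t := q t / p t.
have kM : character k by move=> s t s0 t0; rewrite /k pM// qM// invfM mulrACA.
have k0 t : 0 < t -> k t != 0 by move=> t0; rewrite mulf_neq0 ?invr_eq0 ?p0 ?q0.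
have [c [th [c0 thM th1 kE]]] := character_polar kM k0.
have thRe s : 0 < s < d -> 0 < complex.Re (th s).
  move=> sd; have s0 : 0 < s by case/andP: sd.
  have := hd s sd; have -> : q s = p s * k s by rewrite /k mulrC divfK// p0.
  rewrite rmorphM mulrA -normCK (proj1 (kE s s0)) (Re_norm (p s)).
  move: (complex.Re `|p s|) (c `^ _) (powR_gt0 (ratr s) c0) (th s) => m e e0 [x y].
  have -> : complex.Re (m%:C ^+ 2 * (e%:C * (x +i* y))^*%R) = m ^+ 2 * (e * x).
    by rewrite -rmorphXn /=; ring.
  have m0 : 0 <= m ^+ 2 by exact: sqr_ge0.
  by rewrite mulrCA pmulr_rgt0//= => h; nra.
have [b thE] := circle_character thM d0 th1 thRe.
pose W t := (p t)^-1 *: Y t.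
have WD s t : 0 < s -> 0 < t -> W (s + t) = M s t (W s) (X t) + k s *: M s t (X s) (W t).
  move=> s0 t0; rewrite /W; have [-> _ ->] := YD s t s0 t0.
  rewrite !gmulE; apply: inner_ext => z; rewrite !innerE /k.
  by field; rewrite !p0.
have XW t : 0 < t -> inner (X t) (W t) = 0.
  by move=> t0; have [_ _ xy] := Y0 t t0; rewrite /W innerZr xy mulr0.
have WX t : 0 < t -> inner (W t) (X t) = 0.
  by move=> t0; rewrite innerC XW// rmorph0.
pose N t := rsq (W t).
have ND s t : 0 < s -> 0 < t -> N (s + t) = N s + c `^ (2 * ratr s) * N t.
  move=> s0 t0; apply: (@complexI R); rewrite /N -rsqE WD// innerDl !innerDr.
  rewrite !innerZl !innerZr !gmul_inner (XW _ s0) (WX _ s0) !(mul0r, mulr0, addr0, add0r).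
  rewrite (innerXX Xu s0) (innerXX Xu t0) mulr1 mul1r [k s * _]mulrA -normCK (proj2 (kE s s0)).
  have -> : c `^ (2 * ratr s) = (c `^ ratr s) ^+ 2.
    by rewrite mulrC powRrM (powR_mulrn 2) ?powR_ge0.
  by rewrite !rsqE rmorphD rmorphM /= rmorphXn.
have N0 t : 0 < t -> 0 < N t.
  move=> t0; rewrite /N -ltcR -rsqE dnorm_gt0 /W scaler_eq0 invr_eq0 negb_or p0//.
  by have [_ -> _] := Y0 t t0.
have one : (0 : rat) < 1 by [].
pose l : C := (Num.sqrt (N 1))%:C^-1.
have ll : l * l^*%R = (N 1)^-1%:C.
  have -> : l^*%R = l.
    rewrite /l fmorphV; congr (_^-1).
    by apply/CrealP; rewrite ger0_real// lecR sqrtr_ge0.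
  by rewrite /l -invfM -rmorphM /= -expr2 sqr_sqrtr ?ltW ?N0// fmorphV.
exists (fun t => l *: W t), c, b; split=> // s t s0 t0; split.
- by apply: (spZ KP) => //; apply: (spZ KP) => //; have [] := Y0 t t0.
- by rewrite innerZr XW// mulr0.
- rewrite innerZl innerZr mulrA ll rsqE -/(N t) -rmorphM /=; congr (_%:C).
  have N1 : N 1 != 0 by rewrite gt_eqF// N0.
  have [c1|c1] := eqVneq c 1.
    have ND' s' t' : 0 < s' -> 0 < t' -> N (s' + t') = N s' + N t'.
      by move=> *; rewrite ND// c1 powR1 mul1r.
    by rewrite (additive_on_rat ND' t0) mulrC mulfK.
  have c2 : c ^+ 2 - 1 != 0.
    rewrite subr_eq0 -[1](expr1n R 2) eqrXn2 ?ltW// ler01.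
  have c1E : c `^ (2 * ratr 1) = c ^+ 2.
    by rewrite rmorph1 mulr1 (powR_mulrn 2) ?ltW.
  have E : (c ^+ 2 - 1) * N t = (c `^ (2 * ratr t) - 1) * N 1.
    have := ND 1 t one t0; rewrite addrC (ND t 1 t0 one) c1E => h.
    transitivity (N 1 + c ^+ 2 * N t - N 1 - N t); first by ring.
    by rewrite -h; ring.
  have -> : N t = (c `^ (2 * ratr t) - 1) * N 1 / (c ^+ 2 - 1) by rewrite -E mulrAC divff// mul1r.
  by field; rewrite N1 c2.
- rewrite WD// -thE// -(proj1 (kE s s0)) !gmulE; vec.
Qed.

End Normalisation.

(** * The classification *)

Section Representation.
Variables (R : realType) (E : rational_subproduct_system R) (A : arveson_system R).
Variable rep : representation E A.
Variables (H : hilbertType R) (U : forall t, unitary (A t) H).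
Local Notation C := R[i].
Local Notation al := (repr_map rep).

Definition embed (t : {posnum rat}) (e : E t) : H := U (qtime R t) (al t e).

Lemma embedP t : linear (@embed t).
Proof. by move=> a x y; rewrite /embed !linearP. Qed.

HB.instance Definition _ t := GRing.isLinear.Build C (E t) H _ (@embed t) (@embedP t).

Lemma embed_norm t (e : E t) : `|embed e| = `|e|.
Proof. by rewrite /embed !isometry_norm. Qed.

Lemma embed_inner t (e f : E t) : inner (embed e) (embed f) = inner e f.
Proof. by rewrite /embed !isometry_inner. Qed.

(** The vector of H represented by a tensor of E; on [sub_beta e] it agrees with
    [embed e]. So identities for the structure maps of E can be checked in H. *)
Definition tensor_embed s t (w : E s ⊠ E t) : H :=
  U (tadd (qtime R s) (qtime R t))
    (unitary_inv (arv_beta A (qtime R s) (qtime R t)) (tmap (al s) (al t) w)).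

Lemma tensor_embed_inj s t : injective (@tensor_embed s t).
Proof.
move=> x y /isometry_inj e; apply: (@isometry_inj _ _ _ (tmap (al s) (al t))).
by rewrite -[LHS](unitary_invK (arv_beta A (qtime R s) (qtime R t))) e
  (unitary_invK (arv_beta A (qtime R s) (qtime R t))).
Qed.

Lemma tensor_embedP s t : linear (@tensor_embed s t).
Proof.
move=> a x y; rewrite /tensor_embed.
have -> : tmap (al s) (al t) (a *: x + y) = a *: tmap (al s) (al t) x + tmap (al s) (al t) y.
  exact: linearP.
have -> := unitary_inv_linear (arv_beta A (qtime R s) (qtime R t)) a
  (tmap (al s) (al t) x) (tmap (al s) (al t) y).
exact: linearP.
Qed.

HB.instance Definition _ s t :=
  GRing.isLinear.Build C (E s ⊠ E t) H _ (@tensor_embed s t) (@tensor_embedP s t).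

Lemma tensor_embed_pure s t (e : E s) (f : E t) :
  tensor_embed (e ⊗ f) = time_mul U (qtime R s) (qtime R t) (embed e) (embed f).
Proof. by rewrite /tensor_embed /time_mul /embed tmapE !unitaryK. Qed.

Lemma tensor_embed_beta s t (e : E (tadd s t)) :
  tensor_embed (sub_beta E s t e) = embed e.
Proof.
rewrite /tensor_embed -repr_beta unitaryK /embed.
exact: U_tcast.
Qed.

Let ratrD (s t : rat) : ratr (s + t) = ratr s + ratr t :> R.
Proof. exact: rmorphD. Qed.
Let ratr_pos (t : rat) : qpos t -> 0 < ratr t :> R.
Proof. by rewrite /qpos ltr0q. Qed.

Definition rational_product : graded_product H (+%R : rat -> rat -> rat) qpos :=
  gp_pull (real_product U) ratrD ratr_pos.

Definition rational_fiber (t : rat) (x : H) : Prop := exists e : E (topos t), x = embed e.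

Lemma rational_productE (s t : {posnum rat}) a b :
  rational_product s%:num t%:num a b = time_mul U (qtime R s) (qtime R t) a b.
Proof.
have q (u : {posnum rat}) : topos (ratr u%:num) = qtime R u.
  by apply: val_inj; rewrite /= toposK// ltr0q.
by rewrite /= !q.
Qed.

Lemma rational_sp : subproduct rational_product rational_fiber.
Proof.
split.
- move=> t a x y [e ->] [f ->]; exists (a *: e + f); by rewrite linearP.
- move=> t t0; have [u [v [uu vv uv sp]]] := has_dim2_orthonormal (sub_dim2 E (topos t)).
  exists (embed u), (embed v); split; [by exists u|by exists v| |].
    have nz (w : E (topos t)) : inner w w = 1 -> embed w != 0.
      move=> ww; apply/eqP => w0; have := embed_inner w w.
      by rewrite w0 inner0l ww => /esym/eqP; rewrite oner_eq0.
    by apply: orth_indep; [exact: nz|exact: nz|rewrite embed_inner].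
  move=> z [e ->]; exists (inner e u), (inner e v).
  by rewrite {1}(sp e) linearD !linearZ.
- move=> s t u s0 t0; rewrite /rational_fiber toposD// => -[e ->].
  have [g [g' [h [h' eE]]]] := tensor_dim2 (sub_beta E (topos s) (topos t) e)
    (sub_dim2 E _) (sub_dim2 E _).
  exists (embed g), (embed g'), (embed h), (embed h'); split; try by eexists.
  rewrite -tensor_embed_beta eE linearD /= !tensor_embed_pure.
  by rewrite -!rational_productE !toposK.
Qed.

Lemma fiber_lift (X : rat -> H) : (forall t, 0 < t -> rational_fiber t (X t)) ->
  exists x : forall t, E t, forall t, embed (x t) = X t%:num.
Proof.
move=> KX.
have h (t : {posnum rat}) : exists e : E t, embed e = X t%:num.
  have [e ->] : rational_fiber t%:num (X t%:num) by apply: KX.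
  by move: e; rewrite topos_num => e; exists e.
by exists (fun t => projT1 (cid (h t))) => t; case: cid.
Qed.

Lemma beta_eq s t (e : E (tadd s t)) (w : E s ⊠ E t) :
  embed e = tensor_embed w -> sub_beta E s t e = w.
Proof. by rewrite -tensor_embed_beta => /tensor_embed_inj. Qed.

End Representation.

Theorem theorem4p6 (R : realType) (E : rational_subproduct_system R)
    (hrep : exists A : arveson_system R, inhabited (representation E A)) :
  exists x y : forall t, E t,
    (multiplicative_pair x y /\ ~ twisted_additive_pair x y) \/
    (~ multiplicative_pair x y /\ twisted_additive_pair x y).
Proof.
have exclusive (x y : forall t, E t) : multiplicative_pair x y -> ~ twisted_additive_pair x y.
  move=> [a a01 h1] [c [b [_ h2]]]; have [_ _ + _ _] := h1 1%:pos 1%:pos.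
  have [_ -> _ _ _] := h2 1%:pos 1%:pos => /esym/complexI/eqP.
  by rewrite gt_eqF// powR_gt0//; case/andP: a01.
suff [x [y [h|h]]] : exists x y : forall t, E t,
    multiplicative_pair x y \/ twisted_additive_pair x y.
  - by exists x, y; left; split=> //; exact: exclusive.
  - by exists x, y; right; split=> // h'; exact: exclusive h' h.
have [A [rep]] := hrep; have [H [U [Hsep _ Umeas Vmeas]]] := arv_trivial A.
pose M := real_product U.
have shift (f : H) : f != 0 -> exists2 d : rat, 0 < d &
    forall s, 0 < s < d -> s < 1 -> exists2 V : isometry H H,
      (forall a b, V (rational_product U (1 - s) s a b) = rational_product U s (1 - s) b a) &
      0 < complex.Re (inner (V f) f).
  move=> f0; have [||d d0 hd] := @shift_continuous R H M (real_product_dense U) Hsep _ _ f f0.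
  - move=> a b g; apply: (real_product_measurable Umeas Vmeas).
    + exact: measurable_funB.
    + exact: measurable_id.
    + by move=> t /andP[]; rewrite subr_gt0.
    + by move=> t /andP[].
  - move=> a b g; apply: (real_product_measurable Umeas Vmeas).
    + exact: measurable_id.
    + exact: measurable_funB.
    + by move=> t /andP[].
    + by move=> t /andP[]; rewrite subr_gt0.
  have [N Nd] : exists N : nat, (N.+1%:R : R)^-1 < d.
    have [N _ hN] := near_infty_natSinv_lt (PosNum d0).
    by exists N; apply: hN => /=.
  exists (N.+1%:R)^-1 => // s /andP[s0 sN] s1.
  have [||V hV Vf] := hd (ratr s).
  - rewrite ltr0q s0 (lt_trans _ Nd)//.
    have -> : (N.+1%:R : R)^-1 = ratr (N.+1%:R)^-1 by rewrite fmorphV /= ratr_nat.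
    by rewrite ltr_rat.
  - by rewrite -(rmorph1 (@ratr R)) ltr_rat.
  - exists V => // a b; have := hV a b.
    have -> : 1 - ratr s = ratr (1 - s) :> R by rewrite rmorphB rmorph1.
    exact.
have KP := rational_sp rep U.
have MD X Y Z (x y z : forall t, E t) : (forall t, embed rep U (x t) = X t%:num) ->
  (forall t, embed rep U (y t) = Y t%:num) -> (forall t, embed rep U (z t) = Z t%:num) ->
  forall s t : {posnum rat}, 
    tensor_embed rep U (y s ⊗ z t) = rational_product U s%:num t%:num (Y s%:num) (Z t%:num).
  by move=> xX yY zZ s t; rewrite tensor_embed_pure yY zZ rational_productE.
have [[X [Y XY]]|[X [Y [p [q [Xu Yt]]]]]] := rational_families KP.
- have [Xu _ _] := XY; have [Z [a [a01 Zu XZ]]] := unit_pair_normal KP shift XY.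
  have [x xE] := fiber_lift (fun t t0 => proj1 (Xu.1 t t0)).
  have [z zE] := fiber_lift (fun t t0 => proj1 (Zu.1 t t0)).
  exists x, z; left; exists a => // s t; split.
  + by rewrite -(embed_norm rep U) xE (proj2 (Xu.1 _ _)).
  + by rewrite -(embed_norm rep U) zE (proj2 (Zu.1 _ _)).
  + by rewrite -(embed_inner rep U) xE zE XZ.
  + by apply: (@beta_eq _ _ _ rep _ U); rewrite xE (MD X X X x x x)// -Xu.2.
  + by apply: (@beta_eq _ _ _ rep _ U); rewrite zE (MD Z Z Z z z z)// -Zu.2.
- have [Z [c [b [c0 hZ]]]] := twisted_normal KP shift Xu Yt.
  have [x xE] := fiber_lift (fun t t0 => proj1 (Xu.1 t t0)).
  have KZ t : 0 < t -> rational_fiber rep U t (Z t).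
    by move=> t0; have [] := hZ t t t0 t0.
  have [z zE] := fiber_lift KZ.
  exists x, z; right; exists c, b; split=> // s t.
  have [_ XZ ZZ ZD] := hZ s%:num t%:num (gt0 s) (gt0 t); split.
  + by rewrite -(embed_norm rep U) xE (proj2 (Xu.1 _ _)).
  + by rewrite -(embed_inner rep U) xE zE XZ.
  + by rewrite -(embed_norm rep U) zE -inner_norm ZZ.
  + by apply: (@beta_eq _ _ _ rep _ U); rewrite xE (MD X X X x x x)// -Xu.2.
  + apply: (@beta_eq _ _ _ rep _ U); rewrite zE ZD linearD linearZ /=.
    by rewrite (MD X Z X x z x)// (MD X X Z x x z).
Qed.
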